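(* Let $\Omega\subset\mathbb{R}^d$ be open, $T>0$, and let $(\rho,u,p)$ be a weak solution on $(0,T)\times\Omega$ to the inhomogeneous incompressible Euler system with external force $f$. Assume that $u\in L^3((0,T)\times\Omega;\mathbb{R}^d)$, $p\in L^{3/2}((0,T)\times\Omega)$, $f\in L^{3/2}((0,T)\times\Omega;\mathbb{R}^d)$, and that $\rho\in L^\infty((0,T)\times\Omega)$ satisfies $\rho(t,x)\ge c>0$ for a.e. $(t,x)$ for some constant $c>0$. Fix a radial kernel $\eta\in C_c^\infty(B_1;[0,1])$ with $\int\eta=1$. Then the defect distribution $D$ satisfies $$D=\lim_{\ell\to0}\big(J_1^\ell-J_3^\ell\big)$$ in the sense of distributions, where $$J_1^\ell:=\overline{\rho}\,\big(\widetilde{u}\otimes\widetilde{u}-\widetilde{u\otimes u}\big):E\widetilde{u},\qquad E\widetilde{u}:=\frac{\nabla\widetilde{u}+(\nabla\widetilde{u})^T}{2},\qquad J_3^\ell:=\overline{p}\,\mathrm{div}(\widetilde{u}).$$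
   Context: The inhomogeneous incompressible Euler system is $$\partial_t(\rho u)+\mathrm{div}(\rho u\otimes u)+\nabla p=\rho f,\qquad \partial_t\rho+\mathrm{div}(\rho u)=0,\qquad \mathrm{div}(u)=0\qquad\text{in }(0,T)\times\Omega,$$ with $\rho\ge0$ the density, $u$ the velocity, $p$ the scalar (unknown) pressure and $f$ the external force; weak solutions are understood in the sense of distributions on $(0,T)\times\Omega$. The defect distribution $D$ is defined by $$-D:=\partial_t\Big(\frac{\rho|u|^2}{2}\Big)+\mathrm{div}\Big(u\Big(\frac{\rho|u|^2}{2}+p\Big)\Big)-\rho f\cdot u.$$ Mollification is in the space variable only: $\eta_\ell(x):=\ell^{-d}\eta(x/\ell)$ and, for a function $g$ (at each fixed time), $$\overline{g}:=g*\eta_\ell,\qquad \widetilde{g}:=\frac{\overline{\rho g}}{\overline{\rho}}=\frac{(\rho g)*\eta_\ell}{\rho*\eta_\ell}.$$ If $\Omega\ne\mathbb{R}^d$, these are defined at points of distance larger than $\ell$ from $\partial\Omega$; against a given compactly supported test function the expressions make sense for all small $\ell$. *)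

(* Defs.v *)
From HB Require Import structures.
From mathcomp Require Import all_boot all_order all_algebra.
From mathcomp Require Import all_classical all_reals all_analysis.

Set Implicit Arguments.
Unset Strict Implicit.
Unset Printing Implicit Defensive.
Import Order.TTheory GRing.Theory Num.Theory.
Import numFieldNormedType.Exports.

Local Open Scope classical_set_scope.
Local Open Scope ring_scope.

Definition measure_rV_display : measure_display.
Proof. exact: default_measure_display. Qed.

(* 'rV[R]_n with the sigma-algebra generated by the coordinates, i.e. the
   Borel sigma-algebra *)
Section measurable_rV.
Context {R : realType} (n : nat).

Let coord : 'I_n -> 'rV[R]_n -> R := fun i x => x ord0 i.

Let rV_set0 : g_sigma_preimage coord set0.
Proof. exact: sigma_algebra0. Qed.

Let rV_setC A : g_sigma_preimage coord A -> g_sigma_preimage coord (~` A).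
Proof. exact: sigma_algebraC. Qed.

Let rV_bigcup (F : _^nat) : (forall i, g_sigma_preimage coord (F i)) ->
  g_sigma_preimage coord (\bigcup_i (F i)).
Proof. exact: sigma_algebra_bigcup. Qed.

HB.instance Definition _ := @isMeasurable.Build measure_rV_display
  'rV[R]_n (g_sigma_preimage coord) rV_set0 rV_setC rV_bigcup.

End measurable_rV.

Section measurable_rV_lemmas.
Context {R : realType} (n : nat).

Lemma measurable_coord (i : 'I_n) :
  measurable_fun setT (fun x : 'rV[R]_n => x ord0 i).
Proof.
move=> _ Y mY; rewrite setTI; apply: sub_sigma_algebra => /=.
rewrite -bigcup_seq/=; exists i => /=; first by rewrite mem_index_enum.
by exists Y => //; rewrite setTI.
Qed.

Lemma measurable_fun_rV d (T : measurableType d) (f : T -> 'rV[R]_n) :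
  (forall i, measurable_fun setT (fun x => f x ord0 i)) -> measurable_fun setT f.
Proof.
move=> mf _ A mA; rewrite setTI.
suff : measurable `<=` [set B | measurable (f @^-1` B)] by exact.
apply: smallest_sub.
  split => [|B mB|F mF] /=.
  - by rewrite preimage_set0.
  - by rewrite setTD preimage_setC; exact: measurableC.
  - by rewrite preimage_bigcup; exact: bigcupT_measurable.
move=> B; rewrite -bigcup_seq/= => -[i _ [C mC <-]]/=.
by rewrite setTI -[X in measurable X]setTI; exact: mf.
Qed.

End measurable_rV_lemmas.

Section cons_rV.
Context {R : realType} (n : nat).

Definition cons_rV (z : measurableTypeR R * 'rV[R]_n) : 'rV[R]_n.+1 :=
  row_mx ((z.1 : R)%:M : 'rV_1) z.2.

Definition uncons_rV (x : 'rV[R]_n.+1) : measurableTypeR R * 'rV[R]_n :=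
  (x ord0 ord0, rsubmx (x : 'rV_(1 + n))).

Lemma cons_rVK : cancel cons_rV uncons_rV.
Proof.
move=> [t x]; rewrite /uncons_rV /cons_rV row_mxKr; congr pair.
have -> : (ord0 : 'I_n.+1) = lshift n (ord0 : 'I_1) by exact/val_inj.
by rewrite (row_mxEl (t%:M : 'rV[R]_1) x) mxE eqxx mulr1n.
Qed.

Lemma uncons_rVK : cancel uncons_rV cons_rV.
Proof.
move=> x; rewrite /cons_rV /uncons_rV /= -[RHS](@hsubmxK _ 1 1 n).
rewrite (_ : (x ord0 ord0)%:M = lsubmx (x : 'rV_(1 + n)))//.
apply/rowP => i; rewrite !ord1 !mxE eqxx mulr1n.
by congr (x _ _); apply/val_inj.
Qed.

Lemma measurable_cons_rV : measurable_fun setT cons_rV.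
Proof.
apply: measurable_fun_rV => i.
rewrite /cons_rV; under eq_fun do rewrite mxE.
case: (@fintype.split 1 n i) => [j|j].
  under eq_fun do rewrite (ord1 j) mxE eqxx mulr1n.
  exact: measurable_fst.
exact: (measurableT_comp (measurable_coord j) measurable_snd).
Qed.

Lemma measurable_uncons_rV : measurable_fun setT uncons_rV.
Proof.
apply/measurable_fun_pairP; split; first exact: measurable_coord.
apply: measurable_fun_rV => i; rewrite /uncons_rV /=.
by under eq_fun do rewrite mxE; exact: measurable_coord.
Qed.

End cons_rV.

Section lebesgue_rV_step.
Context {R : realType} (n : nat).
Variable m : {sigma_finite_measure set 'rV[R]_n -> \bar R}.

Definition lebesgue_rV_step : set 'rV[R]_n.+1 -> \bar R :=
  pushforward (lebesgue_measure \x m)%E (@cons_rV R n).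


Let step0 : lebesgue_rV_step set0 = 0%E.
Proof. by rewrite /lebesgue_rV_step /pushforward preimage_set0 measure0. Qed.

Let step_ge0 A : (0 <= lebesgue_rV_step A)%E.
Proof. exact: (measure_ge0 (lebesgue_measure \x m)%E). Qed.

Let mcons := @measurable_cons_rV R n.

Let step_sigma_additive : semi_sigma_additive lebesgue_rV_step.
Proof.
exact: (@measure_semi_sigma_additive _ _ _
  (pushforward (lebesgue_measure \x m)%E (mfun_Sub (mem_set mcons)))).
Qed.

HB.instance Definition _ := isMeasure.Build _ _ _ lebesgue_rV_step
  step0 step_ge0 step_sigma_additive.

Let step_sigma_finite : sigma_finite setT lebesgue_rV_step.
Proof.
have [F TF Foo] := lebesgue_integral_fubini.product_measure_sigma_finite_subproof lebesgue_measure m.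
exists (fun k => @uncons_rV R n @^-1` F k).
  by rewrite -preimage_bigcup -TF preimage_setT.
move=> k; have [mF Fk] := Foo k; split.
  by rewrite -[X in measurable X]setTI; exact: measurable_uncons_rV.
rewrite /lebesgue_rV_step /pushforward -comp_preimage.
rewrite (_ : _ \o _ = id) ?preimage_id//.
by apply/funext => z /=; rewrite cons_rVK.
Qed.

HB.instance Definition _ := Measure_isSigmaFinite.Build _ _ _ lebesgue_rV_step
  step_sigma_finite.

End lebesgue_rV_step.

(* Lebesgue measure on R^n, see lebesgue_rV_box *)
Fixpoint lebesgue_rV {R : realType} (n : nat) :
    {sigma_finite_measure set 'rV[R]_n -> \bar R} :=
  match n with
  | 0 => \d_(0 : 'rV[R]_0)
  | k.+1 => lebesgue_rV_step (lebesgue_rV k)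
  end.

Lemma measurable_box (R : realType) (n : nat) (A : 'I_n -> set R) :
  (forall i, measurable (A i)) ->
  measurable [set x : 'rV[R]_n | forall i, A i (x ord0 i)].
Proof.
move=> mA.
have -> : [set x : 'rV[R]_n | forall i, A i (x ord0 i)] =
    \bigcap_(i in [set: 'I_n]) [set x | A i (x ord0 i)].
  by apply/seteqP; split => x /= h i; [move=> _|]; exact: h.
apply: fin_bigcap_measurable => // i _.
by rewrite -[X in measurable X]setTI; exact: measurable_coord.
Qed.

Lemma lebesgue_rV_box (R : realType) (n : nat) (A : 'I_n -> set R) :
  (forall i, measurable (A i)) ->
  lebesgue_rV n [set x | forall i, A i (x ord0 i)] =
  (\prod_(i < n) lebesgue_measure (A i))%E.
Proof.
elim: n A => [|n IH] A mA.
  rewrite big_ord0 /= diracE mem_set//= => -[]//.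
have mA' i : measurable (A (lift ord0 i)) by [].
rewrite big_ord_recl -(IH _ mA')/= /lebesgue_rV_step /pushforward.
transitivity ((lebesgue_measure \x lebesgue_rV n)%E
  (A ord0 `*` [set x : 'rV[R]_n | forall i, A (lift ord0 i) (x ord0 i)]));
    last first.
  by rewrite product_measure1E//; [exact: mA|exact: (measurable_box mA')].
have E0 t (x : 'rV[R]_n) : cons_rV (t, x) ord0 ord0 = t :> R.
  by have [] := cons_rVK (t, x).
have ES t (x : 'rV[R]_n) i : cons_rV (t, x) ord0 (lift ord0 i) = x ord0 i :> R.
  have [_ /rowP/(_ i) <-] := cons_rVK (t, x).
  by rewrite [RHS]mxE; congr (cons_rV _ _ _); exact/val_inj.
congr (_ _); apply/seteqP; split => -[t x]/= => [h|[h0 h] i].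
  by split => [|i]; [rewrite -(E0 t x)|rewrite -(ES t x)]; exact: h.
have [->|[j ->]] : i = ord0 \/ exists j, i = lift ord0 j.
  by case: (unliftP ord0 i) => [j ->|->]; [right; exists j|left].
- by rewrite E0.
- by rewrite ES.
Qed.

Section spacetime_measure.
Context {R : realType} (d : nat).

(* Lebesgue measure on the space-time R * R^d *)
Definition lebesgue_st : set (measurableTypeR R * 'rV[R]_d) -> \bar R :=
  (lebesgue_measure \x lebesgue_rV d)%E.

HB.instance Definition _ := Measure.on lebesgue_st.

(* the library instance for products of sigma-finite measures is shadowed by
   the one for products of subprobabilities *)
HB.instance Definition _ := Measure_isSigmaFinite.Build _ _ _ lebesgue_st
  (lebesgue_integral_fubini.product_measure_sigma_finite_subproof
     lebesgue_measure (lebesgue_rV d)).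

End spacetime_measure.
Arguments lebesgue_st {R} d _.

Notation spacetime R d := (R * 'rV[R]_d)%type.

Section vectors.
Context {R : realType} {d : nat}.

Definition dotv (x y : 'rV[R]_d) : R := \sum_i x ord0 i * y ord0 i.

(* the library norm on 'rV[R]_d is the sup norm *)
Definition enorm (x : 'rV[R]_d) : R := Num.sqrt (dotv x x).

Definition tensor (x y : 'rV[R]_d) : 'M[R]_d := x^T *m y.

Definition ddot (A B : 'M[R]_d) : R := \sum_i \sum_j A i j * B i j.

Definition basis_vec (i : 'I_d) : 'rV[R]_d := delta_mx ord0 i.

End vectors.

Section test_functions.
Context {R : realType} {V : normedModType R}.

Fixpoint Ck (k : nat) (f : V -> R) : Prop :=
  if k is k'.+1 then
    continuous f /\ forall v, (forall x, derivable f x v) /\ Ck k' ('D_v f)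
  else continuous f.

Definition smooth (f : V -> R) := forall k, Ck k f.

Definition tsupp (f : V -> R) : set V := closure [set x | f x != 0].

Definition test_function (A : set V) (f : V -> R) :=
  [/\ smooth f, compact (tsupp f) & tsupp f `<=` A].

End test_functions.

(* g belongs to L^p(Q) *)
Definition LpOn d (X : measurableType d) (R : realType)
    (mu : {measure set X -> \bar R}) (Q : set X) (p : \bar R) (g : X -> R) :=
  measurable_fun Q g /\ finite_norm mu p (g \_ Q).

Section distributions.
Context {R : realType} {d : nat}.
Implicit Types (Q : set (spacetime R d)) (S : (spacetime R d -> R) -> R).

(* A distribution on Q is represented by its action on functions; only its
   values on the test functions with support in Q are meaningful. *)
Definition distribution := (spacetime R d -> R) -> R.

Definition distr_of Q (g : spacetime R d -> R) : distribution :=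
  fun phi => \int[lebesgue_st d]_(z in Q) (g z * phi z).

Definition distr_dt S : distribution :=
  fun phi => - S ('D_((1, 0) : spacetime R d) phi).

Definition distr_dx (i : 'I_d) S : distribution :=
  fun phi => - S ('D_((0, basis_vec i) : spacetime R d) phi).

Definition distr_div (S : 'I_d -> distribution) : distribution :=
  \sum_i distr_dx i (S i).

Definition distr_eq Q S S' :=
  forall phi, test_function Q phi -> S phi = S' phi.

Definition distr_cvg0 Q (S : R -> distribution) S' :=
  forall phi, test_function Q phi -> S l phi @[l --> 0^'+] --> S' phi.

End distributions.
Arguments distribution : clear implicits.

Section euler.
Context {R : realType} {d : nat}.
Variable Q : set (spacetime R d).
Variables (rho p : spacetime R d -> R) (u f : spacetime R d -> 'rV[R]_d).

(* The equations are read componentwise. The notion is meaningful when the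
   functions below are locally integrable on Q. *)
Definition euler_weak_solution :=
  [/\ forall i, distr_eq Q
        (distr_dt (distr_of Q (fun z => rho z * u z ord0 i))
         + distr_div (fun j => distr_of Q
             (fun z => rho z * tensor (u z) (u z) i j))
         + distr_dx i (distr_of Q p))
        (distr_of Q (fun z => rho z * f z ord0 i)),
      distr_eq Q
        (distr_dt (distr_of Q rho)
         + distr_div (fun j => distr_of Q (fun z => rho z * u z ord0 j)))
        0
    & distr_eq Q (distr_div (fun j => distr_of Q (fun z => u z ord0 j))) 0].

Definition kinetic (z : spacetime R d) : R := rho z * enorm (u z) ^+ 2 / 2.

Definition defect : distribution R d :=
  - (distr_dt (distr_of Q kinetic)
     + distr_div (fun i => distr_of Q
         (fun z => u z ord0 i * (kinetic z + p z)))
     - distr_of Q (fun z => rho z * dotv (f z) (u z))).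

End euler.

Section mollification.
Context {R : realType} {d : nat}.

Record radial_kernel (eta : 'rV[R]_d -> R) : Prop := RadialKernel {
  kernel_test : test_function [set x | enorm x < 1] eta ;
  kernel_itv : forall x, 0 <= eta x <= 1 ;
  kernel_radial : forall x y, enorm x = enorm y -> eta x = eta y ;
  kernel_int : \int[lebesgue_rV d]_x eta x = 1 }.

Variables (Omega : set 'rV[R]_d) (eta : 'rV[R]_d -> R) (l : R).

Definition scaled_kernel (x : 'rV[R]_d) : R := l ^- d * eta (l^-1 *: x).

(* Convolution in space only. At the points x with distance larger than l from
   the boundary of Omega this is the convolution of the paper; the values at
   the other points are irrelevant. *)
Definition mollify (g : spacetime R d -> R) : spacetime R d -> R :=
  fun z => \int[lebesgue_rV d]_(y in Omega)
             (g (z.1, y) * scaled_kernel (z.2 - y)).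

Variable rho : spacetime R d -> R.

Definition favre (g : spacetime R d -> R) : spacetime R d -> R :=
  fun z => mollify (fun z' => rho z' * g z') z / mollify rho z.

Definition favre_vec (v : spacetime R d -> 'rV[R]_d) (z : spacetime R d) :
  'rV[R]_d := \row_i favre (fun z' => v z' ord0 i) z.

Definition favre_mx (A : spacetime R d -> 'M[R]_d) (z : spacetime R d) :
  'M[R]_d := \matrix_(i, j) favre (fun z' => A z' i j) z.

End mollification.

Section differential_operators.
Context {R : realType} {d : nat}.
Implicit Types v : spacetime R d -> 'rV[R]_d.

(* (grad v) i j is the partial derivative of the i-th component of v with
   respect to x_j *)
Definition grad v (z : spacetime R d) : 'M[R]_d :=
  \matrix_(i, j) 'D_((0, basis_vec j) : spacetime R d)
                   (fun z' => v z' ord0 i) z.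

Definition sym_grad v (z : spacetime R d) : 'M[R]_d :=
  2^-1 *: (grad v z + (grad v z)^T).

Definition divergence v (z : spacetime R d) : R := \tr (grad v z).

End differential_operators.

Section J.
Context {R : realType} {d : nat}.
Variables (Omega : set 'rV[R]_d) (eta : 'rV[R]_d -> R).
Variables (rho p : spacetime R d -> R) (u : spacetime R d -> 'rV[R]_d).

Definition J1 (l : R) (z : spacetime R d) : R :=
  let ut := favre_vec Omega eta l rho u in
  let uut := favre_mx Omega eta l rho (fun z' => tensor (u z') (u z')) in
  mollify Omega eta l rho z *
  ddot (tensor (ut z) (ut z) - uut z) (sym_grad ut z).

Definition J3 (l : R) (z : spacetime R d) : R :=
  mollify Omega eta l p z * divergence (favre_vec Omega eta l rho u) z.

End J.

(* Main.v *)
(** Mollify the equations in space and time with a product kernel theta_r(t)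
    eta_l(x): near the support of the test function phi they become classical
    identities for the mollified density, momentum, momentum flux, pressure and
    force. Multiplying the momentum equation by the Favre velocity, the quotient
    of mollified momentum and mollified density, and using the product rule
    gives an exact identity between the integral of phi (J1 - J3) and an
    integral in which derivatives fall on phi only. All the fields are dominated
    by powers of one weight y with y^3 integrable, and by Jensen's inequality
    the products occurring in both integrals are dominated by the mollification
    of y^3, which converges in L1. Hence one can send first r and then l to
    zero, and the second integral converges to the action of the defect on
    phi. *)

Require Import Defs.
From HB Require Import structures.
From mathcomp Require Import all_boot all_order all_algebra.
From mathcomp Require Import all_classical all_reals all_analysis.
From mathcomp Require Import measurable_realfun ess_sup_inf.
From mathcomp Require Import ring lra.

Set Implicit Arguments.
Unset Strict Implicit.
Unset Printing Implicit Defensive.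
Import Order.TTheory GRing.Theory Num.Theory.
Import numFieldNormedType.Exports.
Local Open Scope classical_set_scope.
Local Open Scope ring_scope.

(** * Lebesgue measure under affine maps *)

(** Mollifying in space alone does not make the Favre velocity differentiable in time, so it could
    not multiply the momentum equation; the time kernel removes this obstacle and then disappears at
    fixed l. At that stage the gradient of the Favre velocity is harmless, since bounds may depend
    on l. As l tends to zero they are not uniform, so J1 - J3 is never dominated directly: only the
    other side of the identity, free of differentiated kernels, gets a constant independent of l.
    Near the support of phi the weight y is at least |u|, |p|^(1/2) and |f|^(1/2), so every energy
    term has degree at most three in y; this is where the exponents 3 and 3/2 enter. Requiring y = 0
    or y >= 1 lets y^3 dominate lower powers although space-time has infinite measure. The
    assumptions hold almost everywhere, whereas convolutions are differentiated at every point.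
    Hence the fields are replaced by representatives with bounds valid everywhere and time slices
    integrable at every time. Scales are taken so small that the m-th L1 error is at most 2^-(m+1);
    this yields almost everywhere convergence and one majorant without extracting subsequences. *)

Section affine_change_of_variables.
Context {R : realType}.
Local Open Scope ereal_scope.

Lemma measurable_affine1 (a b : R) :
  measurable_fun setT (fun x : measurableTypeR R => (a * x + b)%R : measurableTypeR R).
Proof.
by apply: measurable_funD => //; exact: measurable_funM.
Qed.

(** The measure sending [A] to |a| times the measure of its preimage under x -> a x + b gives
    half-open intervals their length, and these intervals determine Lebesgue measure. *)
Let affine1_ge0 (a b : R) (f : R -> \bar R) : a != 0%R ->
  measurable_fun setT f -> (forall x, 0 <= f x) ->
  \int[@lebesgue_measure R]_x f x =
  `|a|%:E * \int[@lebesgue_measure R]_x f (a * x + b)%R.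
Proof.
move=> a0 mf f0.
have ma := measurable_affine1 a b.
pose phi x : measurableTypeR R := (a * x + b)%R.
pose nu' := mscale (NngNum (normr_ge0 a))
  (pushforward (@lebesgue_measure R) (phi : measurableTypeR R -> _)).
pose nu := nu' ma.
have nu_eq A : nu A = `|a|%:E * (@lebesgue_measure R) (phi @^-1` A) by [].
have nuE : forall A, measurable A -> (@lebesgue_measure R) A = nu A.
  apply: lebesgue_measure_unique => _ [[l r]] _ <-.
  apply: etrans (esym (nu_eq _)).
  rewrite /phi lebesgue_measure_itv/= lte_fin.
  have [a1|a1] := ltP 0%R a.
  - rewrite (_ : _ @^-1` _ = `](l - b) / a, (r - b) / a]%classic)%R; last first.
      apply/seteqP; split => x /=; rewrite !in_itv/=;
      by rewrite ltr_pdivrMr// ler_pdivlMr// ltrBlDr lerBrDr mulrC.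
    rewrite lebesgue_measure_itv/= lte_fin ltr_pM2r ?invr_gt0// ltrD2r.
    case: ifP => _; last by rewrite mule0.
    rewrite -!EFinD -EFinM gtr0_norm//; congr EFin.
    by rewrite -mulrBl mulrC divfK// opprB addrA subrK.
  (* For a negative slope the preimage is closed on the left and open on the right; its length is
     the same. *)
  - have {}a1 : (a < 0)%R by rewrite lt_neqAle a0.
    rewrite (_ : _ @^-1` _ = `[(r - b) / a, (l - b) / a[%classic)%R; last first.
      apply/seteqP; split => x /=; rewrite !in_itv/=;
      by rewrite ltr_ndivlMr// ler_ndivrMr// ltrBlDr lerBrDr mulrC andbC.
    rewrite lebesgue_measure_itv/= lte_fin ltr_nM2r ?invr_lt0// ltrD2r.
    case: ifP => _; last by rewrite mule0.
    rewrite -!EFinD -EFinM ltr0_norm//; congr EFin.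
    by rewrite -mulrBl mulNr mulrC divfK//; ring.
transitivity (\int[nu]_x f x).
  by apply: eq_measure_integral => A mA _; exact: nuE.
rewrite [LHS]ge0_integral_mscale//=; congr (_ * _).
by rewrite ge0_integral_pushforward//.
Qed.

Lemma lebesgue_affine (a b : R) (f : R -> \bar R) : a != 0%R ->
  measurable_fun setT f -> (forall x, 0 <= f x) ->
  \int[@lebesgue_measure R]_x f (a * x + b)%R =
  (`|a|^-1)%:E * \int[@lebesgue_measure R]_x f x.
Proof.
move=> a0 mf f0; rewrite (affine1_ge0 b a0 mf f0) muleA -EFinM mulVf ?mul1e//.
by rewrite normr_eq0.
Qed.

End affine_change_of_variables.

Section lebesgue_rV_affine.
Context {R : realType}.

Lemma measurable_affine_rV n (a : R) (b : 'rV[R]_n) :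
  measurable_fun setT (fun x : 'rV[R]_n => a *: x + b).
Proof.
apply: measurable_fun_rV => i; under eq_fun do rewrite !mxE.
by apply: measurable_funD => //; apply: measurable_funM => //; exact: measurable_coord.
Qed.

Lemma measurable_sub_rV n :
  measurable_fun setT (fun z : 'rV[R]_n * 'rV[R]_n => z.1 - z.2).
Proof.
apply: measurable_fun_rV => i; under eq_fun do rewrite !mxE.
apply: measurable_funB.
  exact: (measurableT_comp (measurable_coord i) measurable_fst).
exact: (measurableT_comp (measurable_coord i) measurable_snd).
Qed.

Lemma cons_rV_affine n (a : R) (b z : R * 'rV[R]_n) :
  cons_rV (a * z.1 + b.1, a *: z.2 + b.2) = a *: cons_rV z + cons_rV b.
Proof.
apply/rowP => i; rewrite !mxE; case: fintype.split => j; rewrite !mxE//.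
by rewrite ord1 eqxx !mulr1n.
Qed.

Local Open Scope ereal_scope.

Lemma ge0_integral_lebesgue_rVS n (f : 'rV[R]_n.+1 -> \bar R) :
  measurable_fun setT f -> (forall x, 0 <= f x) ->
  \int[lebesgue_rV n.+1]_x f x =
  \int[lebesgue_st n]_z f (cons_rV z).
Proof.
move=> mf f0.
exact: (@ge0_integral_pushforward _ _ _ _ _ _ (@measurable_cons_rV R n)
  (lebesgue_st n) setT f measurableT mf (fun x _ => f0 x)).
Qed.

Lemma fubini_st n (f : measurableTypeR R * 'rV[R]_n -> \bar R) :
  measurable_fun setT f -> (forall x, 0 <= f x) ->
  \int[lebesgue_st n]_z f z =
  \int[lebesgue_measure]_t \int[lebesgue_rV n]_x f (t, x).
Proof. by move=> mf f0; exact: fubini_tonelli1. Qed.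

Lemma fubini_st2 n (f : measurableTypeR R * 'rV[R]_n -> \bar R) :
  measurable_fun setT f -> (forall x, 0 <= f x) ->
  \int[lebesgue_st n]_z f z =
  \int[lebesgue_rV n]_x \int[lebesgue_measure]_t f (t, x).
Proof.
move=> mf f0; rewrite fubini_st//.
exact: (@fubini_tonelli _ _ _ _ _ lebesgue_measure (lebesgue_rV n) f mf f0).
Qed.

Lemma measurable_affine_st n (a : R) (b : R * 'rV[R]_n) :
  measurable_fun setT (fun z : measurableTypeR R * 'rV[R]_n =>
    ((a * z.1 + b.1)%R, (a *: z.2 + b.2)%R) : measurableTypeR R * 'rV[R]_n).
Proof.
apply/measurable_fun_pairP; split.
  exact: (measurableT_comp (measurable_affine1 a b.1) measurable_fst).
exact: (measurableT_comp (measurable_affine_rV a b.2) measurable_snd).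
Qed.

(** Induction on the dimension: Tonelli peels off the first coordinate, and each one-dimensional
    change of variable contributes one factor |a|^-1. *)
Lemma lebesgue_rV_affine n (a : R) (b : 'rV[R]_n) (f : 'rV[R]_n -> \bar R) :
  a != 0%R -> measurable_fun setT f -> (forall x, 0 <= f x) ->
  \int[lebesgue_rV n]_x f (a *: x + b)%R =
  (`|a|^-1 ^+ n)%:E * \int[lebesgue_rV n]_x f x.
Proof.
elim: n b f => [|n IH] b f a0 mf f0.
  rewrite expr0 mul1e; apply: eq_integral => x _; congr f.
  by apply/rowP => -[].
have mfa := measurableT_comp mf (measurable_affine_rV a b).
rewrite !ge0_integral_lebesgue_rVS//.
have mfc := measurableT_comp mf (@measurable_cons_rV R n).
have mfac := measurableT_comp mfa (@measurable_cons_rV R n).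
rewrite [LHS]fubini_st// [in RHS]fubini_st//.
pose b' := uncons_rV b.
have E t x : f (a *: cons_rV (t, x) + b)%R =
             f (cons_rV ((a * t + b'.1)%R, (a *: x + b'.2)%R)).
  by rewrite (cons_rV_affine a b' (t, x)) /b' uncons_rVK.
under eq_integral do under eq_integral do rewrite E.
have mg t : measurable_fun setT (fun x => f (cons_rV (t, x))).
  exact: (measurableT_comp mfc (pair1_measurable t)).
have mF : measurable_fun setT (fun t : measurableTypeR R => \int[lebesgue_rV n]_x f (cons_rV (t, x))).
  exact: (@measurable_fun_fubini_tonelli_F _ _ (measurableTypeR R) _ R (lebesgue_rV n)
    (fun z => f (cons_rV z)) mfc (fun z => f0 _)).
under eq_integral => t _ do rewrite (IH b'.2 _ a0 (mg (a * t + b'.1)%R))//.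
pose G (t : measurableTypeR R) := \int[lebesgue_rV n]_x f (cons_rV (t, x)).
have G0 t : 0 <= G t by exact: integral_ge0.
have mGa : measurable_fun setT (fun t : measurableTypeR R => G (a * t + b'.1)%R).
  exact: (measurableT_comp mF (measurable_affine1 a b'.1)).
have c0 : (0 <= `|a|^-1 ^+ n)%R by rewrite exprn_ge0.
transitivity ((`|a|^-1 ^+ n)%:E * \int[@lebesgue_measure R]_t G (a * t + b'.1)%R).
  exact: (@ge0_integralZl_EFin _ _ _ (@lebesgue_measure R) setT measurableT
    (fun t => G (a * t + b'.1)%R) (fun t _ => G0 _) mGa _ c0).
rewrite (@lebesgue_affine _ a b'.1 G a0 mF G0).
by rewrite muleA -EFinM -exprSr.
Qed.

(** Through [cons_rV] this is the previous formula in dimension n + 1, hence the exponent. *)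
Lemma lebesgue_st_affine n (a : R) (b : R * 'rV[R]_n)
    (f : measurableTypeR R * 'rV[R]_n -> \bar R) :
  a != 0%R -> measurable_fun setT f -> (forall x, 0 <= f x) ->
  \int[lebesgue_st n]_z f ((a * z.1 + b.1)%R, (a *: z.2 + b.2)%R) =
  (`|a|^-1 ^+ n.+1)%:E * \int[lebesgue_st n]_z f z.
Proof.
move=> a0 mf f0; pose g := f \o @uncons_rV R n.
have mg : measurable_fun setT g.
  exact: measurableT_comp mf (@measurable_uncons_rV R n).
have := @lebesgue_rV_affine n.+1 a (cons_rV b) g a0 mg (fun x => f0 _).
have mga : measurable_fun setT (fun x : 'rV[R]_n.+1 => g (a *: x + cons_rV b)%R).
  exact: (measurableT_comp mg (measurable_affine_rV a (cons_rV b))).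
rewrite (ge0_integral_lebesgue_rVS mg (fun=> f0 _)).
rewrite (ge0_integral_lebesgue_rVS mga (fun=> f0 _)).
under eq_integral do rewrite -cons_rV_affine /g /= cons_rVK.
by under [in X in _ = _ * X -> _]eq_integral do rewrite /g /= cons_rVK.
Qed.

Lemma lebesgue_st_shift n (b : R * 'rV[R]_n)
    (f : measurableTypeR R * 'rV[R]_n -> \bar R) :
  measurable_fun setT f -> (forall x, 0 <= f x) ->
  \int[lebesgue_st n]_z f (z + b)%R = \int[lebesgue_st n]_z f z.
Proof.
move=> mf f0; have := lebesgue_st_affine b (oner_neq0 R) mf f0.
rewrite normr1 invr1 expr1n mul1e => <-; apply: eq_integral => -[t x] _ /=.
by rewrite mul1r scale1r.
Qed.

End lebesgue_rV_affine.

(** * Norms, and measurability of continuous functions *)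

Section norms.
Context {R : realType}.

Lemma normr_rV_lt n (x : 'rV[R]_n) (e : R) : 0 < e ->
  (forall i, `|x ord0 i| < e) -> `|x| < e.
Proof.
move=> e0 h; rewrite [X in X < _]/Num.norm/= mx_normrE.
by apply: bigmax_lt => // -[i j] _; rewrite /= ord1.
Qed.

Lemma normr_coord_le n (x : 'rV[R]_n) i : `|x ord0 i| <= `|x|.
Proof.
rewrite [X in _ <= X]/Num.norm/= mx_normrE.
exact: (@le_bigmax _ _ _ 0 (fun ij : 'I_1 * 'I_n => `|x ij.1 ij.2|) (ord0, i)).
Qed.

Lemma normr_st n (z : R * 'rV[R]_n) : `|z| = Num.max `|z.1| `|z.2|.
Proof. by []. Qed.

Lemma enorm_ge0 n (x : 'rV[R]_n) : 0 <= enorm x.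
Proof. exact: sqrtr_ge0. Qed.

Lemma normr_le_enorm n (x : 'rV[R]_n) : `|x| <= enorm x.
Proof.
rewrite [X in X <= _]/Num.norm/= mx_normrE.
apply: bigmax_le => [|[i j] _]; first exact: enorm_ge0.
rewrite /= ord1 -sqrtr_sqr; apply: ler_wsqrtr.
rewrite /dotv (bigD1 j)//= expr2 lerDl; apply: sumr_ge0 => k _.
by rewrite -expr2 sqr_ge0.
Qed.

End norms.

Section continuous_measurable.
Context {R : realType}.

(** The measurable structure on rows is generated by the coordinates, so it must be linked to the
    topology. An open preimage is the countable union of the members of [B] that it contains;
    [pselect] replaces the other members by the empty set. *)
Lemma open_measurable_base d (T : measurableType d) (V : normedModType R)
    (f : T -> V) (I : countType) (B : I -> set T) :
  (forall i, measurable (B i)) ->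
  (forall x e, 0 < e -> exists i, B i x /\ forall y, B i y -> `|f x - f y| < e) ->
  forall U, open U -> measurable (f @^-1` U).
Proof.
move=> mB base U oU.
have -> : f @^-1` U = \bigcup_i (if pselect (B i `<=` f @^-1` U) then B i else set0).
  apply/seteqP; split => x /=.
    move=> Ux; have /nbhs_ballP[e /= e0 eU] : nbhs (f x) U by exact: open_nbhs_nbhs.
    have [i [Bix Bi]] := base x e e0; exists i => //=.
    case: pselect => //= -[] y By; apply: eU.
    by rewrite -ball_normE/=; exact: Bi.
  by move=> [i _]; case: pselect => //= + Bx; exact.
apply: countable_bigcupT_measurable; first exact: countableP.
by move=> i; case: (pselect (B i `<=` _)) => ?; [exact: mB|exact: measurable0].
Qed.

Definition rat_box n (q : 'rV[rat]_n * nat) : set 'rV[R]_n :=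
  [set x | forall i, ball_ Num.norm (ratr (q.1 ord0 i) : R) q.2.+1%:R^-1 (x ord0 i)].

Lemma measurable_rat_box n (q : 'rV[rat]_n * nat) : measurable (rat_box q).
Proof.
apply: (@measurable_box R n (fun i => ball_ Num.norm (ratr (q.1 ord0 i)) q.2.+1%:R^-1)).
move=> i; apply: measurable_realfun.open_measurable.
by rewrite ball_normE; apply: ball_open; rewrite invr_gt0.
Qed.

Lemma rat_box_base n (x : 'rV[R]_n) (e : R) : 0 < e ->
  exists q, rat_box q x /\ forall y, rat_box q y -> `|x - y| < e.
Proof.
move=> e0; have [k ke] : exists k : nat, k.+1%:R^-1 < e / 2.
  have e2 : 0 < e / 2 by rewrite divr_gt0.
  have [k _ /(_ k (leqnn k))] := near_infty_natSinv_lt (PosNum e2).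
  by exists k.
have k0 : 0 < k.+1%:R^-1 :> R by rewrite invr_gt0.
have /choice[q xq] : forall i, exists q : rat, `|ratr q - x ord0 i| < k.+1%:R^-1.
  move=> i; have [|q] := @rat_in_itvoo R (x ord0 i - k.+1%:R^-1) (x ord0 i + k.+1%:R^-1).
    by rewrite ltrBlDr -addrA ltrDl addr_gt0.
  by rewrite in_itv/= -ltr_distl => ?; exists q.
exists (\row_i q i, k); split => [i|y yq] /=; first by rewrite mxE.
apply: normr_rV_lt => // i; have := yq i; rewrite /= !mxE => yqi.
rewrite -(subrKA (ratr (q i))) (splitr e) (le_lt_trans (ler_normD _ _))//.
by apply: ltrD; [rewrite distrC|]; rewrite (lt_trans _ ke).
Qed.

Lemma measurable_fun_continuous_base d (T : measurableType d) (f : T -> R) :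
  (forall U : set R, open U -> measurable (f @^-1` U)) -> measurable_fun setT f.
Proof.
move=> h; apply: (measurability _ (RGenOpens.measurableE R)).
by move=> _ [_ [x [y ->]] <-]; rewrite setTI; apply: h; exact: interval_open.
Qed.

Lemma open_measurable_rV n (U : set 'rV[R]_n) : open U -> measurable U.
Proof.
exact: (@open_measurable_base _ 'rV[R]_n 'rV[R]_n id _ (@rat_box n)
  (@measurable_rat_box n) (@rat_box_base n) U).
Qed.

Lemma continuous_measurable_rV n (f : 'rV[R]_n -> R) :
  continuous f -> measurable_fun setT f.
Proof.
move=> /continuousP cf; apply: measurable_fun_continuous_base => U oU.
exact: open_measurable_rV (cf _ oU).
Qed.

Lemma open_measurable_st n (U : set (R * 'rV[R]_n)) : open U ->
  measurable (U : set (measurableTypeR R * 'rV[R]_n)).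
Proof.
(* Time is read as a row of length one, so that rational boxes serve as a countable base in both
   factors. *)
apply: (@open_measurable_base _ (measurableTypeR R * 'rV[R]_n)%type (R * 'rV[R]_n)%type
  id _ (fun q : ('rV[rat]_1 * nat) * ('rV[rat]_n * nat) =>
    (fun t : measurableTypeR R => (\row_i t : 'rV[R]_1)) @^-1` rat_box q.1 `*` rat_box q.2)).
  move=> q; apply: measurableX; last exact: measurable_rat_box.
  rewrite -[X in measurable X]setTI.
  suff m1 : measurable_fun setT (fun t : measurableTypeR R => \row_i t : 'rV[R]_1).
    exact: (m1 measurableT _ (measurable_rat_box q.1)).
  apply: measurable_fun_rV => i; under eq_fun do rewrite mxE.
  exact: measurable_id.
move=> [t x] e e0.
have [p [pt hp]] := rat_box_base (\row_i t : 'rV[R]_1) e0.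
have [q [qx hq]] := rat_box_base x e0.
exists (p, q); split => // -[t' x'] [/= pt' qx'].
rewrite normr_st gt_max/= hq// andbT.
rewrite (le_lt_trans _ (hp _ pt'))//.
by rewrite (le_trans _ (normr_coord_le _ ord0))// !mxE.
Qed.

Lemma continuous_measurable_st n (f : R * 'rV[R]_n -> R) : continuous f ->
  measurable_fun setT (f : measurableTypeR R * 'rV[R]_n -> R).
Proof.
move=> /continuousP cf; apply: measurable_fun_continuous_base => U oU.
exact: open_measurable_st (cf _ oU).
Qed.

End continuous_measurable.

(** * Continuity of translations in L1 *)

(* [spacetime R n] with the measurable structure that carries [lebesgue_st]. *)
Notation mspacetime R n := (measurableTypeR R * 'rV[R]_n)%type.

Section ereal_aux.
Context {R : realType}.
Local Open Scope ereal_scope.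

Lemma cvge0_le (u : nat -> \bar R) : (forall n, 0 <= u n) ->
  (forall e : R, (0 < e)%R -> \forall n \near \oo, u n <= e%:E) ->
  u n @[n --> \oo] --> 0.
Proof.
move=> u0 h; apply/fine_cvgP; split.
  have := h 1%R ltr01; apply: filterS => n un.
  by rewrite ge0_fin_numE// (le_lt_trans un)// ltry.
apply/cvgr0Pnorm_le => e e0; have := h e e0; apply: filterS => n un /=.
have fu : u n \is a fin_num by rewrite ge0_fin_numE// (le_lt_trans un)// ltry.
by rewrite ger0_norm ?fine_ge0// -lee_fin fineK.
Qed.

Lemma cvg_EFinW {I} {F : set_system I} {FF : Filter F} (u : I -> R) (l : R) :
  u x @[x --> F] --> l -> (u x)%:E @[x --> F] --> l%:E.
Proof. by move=> ul; apply: cvg_EFin; [exact: nearW|exact: ul]. Qed.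

Lemma cvge0_near_le (u : nat -> \bar R) : u n @[n --> \oo] --> 0 ->
  forall e : R, (0 < e)%R -> \forall n \near \oo, u n <= e%:E.
Proof.
move=> /fine_cvgP[fu /cvgr0_norm_le h] e e0.
near=> n.
have fun_n : u n \is a fin_num by near: n.
rewrite -(fineK fun_n) lee_fin (le_trans (ler_norm _))//.
by near: n; exact: h.
Unshelve. all: by end_near. Qed.

End ereal_aux.

Section L1_distance.
Context {d} {T : measurableType d} {R : realType} (mu : {measure set T -> \bar R}).
Local Open Scope ereal_scope.

Implicit Types f g h : T -> R.

Definition L1dist (f g : T -> R) : \bar R := \int[mu]_x `|(f x - g x)%:E|.

Lemma L1dist_ge0 f g : 0 <= L1dist f g.
Proof. exact: integral_ge0. Qed.

Lemma measurable_L1dist f g : measurable_fun setT f -> measurable_fun setT g ->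
  measurable_fun setT (fun x => `|(f x - g x)%:E|).
Proof.
move=> mf mg; apply: measurableT_comp => //; apply/measurable_EFinP.
exact: measurable_funB.
Qed.

Lemma L1dist_triangle f g h : measurable_fun setT f -> measurable_fun setT g ->
  measurable_fun setT h -> L1dist f h <= L1dist f g + L1dist g h.
Proof.
move=> mf mg mh; rewrite /L1dist -ge0_integralD//; last 2 first.
- exact: measurable_L1dist.
- exact: measurable_L1dist.
apply: ge0_le_integral => //.
- exact: measurable_L1dist.
- by apply: emeasurable_funD; exact: measurable_L1dist.
- move=> x _; rewrite -EFinD lee_fin.
  by rewrite (_ : (f x - h x = (f x - g x) + (g x - h x))%R) ?ler_normD//; ring.
Qed.

Lemma L1distC f g : L1dist f g = L1dist g f.
Proof. by apply: eq_integral => x _; rewrite /= distrC. Qed.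

Lemma L1distxx f : L1dist f f = 0.
Proof. by rewrite /L1dist integral0_eq// => x _; rewrite subrr abse0. Qed.

End L1_distance.

Section L1_shift.
Context {R : realType}.
Local Open Scope ereal_scope.

Lemma lebesgue_shift (b : R) (f : R -> \bar R) :
  measurable_fun setT f -> (forall x, 0 <= f x) ->
  \int[@lebesgue_measure R]_x f (x + b)%R = \int[@lebesgue_measure R]_x f x.
Proof.
move=> mf f0; have := lebesgue_affine b (oner_neq0 R) mf f0.
rewrite normr1 invr1 mul1e => <-; apply: eq_integral => x _ /=.
by rewrite mul1r.
Qed.

(** Three-epsilon argument: since [s n] preserves the integral, the distance between the shifted [g]
    and the shifted [g'] equals the distance between [g] and [g']. *)
Lemma L1_shift_closure d (T : measurableType d) (mu : {measure set T -> \bar R})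
    (s : nat -> T -> T) (g : T -> R) :
  (forall n, measurable_fun setT (s n)) ->
  (forall n (f : T -> \bar R), measurable_fun setT f -> (forall x, 0 <= f x) ->
    \int[mu]_x f (s n x) = \int[mu]_x f x) ->
  measurable_fun setT g ->
  (forall e : R, (0 < e)%R -> exists g' : T -> R, [/\ measurable_fun setT g',
     L1dist mu g g' <= e%:E & L1dist mu (g' \o s n) g' @[n --> \oo] --> 0]) ->
  L1dist mu (g \o s n) g @[n --> \oo] --> 0.
Proof.
move=> ms inv mg h; apply: cvge0_le => [n|e e0]; first exact: L1dist_ge0.
have e3 : (0 < e / 3)%R by rewrite divr_gt0.
have [g' [mg' gg' g'0]] := h _ e3.
have := cvge0_near_le g'0 e3; apply: filterS => n hn.
have mgs := measurableT_comp mg (ms n).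
have mgs' := measurableT_comp mg' (ms n).
apply: (le_trans (L1dist_triangle mu mgs mgs' mg)).
have -> : (e = e / 3 + (e / 3 + e / 3))%R by field.
rewrite !EFinD; apply: leeD; last first.
  apply: (le_trans (L1dist_triangle mu mgs' mg' mg)).
  by apply: leeD => //; rewrite L1distC.
rewrite /L1dist -[X in X <= _]/(\int[mu]_x ((fun y => `|(g y - g' y)%:E|) (s n x))).
rewrite inv//; exact: measurable_L1dist.
Qed.

(** The approximant given to [L1_shift_closure] is a continuous function cut off to a large interval
    [I k]. Its translates converge except possibly at the two end points, below a constant times an
    indicator. *)
Lemma L1_shift_R (g : R -> R) : lebesgue_measure.-integrable setT (EFin \o g) ->
  forall v : nat -> R, v n @[n --> \oo] --> 0%R ->
  L1dist (@lebesgue_measure R) (fun x => g (x + v n)%R) g @[n --> \oo] --> 0.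
Proof.
move=> ig v v0; have mg : measurable_fun setT g.
  by move/integrableP : ig => [/measurable_EFinP].
have ms n : measurable_fun setT (fun x : measurableTypeR R => (x + v n)%R : measurableTypeR R).
  exact: measurable_funD.
pose I k : set R := `]- k%:R, k%:R[%classic%R.
have mI k : measurable (I k : set (measurableTypeR R)) by exact: measurable_itv.
apply: (@L1_shift_closure _ (measurableTypeR R) lebesgue_measure
  (fun n x => (x + v n)%R) g ms) => //.
  by move=> n f; exact: lebesgue_shift.
move=> e e0; have e2 : (0 < e / 2)%R by rewrite divr_gt0.
pose gk k := g \_ (I k).
have mgk k : measurable_fun setT (gk k).
  by apply/(measurable_restrictT _ (mI k)); exact: measurable_funTS.
have gk_cvg : L1dist lebesgue_measure g (gk k) @[k --> \oo] --> 0.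
  have := @dominated_convergence _ (measurableTypeR R) R lebesgue_measure setT
    measurableT (fun k x => (gk k x)%:E) (EFin \o g) (abse \o (EFin \o g)).
  case=> //.
  - by move=> k; apply/measurable_EFinP; exact: mgk.
  - by apply/measurable_EFinP; exact: mg.
  - apply/aeW => x _; apply: cvg_EFinW.
    apply: cvg_near_cst; apply: filterS (nbhs_infty_gtr `|x|%R) => k xk.
    by rewrite /gk patchE mem_set// /I/= in_itv/= -ltr_norml.
  - exact: integrable_abse.
  - apply/aeW => x k _ /=; rewrite /gk patchE lee_fin; case: ifP => // _.
    by rewrite normr0.
  move=> _ + _; under eq_fun do under eq_integral do rewrite /= distrC.
  by [].
have [k hk] : exists k, L1dist lebesgue_measure g (gk k) <= (e / 2)%:E.
  by have [k _ /(_ k (leqnn k))] := cvge0_near_le gk_cvg e2; exists k.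
have Ik_fin : (lebesgue_measure (I k) < +oo).
  by rewrite lebesgue_measure_itv/=; case: ifP => // _; rewrite -EFinB ltry.
have [c_ [cc ic c_cvg]] := approximation_continuous_integrable (mI k) Ik_fin
  (integrableS measurableT (mI k) (@subsetT _ _) ig).
have [m hm] : exists m, \int[lebesgue_measure]_(z in I k) `|(g z - c_ m z)%:E| <= (e / 2)%:E.
  by have [m _ /(_ m (leqnn m))] := cvge0_near_le c_cvg e2; exists m.
pose c := c_ m; pose ck := c \_ (I k).
have mc : measurable_fun setT c by apply: continuous_measurable_fun; exact: cc.
have mck : measurable_fun setT ck.
  by apply/(measurable_restrictT _ (mI k)); exact: measurable_funTS.
exists ck; split => //.
  apply: (le_trans (@L1dist_triangle _ (measurableTypeR R) R lebesgue_measure g (gk k) ck mg (mgk k) mck)).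
  rewrite (splitr e) EFinD; apply: leeD => //.
  rewrite [X in X <= _](_ : _ = \int[lebesgue_measure]_(z in I k) `|(g z - c z)%:E|)//.
  rewrite [RHS]integral_mkcond; apply: eq_integral => x _.
  by rewrite /gk /ck !patchE; case: ifP => // _; rewrite subr0 abse0.
have [M cM] : exists M : R, forall x, (`|x| <= k%:R + 1)%R -> (`|c x| <= M)%R.
  have /compact_bounded[M [_ hM]] : compact (c @` `[- (k%:R + 1), k%:R + 1]%classic%R).
    apply: continuous_compact; last exact: segment_compact.
    by apply: continuous_subspaceT; exact: cc.
  exists (M + 1)%R => x xk; apply: hM; first by rewrite ltrDl.
  by exists x => //=; rewrite in_itv/= -ler_norml.
pose J : set R := `[- (k%:R + 1), k%:R + 1]%classic%R.
have mJ : measurable (J : set (measurableTypeR R)) by exact: measurable_itv.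
have ckM x h : (`|h| <= 1)%R -> (`|ck (x + h)%R| <= `|M| * \1_J x)%R.
  move=> h1; rewrite /ck patchE; case: ifPn => [/set_mem|_]; last first.
    by rewrite normr0 mulr_ge0.
  rewrite /I/= in_itv/= -ltr_norml => xh.
  have Jx : J x.
    rewrite /J/= in_itv/= -ler_norml -[x](addrK h).
    by rewrite (le_trans (ler_normB _ _))// lerD// ltW.
  rewrite indicE mem_set// mulr1 (le_trans _ (ler_norm _))// cM//.
  by rewrite (le_trans (ltW xh))// lerDl.
(* Dominated convergence wants its majorant at every index, so the first [N] terms are dropped;
   shifts of size at most 1 keep the translates of [ck] supported in [J]. *)
have [N _ vN] : \forall n \near \oo, (`|v n| <= 1)%R.
  by move/cvgr0_norm_le : v0; exact.
rewrite -(cvg_shiftn N)/=.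
have iJ : lebesgue_measure.-integrable setT (EFin \o \1_J : R -> _).
  apply/integrableP; split; first by apply/measurable_EFinP; exact: measurable_indic.
  under eq_integral do rewrite /= ger0_norm//.
  rewrite integral_indic// setIT.
  suff : lebesgue_measure J < +oo by [].
  by rewrite /J lebesgue_measure_itv/=; case: ifP => // _; rewrite -EFinB ltry.
have [] := @dominated_convergence _ (measurableTypeR R) R lebesgue_measure setT
    measurableT (fun n x => (ck (x + v (n + N)%N)%R)%:E) (EFin \o ck)
    (fun x => `|M|%:E * (\1_J x)%:E).
- by move=> n; apply/measurable_EFinP; exact: (measurableT_comp mck (ms _)).
- exact/measurable_EFinP.
- exists [set - k%:R; k%:R]%R; split.
  + exact: measurableU.
  + exact: countable_lebesgue_measure0 (finite_set_countable (finite_set2 _ _)).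
  + move=> x /= xP; apply: contrapT => xk; apply: xP => _.
    apply: cvg_EFinW.
    have [xI|xI] := ltP `|x|%R k%:R.
    - have cx : ck (x + v (n + N)%N)%R @[n --> \oo] --> c x.
        apply: (@cvg_trans _ (c (x + v (n + N)%N)%R @[n --> \oo])).
          apply: near_eq_cvg.
          have : \forall n \near \oo, (`|v (n + N)%N| < k%:R - `|x|)%R.
            have xk0 : (0 < k%:R - `|x|)%R by rewrite subr_gt0.
            have [j _ hj] : \forall n \near \oo, (`|v n| < k%:R - `|x|)%R.
              by move/cvgr0_norm_lt : v0; exact.
            by exists j => // n mn; apply: hj => /=; rewrite (leq_trans mn)// leq_addr.
          apply: filterS => n vn; rewrite /ck patchE mem_set//.
          rewrite /I/= in_itv/= -ltr_norml (le_lt_trans (ler_normD _ _))//.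
          by rewrite -ltrBrDl.
        apply: continuous_cvg; first exact: cc.
        rewrite -[X in _ --> X]addr0; apply: cvgD; first exact: cvg_cst.
        by rewrite (@cvg_shiftn N _ v).
      by rewrite {2}/ck patchE mem_set// /I/= in_itv/= -ltr_norml.
    - have {}xI : (k%:R < `|x|)%R.
        rewrite lt_neqAle xI andbT; apply: contra_not_neq xk => kx.
        have [x0|x0] := leP 0%R x; [right|left].
          by rewrite kx ger0_norm.
        by rewrite kx ltr0_norm// opprK.
      rewrite [X in _ --> X](_ : _ = 0%R); last first.
        rewrite /ck patchE memNset// /I/= in_itv/= -ltr_norml => xk'.
        by have := lt_trans xI xk'; rewrite ltxx.
      apply: cvg_near_cst.
      have xk0 : (0 < `|x| - k%:R)%R by rewrite subr_gt0.
      have [j _ hj] : \forall n \near \oo, (`|v n| < `|x| - k%:R)%R.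
        by move/cvgr0_norm_lt : v0; exact.
      exists j => // n mn; rewrite /ck patchE memNset// /I/= in_itv/= -ltr_norml.
      have /hj vn : (j <= n + N)%N by rewrite (leq_trans mn)// leq_addr.
      move=> xvk.
      have : (`|x| <= `|x + v (n + N)%N| + `|v (n + N)%N|)%R.
        by rewrite -[X in (`|X| <= _)%R](addrK (v (n + N)%N)) ler_normB.
      by lra.
- exact: integrableZl.
- apply/aeW => x n _; rewrite abse_EFin -EFinM lee_fin ckM//.
  by apply: vN => /=; rewrite leq_addl.
move=> _ + _.
by [].
Qed.

(** On almost every slice the shift error tends to 0 by assumption, and invariance bounds it by
    twice the L1 norm [F y] of the slice, which is integrable in y. *)
Lemma L1_shift_slices d1 d2 (T1 : measurableType d1) (T2 : measurableType d2)
    (m1 : {sigma_finite_measure set T1 -> \bar R})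
    (m2 : {sigma_finite_measure set T2 -> \bar R}) (f : T1 * T2 -> R)
    (s : nat -> T1 -> T1) :
  (forall n, measurable_fun setT (s n)) ->
  (forall n (f : T1 -> \bar R), measurable_fun setT f -> (forall x, 0 <= f x) ->
    \int[m1]_x f (s n x) = \int[m1]_x f x) ->
  (forall g : T1 -> R, m1.-integrable setT (EFin \o g) ->
    L1dist m1 (g \o s n) g @[n --> \oo] --> 0) ->
  measurable_fun setT f ->
  \int[m2]_y \int[m1]_x `|(f (x, y))%:E| < +oo ->
  \int[m2]_y \int[m1]_x `|(f (s n x, y) - f (x, y))%:E| @[n --> \oo] --> 0.
Proof.
move=> ms inv shift mf foo.
pose F y := \int[m1]_x `|(f (x, y))%:E|.
have mslice y : measurable_fun setT (fun x => f (x, y)).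
  exact: (measurableT_comp mf (pair2_measurable y)).
have maf : measurable_fun setT (fun z => `|(f z)%:E|).
  by apply: measurableT_comp => //; exact/measurable_EFinP.
have mF : measurable_fun setT F.
  exact: (@measurable_fun_fubini_tonelli_G _ _ _ _ R m1 _ maf (fun=> abse_ge0 _)).
have F0 y : 0 <= F y by exact: integral_ge0.
have iF : m2.-integrable setT F.
  apply/integrableP; split => //.
  by under eq_integral do rewrite gee0_abs//.
have ms2 n : measurable_fun setT (fun z : T1 * T2 => (s n z.1, z.2)).
  apply/measurable_fun_pairP; split; last exact: measurable_snd.
  exact: (measurableT_comp (ms n) measurable_fst).
have md n : measurable_fun setT (fun z => `|(f (s n z.1, z.2) - f z)%:E|).
  by apply: measurable_L1dist => //; exact: (measurableT_comp mf (ms2 n)).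
pose G n y := \int[m1]_x `|(f (s n x, y) - f (x, y))%:E|.
have G0 n y : 0 <= G n y by exact: integral_ge0.
have mG n : measurable_fun setT (G n).
  exact: (@measurable_fun_fubini_tonelli_G _ _ _ _ R m1 _ (md n) (fun=> abse_ge0 _)).
have [] := @dominated_convergence _ _ R m2 setT measurableT G (cst 0)
  (fun y => F y + F y).
- exact: mG.
- exact: measurable_cst.
- have := integrable_ae measurableT iF; apply: filterS => y Fy _.
  apply: shift; apply/integrableP; split; first by apply/measurable_EFinP.
  by rewrite -ge0_fin_numE; [exact: Fy|exact: integral_ge0].
- exact: integrableD.
- apply/aeW => y n _; rewrite gee0_abs// /G.
  have -> : F y + F y = \int[m1]_x `|(f (s n x, y))%:E| + F y.
    congr (_ + _).
    by rewrite (inv n (fun x => `|(f (x, y))%:E|))//; apply: measurableT_comp => //;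
      apply/measurable_EFinP.
  have m1f : measurable_fun setT (fun x => `|(f (x, y))%:E|).
    by apply: measurableT_comp => //; apply/measurable_EFinP.
  rewrite -ge0_integralD//; last exact: (measurableT_comp m1f (ms n)).
  apply: ge0_le_integral => //.
  + by apply: measurable_L1dist => //; exact: (measurableT_comp (mslice y) (ms n)).
  + by apply: emeasurable_funD => //; exact: (measurableT_comp m1f (ms n)).
  + by move=> x _; rewrite -EFinD lee_fin ler_normB.
by move=> _ _; rewrite integral_cst// mul0e.
Qed.

End L1_shift.

Section L1_shift2.
Context {R : realType}.
Local Open Scope ereal_scope.

(** A shift of space-time is a space shift followed by a time shift. The triangle inequality and
    invariance separate the two errors, and each is treated slice by slice. *)
Lemma L1_shift_st_step n :
  (forall g : 'rV[R]_n -> R, (lebesgue_rV n).-integrable setT (EFin \o g) ->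
   forall v : nat -> 'rV[R]_n, v k @[k --> \oo] --> (0 : 'rV[R]_n)%R ->
   L1dist (lebesgue_rV n) (fun x => g (x + v k)%R) g @[k --> \oo] --> 0) ->
  forall f : mspacetime R n -> R,
   (lebesgue_st n).-integrable setT (EFin \o f) ->
  forall v : nat -> R * 'rV[R]_n, v k @[k --> \oo] --> (0 : R * 'rV[R]_n)%R ->
  L1dist (lebesgue_st n) (fun z => f (z + v k)%R) f @[k --> \oo] --> 0.
Proof.
move=> IH f fi v v0.
have [mf foo] : measurable_fun setT f /\ \int[lebesgue_st n]_z `|(f z)%:E| < +oo.
  by move/integrableP : fi => [/measurable_EFinP].
have maf : measurable_fun setT (fun z => `|(f z)%:E|).
  by apply: measurableT_comp => //; exact/measurable_EFinP.
have v1 : (v k).1 @[k --> \oo] --> 0%R by apply: (cvg_comp v fst v0); exact: cvg_fst.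
have v2 : (v k).2 @[k --> \oo] --> (0 : 'rV[R]_n)%R by apply: (cvg_comp v snd v0); exact: cvg_snd.
have ms (w : R * 'rV[R]_n) : measurable_fun setT
    (fun z : measurableTypeR R * 'rV[R]_n => (z + w)%R : measurableTypeR R * 'rV[R]_n).
  have := measurable_affine_st 1%R w; congr (measurable_fun _ _).
  by apply/funext => -[t x] /=; rewrite mul1r scale1r.
have mfs w : measurable_fun setT
    (fun z : measurableTypeR R * 'rV[R]_n => f (z + w)%R).
  exact: (measurableT_comp mf (ms w)).
pose a k : R * 'rV[R]_n := ((v k).1, 0%R).
pose b k : R * 'rV[R]_n := (0%R, (v k).2).
have vE k z : (z + v k = (z + b k) + a k)%R.
  rewrite /a /b; case: (v k) z => h w [t x]/=.
  by rewrite -addrA; congr (_ + _)%R; congr pair; rewrite /= ?add0r ?addr0.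
apply: (@squeeze_cvge _ _ _ _ (cst 0) _
  (fun k => L1dist (lebesgue_st n) (fun z => f (z + a k)%R) f +
            L1dist (lebesgue_st n) (fun z => f (z + b k)%R) f)).
- apply: nearW => k; rewrite L1dist_ge0/=.
  have h1 := @L1dist_triangle _ _ _ (lebesgue_st n) _ _ _ (mfs (v k)) (mfs (b k)) mf.
  apply: (le_trans h1); apply: leeD => //.
  rewrite /L1dist; under eq_integral do rewrite vE.
  rewrite (lebesgue_st_shift (b k) (f := fun z => `|(f (z + a k)%R - f z)%:E|))//.
  exact: measurable_L1dist.
- exact: cvg_cst.
- rewrite -[X in _ --> X](adde0 0); apply: cvgeD => //.
  + have mfa k : measurable_fun setT (fun z : mspacetime R n => `|(f (z + a k)%R - f z)%:E|).
      by apply: measurable_L1dist.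
    rewrite (_ : (fun k => _) = fun k => \int[lebesgue_rV n]_x \int[lebesgue_measure]_t
        `|(f (t + (v k).1, x)%R - f (t, x))%:E|).
      apply: (@L1_shift_slices _ _ _ (measurableTypeR R) 'rV[R]_n lebesgue_measure
        (lebesgue_rV n) f (fun k t => (t + (v k).1)%R)) => //.
      * by move=> k; exact: measurable_funD.
      * by move=> k g; exact: lebesgue_shift.
      * by move=> g gi; exact: (L1_shift_R gi v1).
      * by rewrite -(fubini_st2 maf (fun=> abse_ge0 _)).
    apply/funext => k; rewrite /L1dist (fubini_st2 (mfa k) (fun=> abse_ge0 _)).
    apply: eq_integral => x _; apply: eq_integral => t _.
    by congr (`|(f _ - _)%:E|); congr pair; rewrite /= addr0.
  + have mfb k : measurable_fun setT (fun z : mspacetime R n => `|(f (z + b k)%R - f z)%:E|).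
      by apply: measurable_L1dist.
    rewrite (_ : (fun k => _) = fun k => \int[lebesgue_measure]_t \int[lebesgue_rV n]_x
        `|(f (t, x + (v k).2)%R - f (t, x))%:E|).
      apply: (@L1_shift_slices _ _ _ 'rV[R]_n (measurableTypeR R) (lebesgue_rV n)
        lebesgue_measure (fun z => f (z.2, z.1)) (fun k x => (x + (v k).2)%R)) => //.
      * move=> k; have := measurable_affine_rV 1%R (v k).2; congr (measurable_fun _ _).
        by apply/funext => x /=; rewrite scale1r.
      * move=> k g mg g0; have := lebesgue_rV_affine (v k).2 (oner_neq0 R) mg g0.
        rewrite normr1 invr1 expr1n mul1e => <-; apply: eq_integral => x _ /=.
        by rewrite scale1r.
      * by move=> g gi; exact: (IH g gi _ v2).
      * apply: (measurableT_comp mf); apply/measurable_fun_pairP.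
        by split; [exact: measurable_snd|exact: measurable_fst].
      * by rewrite -(fubini_st maf (fun=> abse_ge0 _)).
    apply/funext => k; rewrite /L1dist (fubini_st (mfb k) (fun=> abse_ge0 _)).
    apply: eq_integral => t _; apply: eq_integral => x _.
    by congr (`|(f _ - _)%:E|); congr pair; rewrite /= addr0.
Qed.

Lemma L1_shift_rV n (g : 'rV[R]_n -> R) :
  (lebesgue_rV n).-integrable setT (EFin \o g) ->
  forall v : nat -> 'rV[R]_n, v k @[k --> \oo] --> (0 : 'rV[R]_n)%R ->
  L1dist (lebesgue_rV n) (fun x : 'rV[R]_n => g (x + v k)%R) g @[k --> \oo] --> 0.
Proof.
elim: n g => [|n IH] g gi v v0.
  rewrite (_ : (fun k => _) = cst 0); first exact: cvg_cst.
  apply/funext => k; rewrite -[RHS](L1distxx (lebesgue_rV 0) g); congr L1dist.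
  by apply/funext => x; congr g; apply/rowP => -[].
have [mg goo] : measurable_fun setT g /\ \int[lebesgue_rV n.+1]_z `|(g z)%:E| < +oo.
  by move/integrableP : gi => [/measurable_EFinP].
pose f : mspacetime R n -> R := g \o @cons_rV R n.
have mf : measurable_fun setT f := measurableT_comp mg (@measurable_cons_rV R n).
have fi : (lebesgue_st n).-integrable setT (EFin \o f).
  apply/integrableP; split; first by apply/measurable_EFinP.
  rewrite -(ge0_integral_lebesgue_rVS (f := fun x => `|(g x)%:E|))//.
  by apply: measurableT_comp => //; exact/measurable_EFinP.
have v0' : uncons_rV (v k) @[k --> \oo] --> (0 : R * 'rV[R]_n)%R.
  apply/cvgrPdist_lt => e e0; move/cvgrPdist_lt : v0 => /(_ e e0).
  apply: filterS => k; rewrite !sub0r !normrN => vk.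
  rewrite normr_st gt_max/= (le_lt_trans (normr_coord_le _ _) vk)/=.
  apply: normr_rV_lt => // i; rewrite mxE.
  exact: (le_lt_trans (normr_coord_le _ _) vk).
rewrite (_ : (fun k => _) = fun k =>
    L1dist (lebesgue_st n) (fun z : mspacetime R n => f (z + uncons_rV (v k))%R) f).
  exact: L1_shift_st_step IH _ fi _ v0'.
apply/funext => k; rewrite /L1dist.
rewrite (ge0_integral_lebesgue_rVS (f := fun x : 'rV[R]_n.+1 => `|(g (x + v k)%R - g x)%:E|))//.
  apply: eq_integral => z _; rewrite /f /=; congr (`|(g _ - _)%:E|).
  have := cons_rV_affine 1%R (uncons_rV (v k)) z.
  by rewrite mul1r !scale1r uncons_rVK => <-.
apply: measurable_L1dist => //; apply: (measurableT_comp mg).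
have := measurable_affine_rV 1%R (v k); congr (measurable_fun _ _).
by apply/funext => x /=; rewrite scale1r.
Qed.

Lemma L1_shift_st n (f : mspacetime R n -> R) :
  (lebesgue_st n).-integrable setT (EFin \o f) ->
  forall v : nat -> R * 'rV[R]_n, v k @[k --> \oo] --> (0 : R * 'rV[R]_n)%R ->
  L1dist (lebesgue_st n) (fun z : mspacetime R n => f (z + v k)%R) f @[k --> \oo] --> 0.
Proof. exact: (L1_shift_st_step (@L1_shift_rV n)). Qed.

(** By contradiction: bad shifts of size below 1/(k+1) would form a sequence violating
    [L1_shift_st]. A threshold is the form suited to kernels, because a kernel supported in a ball
    of radius r averages shifts of size less than r. *)
Lemma L1_shift_st_delta n (f : mspacetime R n -> R) :
  (lebesgue_st n).-integrable setT (EFin \o f) -> forall e : R, (0 < e)%R ->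
  exists2 r : R, (0 < r)%R & forall v : R * 'rV[R]_n, (`|v| < r)%R ->
    L1dist (lebesgue_st n) (fun z : mspacetime R n => f (z + v)%R) f <= e%:E.
Proof.
move=> fi e e0; apply: contrapT => nex.
have /choice[v vP] : forall k : nat, exists v : R * 'rV[R]_n, (`|v| < k.+1%:R^-1)%R /\
    ~~ (L1dist (lebesgue_st n) (fun z : mspacetime R n => f (z + v)%R) f <= e%:E).
  move=> k; apply: contrapT => nv; apply: nex; exists k.+1%:R^-1%R.
    by rewrite invr_gt0.
  by move=> v vk; apply: contrapT => /negP h; apply: nv; exists v.
have v0 : v k @[k --> \oo] --> (0 : R * 'rV[R]_n)%R.
  apply/cvgr0Pnorm_lt => r r0; have := near_infty_natSinv_lt (PosNum r0).
  by apply: filterS => k kr; apply: lt_trans kr; have [] := vP k.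
have [k _ /(_ k (leqnn k))] := cvge0_near_le (L1_shift_st fi v0) e0.
by apply/negP; have [] := vP k.
Qed.

End L1_shift2.

(** * Dominated convergence along fast L1 sequences *)

Section dominated_fields.
Context {d} {T : measurableType d} {R : realType} (mu : {measure set T -> \bar R}).
Local Open Scope ereal_scope.

Lemma integral_measure_preserving (s : T -> T) : measurable_fun setT s ->
  (forall f : T -> \bar R, measurable_fun setT f -> (forall x, 0 <= f x) ->
    \int[mu]_x f (s x) = \int[mu]_x f x) ->
  forall f : T -> \bar R, measurable_fun setT f ->
    \int[mu]_x f (s x) = \int[mu]_x f x.
Proof.
move=> ms inv f mf; rewrite [LHS]integralE [RHS]integralE.
congr (_ - _).
  rewrite -(inv f^\+ (measurable_funepos mf) (funepos_ge0 f)).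
  by apply: eq_integral => x _; rewrite !funeposE.
rewrite -(inv f^\- (measurable_funeneg mf) (funeneg_ge0 f)).
by apply: eq_integral => x _; rewrite !funenegE.
Qed.

(** [h] is the sum of all errors. The prescribed rates add up to at most 1, so [h] is integrable,
    hence finite almost everywhere, and there the terms of the series tend to 0. *)
Lemma L1_fast (f : nat -> T -> R) (g : T -> R) :
  (forall n, measurable_fun setT (f n)) -> measurable_fun setT g ->
  (forall n, L1dist mu (f n) g <= (1 / (2 ^ n.+1)%:R)%:E) ->
  exists h : T -> \bar R, [/\ mu.-integrable setT h,
    forall n x, `|(f n x - g x)%:E| <= h x &
    {ae mu, forall x, f n x @[n --> \oo] --> g x}].
Proof.
move=> mf mg fg; pose a n x := `|(f n x - g x)%:E|.
have ma n : measurable_fun setT (a n) by exact: measurable_L1dist.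
have a0 n x : 0 <= a n x by exact: abse_ge0.
pose h x := \sum_(n <oo) a n x.
have mh : measurable_fun setT h.
  by apply: ge0_emeasurable_sum => // n x _ _; exact: a0.
have h0 x : 0 <= h x by exact: nneseries_ge0.
have ih : mu.-integrable setT h.
  apply/integrableP; split => //; under eq_integral do rewrite gee0_abs//.
  rewrite integral_nneseries//.
  apply: (@le_lt_trans _ _ (\sum_(n <oo) (1 / (2 ^ n.+1)%:R)%:E)).
    by apply: lee_nneseries => n _; [move=> _; exact: integral_ge0|exact: fg].
  by apply: (@le_lt_trans _ _ 1%:E); [exact: epsilon_trick0|rewrite ltry].
exists h; split => //.
- move=> n x; rewrite /h (@nneseriesD1 _ _ n xpredT)// leeDl//.
  exact: nneseries_ge0.
- have := integrable_ae measurableT ih; apply: filterS => x /(_ Logic.I) hx.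
  have ax0 : a n x @[n --> \oo] --> 0.
    have hxoo : h x < +oo by rewrite -ge0_fin_numE.
    have tl := nneseries_tail_cvg hxoo (fun k _ => a0 k x).
    apply: (squeeze_cvge _ (cvg_cst 0) tl); apply: nearW => n.
    rewrite a0/= (@nneseries_split _ _ n 1%N)// addn1 big_nat1 leeDl//.
    exact: nneseries_ge0.
  apply/subr_cvg0; apply/norm_cvg0P.
  by move/fine_cvg : ax0.
Qed.

Lemma ae_forall_fin (I : finType) (P : I -> T -> Prop) :
  (forall i, {ae mu, forall x, P i x}) -> {ae mu, forall x, forall i, P i x}.
Proof.
move=> h; have : {ae mu, forall x, forall n : nat,
    forall i, nth i (enum I) n = i -> (n < #|I|)%N -> P i x}.
  apply: ae_foralln => n; have [nI|nI] := ltnP n #|I|; last first.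
    by apply/aeW.
  have := h (enum_val (Ordinal nI)); apply: filterS => x hx i ni _.
  by move: hx; rewrite /enum_val (set_nth_default i) -?cardE//= ni.
apply: filterS => x hx i; apply: (hx (enum_rank i)); last exact: ltn_ord.
by rewrite nth_enum_rank.
Qed.

(* Fields converging fast in L1 also converge almost everywhere, and the
   L1-convergent bound E n provides an integrable bound uniform in n. *)
Lemma dominated_fields (I : finType) (X : I -> nat -> T -> R) (X' : I -> T -> R)
    (E : nat -> T -> R) (E' B : T -> R) (Cst : R) (Phi : nat -> T -> R) (Phi' : T -> R) :
  (forall i n, measurable_fun setT (X i n)) ->
  (forall i, measurable_fun setT (X' i)) ->
  (forall n, measurable_fun setT (E n)) ->
  (forall i n, L1dist mu (X i n) (X' i) <= (1 / (2 ^ n.+1)%:R)%:E) ->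
  (forall n, L1dist mu (E n) E' <= (1 / (2 ^ n.+1)%:R)%:E) ->
  mu.-integrable setT (EFin \o E') -> mu.-integrable setT (EFin \o B) ->
  (forall n, measurable_fun setT (Phi n)) -> measurable_fun setT Phi' ->
  (forall n x, (`|Phi n x| <= B x + Cst * `|E n x|)%R) -> (0 <= Cst)%R ->
  (forall x, (forall i, X i n x @[n --> \oo] --> X' i x) ->
    Phi n x @[n --> \oo] --> Phi' x) ->
  mu.-integrable setT (EFin \o Phi') /\
  (\int[mu]_x Phi n x)%R @[n --> \oo] --> (\int[mu]_x Phi' x)%R.
Proof.
move=> mX mX' mE XX' EE' iE' iB mPhi mPhi' PhiB C0 Phicvg.
have mE' : measurable_fun setT E' by move/integrableP : iE' => [/measurable_EFinP].
have [h [ih hE _]] := L1_fast mE mE' EE'.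
have Xae i : {ae mu, forall x, X i n x @[n --> \oo] --> X' i x}.
  by have [? []] := L1_fast (mX i) (mX' i) (XX' i).
have [] := @dominated_convergence _ T R mu setT measurableT
  (fun n x => (Phi n x)%:E) (EFin \o Phi')
  (fun x => (B x)%:E + Cst%:E * (`|(E' x)%:E| + h x)).
- by move=> n; exact/measurable_EFinP.
- exact/measurable_EFinP.
- have := ae_forall_fin Xae; apply: filterS => x hx _.
  by apply: cvg_EFinW; exact: Phicvg.
- apply: integrableD => //; apply: integrableZl => //.
  by apply: integrableD => //; exact: integrable_abse.
- apply/aeW => x n _; rewrite abse_EFin.
  apply: (@le_trans _ _ ((B x)%:E + Cst%:E * `|(E n x)%:E|)).
    by rewrite -EFinM -EFinD lee_fin.
  apply: leeD => //; apply: lee_wpmul2l; first by rewrite lee_fin.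
  apply: (@le_trans _ _ (`|(E' x)%:E| + `|(E n x - E' x)%:E|)).
    by rewrite -EFinD lee_fin -{1}(subrK (E' x) (E n x)) addrC ler_normD.
  by apply: leeD.
move=> iPhi' _ cvgPhi; split => //.
by apply: fine_cvg; rewrite fineK; [exact: cvgPhi|exact: integrable_fin_num].
Qed.

End dominated_fields.

(** * Convolutions *)

Section real_integrals.
Context {d} {T : measurableType d} {R : realType} (mu : {measure set T -> \bar R}).
Implicit Types f g : T -> R.

Lemma integrable_real_le f g : measurable_fun setT f ->
  (forall x, `|f x| <= g x) -> mu.-integrable setT (EFin \o g) ->
  mu.-integrable setT (EFin \o f).
Proof.
move=> mf fg; apply: le_integrable => //; first exact/measurable_EFinP.
by move=> x _; rewrite !abse_EFin lee_fin (le_trans (fg x))// ler_norm.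
Qed.

Lemma integrableZl_real (r : R) f : mu.-integrable setT (EFin \o f) ->
  mu.-integrable setT (EFin \o (fun x => r * f x)).
Proof.
by move=> fi; rewrite /comp; under eq_fun do rewrite EFinM; exact: integrableZl.
Qed.

Lemma integrableD_real f g : mu.-integrable setT (EFin \o f) ->
  mu.-integrable setT (EFin \o g) -> mu.-integrable setT (EFin \o (fun x => f x + g x)).
Proof.
by move=> fi gi; rewrite /comp; under eq_fun do rewrite EFinD; exact: integrableD.
Qed.

Lemma integrableB_real f g : mu.-integrable setT (EFin \o f) ->
  mu.-integrable setT (EFin \o g) -> mu.-integrable setT (EFin \o (fun x => f x - g x)).
Proof.
by move=> fi gi; rewrite /comp; under eq_fun do rewrite EFinB; exact: integrableB.
Qed.

Lemma measurable_integrable_real f :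
  mu.-integrable setT (EFin \o f) -> measurable_fun setT f.
Proof. by move/measurable_int/measurable_EFinP. Qed.

Lemma integrable_mul_bounded f g (M : R) : mu.-integrable setT (EFin \o f) ->
  measurable_fun setT g -> (forall x, `|g x| <= M) ->
  mu.-integrable setT (EFin \o (fun x => f x * g x)).
Proof.
move=> fi mg gM; apply: (@integrable_real_le _ (fun x => M * `|f x|)).
- by apply: measurable_funM => //; exact: measurable_integrable_real.
- by move=> x; rewrite normrM mulrC ler_wpM2r.
- by apply: integrableZl_real; exact: integrable_norm.
Qed.

Lemma integrable_real_lty f : measurable_fun setT f ->
  (\int[mu]_x `|(f x)%:E| < +oo)%E -> mu.-integrable setT (EFin \o f).
Proof. by move=> mf foo; apply/integrableP; split => //; apply/measurable_EFinP. Qed.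

Lemma EFin_Rintegral f : mu.-integrable setT (EFin \o f) ->
  (\int[mu]_x f x)%:E = (\int[mu]_x (f x)%:E)%E.
Proof. by move=> fi; rewrite /Rintegral fineK//; exact: integrable_fin_num. Qed.

Lemma le_Rintegral_norm f g : mu.-integrable setT (EFin \o f) ->
  mu.-integrable setT (EFin \o g) -> (forall x, `|f x| <= g x) ->
  `|\int[mu]_x f x| <= \int[mu]_x g x.
Proof.
move=> fi gi fg; apply: (le_trans (le_normr_Rintegral _ _)) => //.
by apply: le_Rintegral => //; exact: integrable_norm.
Qed.

End real_integrals.

Lemma Rintegral_sum_ord d (T : measurableType d) (R : realType) (m : {measure set T -> \bar R})
    k (f : 'I_k -> T -> R) : (forall j, m.-integrable setT (EFin \o f j)) ->
  m.-integrable setT (EFin \o (fun x => \sum_j f j x)) /\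
  \int[m]_(x in setT) (\sum_j f j x) = \sum_j \int[m]_(x in setT) f j x.
Proof.
elim: k f => [|k IH] f h.
  have -> : (fun x => \sum_j f j x) = cst 0 by apply/funext => x; rewrite big_ord0.
  by rewrite big_ord0; split; [exact: integrable0|rewrite /Rintegral integral0].
have [i1 e1] := IH (fun j => f (lift ord0 j)) (fun j => h _).
have -> : (fun x => \sum_j f j x) = fun x => f ord0 x + \sum_j f (lift ord0 j) x.
  by apply/funext => x; rewrite big_ord_recl.
by split; [exact: integrableD_real|rewrite RintegralD// e1 big_ord_recl].
Qed.

Section parametric_integrals.
Context {d1 d2} {T : measurableType d1} {W : measurableType d2} {R : realType}.
Variable nu : {sigma_finite_measure set W -> \bar R}.

(** Tonelli gives measurability for nonnegative integrands, so positive and negative parts are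
    integrated separately and recombined. *)
Lemma measurable_Rintegral_param (F : T * W -> R) : measurable_fun setT F ->
  measurable_fun setT (fun z => \int[nu]_w F (z, w)).
Proof.
move=> mF; pose G := EFin \o F.
have mG : measurable_fun setT G by exact/measurable_EFinP.
rewrite (_ : (fun z => _) = fun z => fine
    (\int[nu]_w (G^\+)%E (z, w) - \int[nu]_w (G^\-)%E (z, w))%E); last first.
  apply/funext => z; rewrite /Rintegral integralE; congr (fine (_ - _)%E);
  by apply: eq_integral => w _; rewrite ?funeposE ?funenegE.
apply: (measurableT_comp (@fine_measurable R setT measurableT)).
apply: emeasurable_funB.
- exact: (@measurable_fun_fubini_tonelli_F _ _ _ _ R nu _ (measurable_funepos mG)
    (funepos_ge0 G)).
- exact: (@measurable_fun_fubini_tonelli_F _ _ _ _ R nu _ (measurable_funeneg mG)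
    (funeneg_ge0 G)).
Qed.

Variable mu : {sigma_finite_measure set T -> \bar R}.

(** As [k] has mass 1, the average minus [H] is the integral of H(s w z) - H(z) against [k w].
    Tonelli moves the L1 norm inside, where only the shifts with [k w != 0] count, each within [e].
    Space and time mollification are both instances. *)
Lemma L1_average (H : T -> R) (k : W -> R) (s : W -> T -> T) (e : R) :
  measurable_fun setT (fun zw : T * W => s zw.2 zw.1) ->
  measurable_fun setT H -> measurable_fun setT k -> (forall w, 0 <= k w) ->
  nu.-integrable setT (EFin \o k) -> \int[nu]_w k w = 1 ->
  (forall z, nu.-integrable setT (EFin \o (fun w => H (s w z) * k w))) ->
  (forall w, k w != 0 -> (L1dist mu (H \o s w) H <= e%:E)%E) -> 0 <= e ->
  (L1dist mu (fun z => (\int[nu]_w (H (s w z) * k w))%R) H <= e%:E)%E.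
Proof.
move=> ms mH mk k0 ik k1 iHk He e0.
have mHs : measurable_fun setT (fun zw : T * W => H (s zw.2 zw.1)).
  exact: (measurableT_comp mH ms).
have mk2 : measurable_fun setT (fun zw : T * W => k zw.2).
  exact: (measurableT_comp mk measurable_snd).
have mH1 : measurable_fun setT (fun zw : T * W => H zw.1).
  exact: (measurableT_comp mH measurable_fst).
pose D (zw : T * W) : \bar R := (`|(H (s zw.2 zw.1) - H zw.1)%:E| * (k zw.2)%:E)%E.
have mD : measurable_fun setT D.
  apply: emeasurable_funM; last exact/measurable_EFinP.
  exact: measurable_L1dist.
have D0 zw : (0 <= D zw)%E by rewrite mule_ge0// lee_fin.
have mavg : measurable_fun setT (fun z => \int[nu]_w (H (s w z) * k w)).
  exact: (@measurable_Rintegral_param (fun zw => H (s zw.2 zw.1) * k zw.2)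
    (measurable_funM mHs mk2)).
apply: (@le_trans _ _ (\int[mu]_z \int[nu]_w D (z, w))%E).
  apply: ge0_le_integral => //.
  - exact: measurable_L1dist.
  - exact: (@measurable_fun_fubini_tonelli_F _ _ _ _ R nu _ mD D0).
  - move=> z _; have iHz : nu.-integrable setT (EFin \o (fun w => H z * k w)).
      exact: integrableZl_real.
    have -> : \int[nu]_w (H (s w z) * k w) - H z =
              \int[nu]_w (H (s w z) * k w - H z * k w).
      by rewrite RintegralB// RintegralZl// k1 mulr1.
    rewrite abse_EFin EFin_normr_Rintegral//; last first.
      exact: integrableB_real.
    apply: (le_trans (le_abse_integral _ _ _)) => //.
      apply/measurable_EFinP; apply: measurable_funB.
        exact: measurable_integrable_real (iHk z).
      exact: measurable_integrable_real iHz.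
    apply: ge0_le_integral => //.
    + apply: measurableT_comp => //; apply/measurable_EFinP; apply: measurable_funB.
        exact: measurable_integrable_real (iHk z).
      exact: measurable_integrable_real iHz.
    + exact: (measurableT_comp mD (pair1_measurable z)).
    + move=> w _; rewrite /D/= -EFinM lee_fin -mulrBl normrM.
      by rewrite (ger0_norm (k0 w)).
rewrite (fubini_tonelli _ mD D0).
apply: (@le_trans _ _ (\int[nu]_w (e%:E * (k w)%:E))%E); last first.
  by rewrite integralZl// -EFin_Rintegral// k1 mule1.
apply: ge0_le_integral => //.
- by move=> w _; exact: integral_ge0.
- exact: (@measurable_fun_fubini_tonelli_G _ _ _ _ R mu _ mD D0).
- by apply: emeasurable_funM => //; apply/measurable_EFinP.
- move=> w _; rewrite /D /=.
  have mw : measurable_fun setT (fun z => `|(H (s w z) - H z)%:E|%E).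
    apply: measurable_L1dist => //.
    exact: (measurableT_comp mHs (pair2_measurable w)).
  rewrite ge0_integralZr//; last by rewrite lee_fin.
  have [->|kw] := eqVneq (k w) 0; first by rewrite !mule0.
  by apply: lee_wpmul2r; [rewrite lee_fin|exact: He].
Qed.

End parametric_integrals.

(** * Jensen's inequality for weights of mass at most A *)

Section jensen.
Context {d} {W : measurableType d} {R : realType} (nu : {measure set W -> \bar R}).
Variables (k y : W -> R) (A : R).
Hypotheses (A0 : 0 < A) (k0 : forall w, 0 <= k w) (y0 : forall w, 0 <= y w)
  (ik : nu.-integrable setT (EFin \o k))
  (iy : nu.-integrable setT (EFin \o (fun w => y w * k w)))
  (iy2 : nu.-integrable setT (EFin \o (fun w => y w ^+ 2 * k w)))
  (iy3 : nu.-integrable setT (EFin \o (fun w => y w ^+ 3 * k w)))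
  (kA : \int[nu]_w k w <= A).
Let a := \int[nu]_w (y w * k w).
Let q := \int[nu]_w (y w ^+ 2 * k w).
Let E := \int[nu]_w (y w ^+ 3 * k w).

(** The cube lies above its tangent at [b] = a / A: y^3 >= 3 b^2 y - 2 b^3, because (y - b)^2 (y + 2
    b) >= 0. Integrating, with total mass at most A, gives b^3 A <= E; multiplication by A^2
    concludes. *)
Lemma jensen_cube : a ^+ 3 <= A ^+ 2 * E.
Proof.
have a0 : 0 <= a by apply: Rintegral_ge0 => w _; rewrite mulr_ge0.
pose b := a / A; have b0 : 0 <= b by rewrite divr_ge0// ltW.
have h : 3 * b ^+ 2 * a - 2 * b ^+ 3 * \int[nu]_w k w <= E.
  rewrite -RintegralZl// -RintegralZl// -RintegralB//; [|exact: integrableZl_real..].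
  apply: le_Rintegral => //.
    by apply: integrableB_real => //; exact: integrableZl_real.
  move=> w _; rewrite mulrA -mulrBl ler_wpM2r//.
  have := mulr_ge0 (sqr_ge0 (y w - b)) (addr_ge0 (y0 w) (mulr_ge0 (ler0n R 2) b0)).
  by rewrite -subr_ge0; congr (0 <= _); ring.
have {}h : 3 * b ^+ 2 * a - 2 * b ^+ 3 * A <= E.
  apply: le_trans h; rewrite lerD2l lerN2; apply: ler_wpM2l => //.
  by rewrite mulr_ge0// exprn_ge0.
have aE : a = b * A by rewrite /b divfK// gt_eqF.
have bE : b ^+ 3 * A <= E.
  by apply: le_trans h; rewrite aE le_eqVlt; apply/orP; left; apply/eqP; ring.
have := ler_wpM2l (sqr_ge0 A) bE; congr (_ <= _).
by rewrite aE; ring.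
Qed.

(** Pointwise a y^2 <= a^3 + y^3, by comparing a with y. After integration the first term costs a^3
    A, which [jensen_cube] bounds by A^3 E. *)
Lemma jensen_mul : a * q <= (A ^+ 3 + 1) * E.
Proof.
have a0 : 0 <= a by apply: Rintegral_ge0 => w _; rewrite mulr_ge0.
have h : a * q <= a ^+ 3 * \int[nu]_w k w + E.
  rewrite -RintegralZl// -RintegralZl// -RintegralD//; last exact: integrableZl_real.
  apply: le_Rintegral => //.
  - exact: integrableZl_real.
  - by apply: integrableD_real => //; exact: integrableZl_real.
  - move=> w _; rewrite mulrA -mulrDl ler_wpM2r//.
    have [ay|ya] := leP a (y w).
      rewrite ler_wpDl ?exprn_ge0// [in leRHS]exprS ler_wpM2r ?sqr_ge0//.
    rewrite ler_wpDr ?exprn_ge0// [in leRHS]exprS ler_wpM2l// lerXn2r ?nnegrE//.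
    exact: ltW.
apply: (le_trans h); rewrite mulrDl mul1r lerD2r.
apply: (le_trans (ler_wpM2l (exprn_ge0 3 a0) kA)).
have := ler_wpM2r (ltW A0) jensen_cube; congr (_ <= _).
by ring.
Qed.

End jensen.

Section shifts_and_reflections.
Context {R : realType}.

Lemma measurable_shift_rV n (b : 'rV[R]_n) :
  measurable_fun setT (fun x : 'rV[R]_n => x + b).
Proof.
have := measurable_affine_rV 1 b; congr (measurable_fun _ _).
by apply/funext => x /=; rewrite scale1r.
Qed.

Lemma measurable_reflect_rV n (b : 'rV[R]_n) :
  measurable_fun setT (fun x : 'rV[R]_n => b - x).
Proof.
have := measurable_affine_rV (-1) b; congr (measurable_fun _ _).
by apply/funext => x /=; rewrite scaleN1r addrC.
Qed.

Lemma measurable_shift_st n (b : R * 'rV[R]_n) :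
  measurable_fun setT (fun z : mspacetime R n => (z + b : R * 'rV[R]_n) : mspacetime R n).
Proof.
have := measurable_affine_st 1 b; congr (measurable_fun _ _).
by apply/funext => -[t x] /=; rewrite mul1r scale1r.
Qed.

Lemma measurable_fun_sub_rV d (T : measurableType d) n (f g : T -> 'rV[R]_n) :
  measurable_fun setT f -> measurable_fun setT g ->
  measurable_fun setT (fun x => f x - g x).
Proof.
move=> mf mg; have mfg : measurable_fun setT (fun x => (f x, g x)).
  exact/measurable_fun_pairP.
exact: (measurableT_comp (@measurable_sub_rV R n) mfg).
Qed.

Lemma measurable_sub_st n : measurable_fun setT
  (fun z : mspacetime R n * mspacetime R n => (z.1 - z.2 : R * 'rV[R]_n) : mspacetime R n).
Proof.
apply/measurable_fun_pairP; split.
  apply: (measurable_funB (f := fun z : mspacetime R n * mspacetime R n => (z.1.1 : R))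
     (g := fun z : mspacetime R n * mspacetime R n => (z.2.1 : R))).
  - exact: (measurableT_comp measurable_fst measurable_fst).
  - exact: (measurableT_comp measurable_fst measurable_snd).
apply: (measurable_fun_sub_rV
  (f := fun z : mspacetime R n * mspacetime R n => z.1.2) (g := fun z => z.2.2)).
- exact: (measurableT_comp measurable_snd measurable_fst).
- exact: (measurableT_comp measurable_snd measurable_snd).
Qed.

Local Open Scope ereal_scope.

Lemma lebesgue_rV_shift n (b : 'rV[R]_n) (f : 'rV[R]_n -> \bar R) :
  measurable_fun setT f -> (forall x, 0 <= f x) ->
  \int[lebesgue_rV n]_x f (x + b)%R = \int[lebesgue_rV n]_x f x.
Proof.
move=> mf f0; have := lebesgue_rV_affine b (oner_neq0 R) mf f0.
rewrite normr1 invr1 expr1n mul1e => <-; apply: eq_integral => x _ /=.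
by rewrite scale1r.
Qed.

Lemma lebesgue_rV_reflect n (b : 'rV[R]_n) (f : 'rV[R]_n -> \bar R) :
  measurable_fun setT f -> (forall x, 0 <= f x) ->
  \int[lebesgue_rV n]_x f (b - x)%R = \int[lebesgue_rV n]_x f x.
Proof.
move=> mf f0; have a0 : (-1 != 0 :> R)%R by rewrite oppr_eq0 oner_neq0.
have := lebesgue_rV_affine b a0 mf f0.
rewrite normrN1 invr1 expr1n mul1e => <-; apply: eq_integral => x _ /=.
by rewrite scaleN1r addrC.
Qed.

Lemma lebesgue_reflect (b : R) (f : R -> \bar R) :
  measurable_fun setT f -> (forall x, 0 <= f x) ->
  \int[@lebesgue_measure R]_x f (b - x)%R = \int[@lebesgue_measure R]_x f x.
Proof.
move=> mf f0; have a0 : (-1 != 0 :> R)%R by rewrite oppr_eq0 oner_neq0.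
have := lebesgue_affine b a0 mf f0.
rewrite normrN1 invr1 mul1e => <-; apply: eq_integral => x _ /=.
by rewrite mulN1r addrC.
Qed.

End shifts_and_reflections.

Section convolutions.
Context {R : realType} {n : nat}.
Local Notation S := (mspacetime R n).
Local Notation mu := (lebesgue_st n).
Local Notation lam := (lebesgue_rV n).
Local Notation leb := (@lebesgue_measure R).
Implicit Types (k : 'rV[R]_n -> R) (th : R -> R) (G H : S -> R).

(** The integral runs over the whole space, whereas [mollify] runs over Omega. It is applied to
    fields cut off to a bounded set; near the support of the test function the two agree on almost
    every time slice. *)
Definition convx k G (z : S) : R := \int[lam]_y (G (z.1, y) * k (z.2 - y)).

Definition convt th H (z : S) : R := \int[leb]_s (H (s, z.2) * th (z.1 - s)).

Definition convst (ka : R * 'rV[R]_n -> R) G (z : S) : R :=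
  \int[mu]_w (G w * ka (z - w)).

Definition tensk th k (z : R * 'rV[R]_n) : R := th z.1 * k z.2.

(** Asked at every time rather than almost every time: space convolutions are then integrals of
    integrable functions, differentiable in space, at every point. *)
Definition integrable_slices G := forall t : R, lam.-integrable setT (EFin \o (fun y => G (t, y))).

Lemma measurable_slice G t : measurable_fun setT G ->
  measurable_fun setT (fun y => G (t, y)).
Proof. by move=> mG; exact: (measurableT_comp mG (pair1_measurable t)). Qed.

Lemma measurable_slicet H x : measurable_fun setT H ->
  measurable_fun setT (fun t : measurableTypeR R => H (t, x)).
Proof. by move=> mH; exact: (measurableT_comp mH (pair2_measurable x)). Qed.

Lemma measurable_convx k G : measurable_fun setT k -> measurable_fun setT G ->
  measurable_fun setT (convx k G).
Proof.
move=> mk mG.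
apply: (@measurable_Rintegral_param _ _ S 'rV[R]_n R lam
  (fun zy => G (zy.1.1, zy.2) * k (zy.1.2 - zy.2))).
apply: measurable_funM.
  apply: (measurableT_comp mG); apply/measurable_fun_pairP; split.
    exact: (measurableT_comp measurable_fst measurable_fst).
  exact: measurable_snd.
apply: (measurableT_comp mk).
apply: (measurable_fun_sub_rV (f := fun zy : S * 'rV[R]_n => zy.1.2) (g := snd));
  last exact: measurable_snd.
exact: (measurableT_comp measurable_snd measurable_fst).
Qed.

Lemma measurable_convt th H : measurable_fun setT th -> measurable_fun setT H ->
  measurable_fun setT (convt th H).
Proof.
move=> mth mH.
apply: (@measurable_Rintegral_param _ _ S (measurableTypeR R) R leb
  (fun zs => H (zs.2, zs.1.2) * th (zs.1.1 - zs.2))).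
apply: measurable_funM.
  apply: (measurableT_comp mH); apply/measurable_fun_pairP; split.
    exact: measurable_snd.
  exact: (measurableT_comp measurable_snd measurable_fst).
apply: (measurableT_comp mth).
apply: (measurable_funB (f := fun zs : S * measurableTypeR R => (zs.1.1 : R))
     (g := fun zs : S * measurableTypeR R => (zs.2 : R))).
  exact: (measurableT_comp measurable_fst measurable_fst).
exact: measurable_snd.
Qed.

Lemma measurable_convst (ka : S -> R) G : measurable_fun setT ka -> measurable_fun setT G ->
  measurable_fun setT (convst ka G).
Proof.
move=> mk mG.
apply: (@measurable_Rintegral_param _ _ S S R mu (fun zw => G zw.2 * ka (zw.1 - zw.2))).
apply: measurable_funM.
  exact: (measurableT_comp mG measurable_snd).
exact: (measurableT_comp mk (@measurable_sub_st R n)).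
Qed.

Lemma integrable_convx_kernel k G (M : R) : measurable_fun setT k ->
  (forall x, `|k x| <= M) -> integrable_slices G ->
  forall z : S, lam.-integrable setT (EFin \o (fun y => G (z.1, y) * k (z.2 - y))).
Proof.
move=> mk kM sG z; apply: (@integrable_mul_bounded _ _ _ _ _ _ M) => //.
exact: (measurableT_comp mk (@measurable_reflect_rV R n z.2)).
Qed.

Lemma integrable_convst_kernel (ka : S -> R) G (M : R) : measurable_fun setT ka ->
  (forall x, `|ka x| <= M) -> mu.-integrable setT (EFin \o G) ->
  forall z : S, mu.-integrable setT (EFin \o (fun w => G w * ka (z - w))).
Proof.
move=> mk kM sG z; apply: (@integrable_mul_bounded _ _ _ _ _ _ M) => //.
apply: (measurableT_comp mk).
exact: (measurableT_comp (@measurable_sub_st R n) (pair1_measurable z)).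
Qed.

Lemma convx_norm_le k G (M : R) : measurable_fun setT k -> (forall x, `|k x| <= M) ->
  integrable_slices G -> forall z : S,
  (`|(convx k G z)%:E| <= \int[lam]_y `|(G (z.1, y) * k (z.2 - y))%:E|)%E.
Proof.
move=> mk kM sG z; have iz := integrable_convx_kernel mk kM sG z.
rewrite abse_EFin EFin_normr_Rintegral//; apply: le_abse_integral => //.
exact: measurable_int iz.
Qed.

(** Young's inequality in L1: on each time slice Tonelli and translation invariance factor the
    double integral into the norm of [k] times that of the slice. *)
Lemma integrable_convx k G (M : R) : measurable_fun setT k -> (forall x, `|k x| <= M) ->
  lam.-integrable setT (EFin \o k) -> integrable_slices G ->
  mu.-integrable setT (EFin \o G) -> mu.-integrable setT (EFin \o convx k G).
Proof.
move=> mk kM ik sG iG; have mG := measurable_integrable_real iG.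
apply: integrable_real_lty; first exact: measurable_convx.
have mF : measurable_fun setT (fun zy : S * 'rV[R]_n =>
    `|(G (zy.1.1, zy.2) * k (zy.1.2 - zy.2))%:E|%E).
  apply: measurableT_comp => //; apply/measurable_EFinP; apply: measurable_funM.
    apply: (measurableT_comp mG); apply/measurable_fun_pairP; split.
      exact: (measurableT_comp measurable_fst measurable_fst).
    exact: measurable_snd.
  apply: (measurableT_comp mk).
  apply: (measurable_fun_sub_rV (f := fun zy : S * 'rV[R]_n => zy.1.2) (g := snd));
  last exact: measurable_snd.
  exact: (measurableT_comp measurable_snd measurable_fst).
have mI : measurable_fun setT (fun z : S =>
    (\int[lam]_y `|(G (z.1, y) * k (z.2 - y))%:E|)%E).
  exact: (@measurable_fun_fubini_tonelli_F _ _ _ _ R lam _ mF (fun=> abse_ge0 _)).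
have K0 : (\int[lam]_y `|(k y)%:E| < +oo)%E by move/integrableP : ik => [].
have iG' : (\int[mu]_z `|(G z)%:E| < +oo)%E by move/integrableP : iG => [].
apply: (@le_lt_trans _ _ (\int[mu]_z \int[lam]_y `|(G (z.1, y) * k (z.2 - y))%:E|)%E).
  apply: ge0_le_integral => //.
  - by apply: measurableT_comp => //; apply/measurable_EFinP; exact: measurable_convx.
  - by move=> z _; exact: convx_norm_le kM sG z.
have -> : (\int[mu]_z \int[lam]_y `|(G (z.1, y) * k (z.2 - y))%:E| =
    \int[mu]_z (`|(G z)%:E| * \int[lam]_y `|(k y)%:E|))%E.
  have mGa : measurable_fun setT (fun z => `|(G z)%:E|%E).
    by apply: measurableT_comp => //; exact/measurable_EFinP.
  have mGk : measurable_fun setT (fun z => `|(G z)%:E| * \int[lam]_y `|(k y)%:E|)%E.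
    exact: emeasurable_funM.
  rewrite (fubini_st mI); last by move=> z; exact: integral_ge0.
  rewrite (fubini_st mGk); last by move=> z; rewrite mule_ge0// integral_ge0.
  apply: eq_integral => t _ /=.
  have mFt : measurable_fun setT (fun xy : 'rV[R]_n * 'rV[R]_n =>
      `|(G (t, xy.2) * k (xy.1 - xy.2))%:E|%E).
    have mp : measurable_fun setT (fun xy : 'rV[R]_n * 'rV[R]_n =>
        ((t : measurableTypeR R, xy.1), xy.2) : S * 'rV[R]_n).
      apply/measurable_fun_pairP; split; last exact: measurable_snd.
      by apply/measurable_fun_pairP; split; [exact: measurable_cst|exact: measurable_fst].
    exact: (measurableT_comp mF mp).
  rewrite (@fubini_tonelli _ _ _ _ R lam lam _ mFt (fun=> abse_ge0 _)).
  apply: eq_integral => y _.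
  have mky : measurable_fun setT (fun x : 'rV[R]_n => `|(k x)%:E|%E).
    by apply: measurableT_comp => //; exact/measurable_EFinP.
  rewrite -(lebesgue_rV_shift (- y) mky (fun=> abse_ge0 _)).
  rewrite -ge0_integralZl//.
    by apply: eq_integral => x _; rewrite /= normrM EFinM.
  exact: (measurableT_comp mky (measurable_shift_rV _)).
have Kfin : (\int[lam]_y `|(k y)%:E|)%E \is a fin_num.
  by rewrite ge0_fin_numE// integral_ge0.
rewrite -(fineK Kfin) ge0_integralZr//; last 2 first.
- by apply: measurableT_comp => //; exact/measurable_EFinP.
- by rewrite lee_fin fine_ge0// integral_ge0.
by rewrite muleC lte_mul_pinfty// lee_fin fine_ge0// integral_ge0.
Qed.

(** |convx k G (s, x)| is at most [M] times the L1 norm of the slice at time s, uniformly in x, and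
    that norm is integrable in s. So a further mollification in time makes sense at every x. *)
Lemma integrable_convx_time k G (M : R) : measurable_fun setT k -> (forall x, `|k x| <= M) ->
  integrable_slices G -> mu.-integrable setT (EFin \o G) ->
  forall x, leb.-integrable setT (EFin \o (fun s : measurableTypeR R => convx k G (s, x))).
Proof.
move=> mk kM sG iG x; have mG := measurable_integrable_real iG.
have M0 : 0 <= M by exact: le_trans (kM 0).
apply: integrable_real_lty.
  exact: (measurable_slicet x (measurable_convx mk mG)).
have mGa : measurable_fun setT (fun z => `|(G z)%:E|%E).
  by apply: measurableT_comp => //; exact/measurable_EFinP.
have mI : measurable_fun setT (fun s : measurableTypeR R => (\int[lam]_y `|(G (s, y))%:E|)%E).
  exact: (@measurable_fun_fubini_tonelli_F _ _ _ _ R lam _ mGa (fun=> abse_ge0 _)).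
apply: (@le_lt_trans _ _ (\int[leb]_s (M%:E * \int[lam]_y `|(G (s, y))%:E|))%E).
  apply: ge0_le_integral => //.
  - apply: measurableT_comp => //; apply/measurable_EFinP.
    exact: (measurable_slicet x (measurable_convx mk mG)).
  - exact: measurable_funeM.
  - move=> s _; apply: (le_trans (convx_norm_le mk kM sG (s, x))).
    have mGs : measurable_fun setT (fun y => `|(G (s, y))%:E|%E).
      exact: (measurableT_comp mGa (pair1_measurable (s : measurableTypeR R))).
    rewrite -ge0_integralZl//; apply: ge0_le_integral => //.
    + have := measurable_int _ (integrable_convx_kernel mk kM sG (s, x)).
      by move=> h; exact: measurableT_comp.
    + exact: measurable_funeM.
    + by move=> y _; rewrite /= normrM -EFinM lee_fin mulrC ler_wpM2r.
rewrite ge0_integralZl//; last by move=> s _; exact: integral_ge0.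
rewrite -(fubini_st mGa (fun=> abse_ge0 _)).
by rewrite lte_mul_pinfty//; move/integrableP : iG => [].
Qed.

(** Fubini for a product kernel. Thus, at a fixed space scale, shrinking the time kernel brings back
    the space mollification alone. *)
Lemma convst_tensk th k G (M M' : R) z : measurable_fun setT th -> measurable_fun setT k ->
  (forall t, `|th t| <= M') -> (forall x, `|k x| <= M) ->
  mu.-integrable setT (EFin \o G) ->
  integrable_slices G ->
  convst (tensk th k) G z = convt th (convx k G) z.
Proof.
move=> mth mk thM kM iG sG; have mG := measurable_integrable_real iG.
have mtk : measurable_fun setT (tensk th k : S -> R).
  apply: measurable_funM; first exact: (measurableT_comp mth measurable_fst).
  exact: (measurableT_comp mk measurable_snd).
have tkM w : `|tensk th k w| <= M' * M by rewrite /tensk normrM ler_pM.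
have iF := integrable_convst_kernel mtk tkM iG z.
rewrite /convst /Rintegral.
transitivity (fine (\int[leb]_s \int[lam]_y (G (s, y) * tensk th k (z - (s, y)))%:E)%E).
  by congr fine; rewrite (integral12_prod_meas1 iF).
rewrite /convt /Rintegral; congr fine; apply: eq_integral => s _.
have := integrable_convx_kernel mk kM sG (s, z.2).
set f := (fun y => _) => fi.
transitivity (\int[lam]_y ((th (z.1 - s))%:E * (f y)%:E))%E.
  by apply: eq_integral => y _; rewrite /tensk /f /= -EFinM; congr EFin; ring.
rewrite integralZl// -EFin_Rintegral// mulrC EFinM; congr (_ * _)%E.
Qed.

End convolutions.

Section approximate_identities.
Context {R : realType} {n : nat}.
Local Notation S := (mspacetime R n).
Local Notation mu := (lebesgue_st n).
Local Notation lam := (lebesgue_rV n).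
Local Notation leb := (@lebesgue_measure R).

Lemma integrable_measure_preserving d (T : measurableType d)
    (m : {measure set T -> \bar R}) (s : T -> T) (f : T -> R) :
  measurable_fun setT s ->
  (forall f : T -> \bar R, measurable_fun setT f -> (forall x, 0 <= f x)%E ->
    (\int[m]_x f (s x) = \int[m]_x f x)%E) ->
  m.-integrable setT (EFin \o f) -> m.-integrable setT (EFin \o (fun x => f (s x))).
Proof.
move=> ms inv fi; have mf := measurable_integrable_real fi.
apply: integrable_real_lty; first exact: (measurableT_comp mf ms).
rewrite (inv (fun x => `|(f x)%:E|%E))//.
- by move/integrableP : fi => [].
- by apply: measurableT_comp => //; exact/measurable_EFinP.
Qed.

(** The substitution y = z.2 + w displays the convolution as an average of translates of [G], the
    shape required by [L1_average]. *)
Lemma convxE (k : 'rV[R]_n -> R) (G : S -> R) (z : R * 'rV[R]_n) :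
  measurable_fun setT k -> measurable_fun setT G ->
  convx k G z = \int[lam]_w (G (z + ((0, w) : R * 'rV[R]_n)) * k (- w)).
Proof.
move=> mk mG; rewrite /convx /Rintegral; congr fine.
have mF : measurable_fun setT (fun y => (G (z.1, y) * k (z.2 - y))%:E).
  apply/measurable_EFinP; apply: measurable_funM; first exact: measurable_slice.
  exact: (measurableT_comp mk (@measurable_reflect_rV R n z.2)).
rewrite -(integral_measure_preserving (measurable_shift_rV z.2) _ mF); last first.
  by move=> f mf f0; exact: lebesgue_rV_shift.
apply: eq_integral => w _; rewrite opprD addrCA subrr addr0; congr (G _ * _)%:E.
by case: z mF => t x _ /=; congr pair; rewrite /= ?addr0 1?addrC.
Qed.

Lemma convtE (th : R -> R) (H : S -> R) (z : R * 'rV[R]_n) :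
  measurable_fun setT th -> measurable_fun setT H ->
  convt th H z = \int[leb]_s (H (z + ((s, 0) : R * 'rV[R]_n)) * th (- s)).
Proof.
move=> mk mG; rewrite /convt /Rintegral; congr fine.
have mF : measurable_fun setT (fun s : measurableTypeR R => (H (s, z.2) * th (z.1 - s))%:E).
  apply/measurable_EFinP; apply: measurable_funM; first exact: measurable_slicet.
  by apply: (measurableT_comp mk); exact: measurable_funB.
have ms : measurable_fun setT (fun s : measurableTypeR R => (s + z.1)%R : measurableTypeR R).
  exact: measurable_funD.
rewrite -(integral_measure_preserving ms _ mF); last first.
  by move=> f mf f0; exact: lebesgue_shift.
apply: eq_integral => w _; rewrite opprD addrCA subrr addr0; congr (H _ * _)%:E.
by case: z mF ms => t x _ _ /=; congr pair; rewrite /= ?addr0 1?addrC.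
Qed.

Lemma L1_convx (k : 'rV[R]_n -> R) (G : S -> R) (M e r : R) :
  measurable_fun setT k -> (forall x, `|k x| <= M) -> (forall x, 0 <= k x) ->
  lam.-integrable setT (EFin \o k) -> \int[lam]_x k x = 1 ->
  (forall x, k x != 0 -> `|x| < r) ->
  mu.-integrable setT (EFin \o G) -> integrable_slices G -> 0 <= e ->
  (forall v : R * 'rV[R]_n, `|v| < r ->
    (L1dist mu (fun z : S => G (z + v)%R) G <= e%:E)%E) ->
  (L1dist mu (convx k G) G <= e%:E)%E.
Proof.
move=> mk kM k0 ik k1 kr iG sG e0 He; have mG := measurable_integrable_real iG.
have mr := @measurable_reflect_rV R n 0.
have refl := fun f mf f0 => @lebesgue_rV_reflect R n 0 f mf f0.
have -> : convx k G = fun z : S => \int[lam]_w (G (z + ((0, w) : R * 'rV[R]_n)) * k (0 - w)).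
  by apply/funext => z; rewrite convxE//; apply: eq_Rintegral => w _; rewrite sub0r.
apply: (L1_average (nu := lam) (mu := mu) (H := G) (k := fun w => k (0 - w))
  (s := fun w (z : S) => (z + ((0, w) : R * 'rV[R]_n) : R * 'rV[R]_n) : S)) => //.
- apply/measurable_fun_pairP; split.
    apply: (measurable_funD (f := fun zw : S * 'rV[R]_n => (zw.1.1 : R)) (g := cst 0)) => //.
    exact: (measurableT_comp measurable_fst measurable_fst).
  have -> : snd \o (fun zw : S * 'rV[R]_n => (zw.1 + ((0, zw.2) : R * 'rV[R]_n) : R * 'rV[R]_n) : S) =
      (fun zw => zw.1.2 - (0 - zw.2)).
    by apply/funext => zw /=; rewrite sub0r opprK.
  apply: measurable_fun_sub_rV.
    exact: (measurableT_comp measurable_snd measurable_fst).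
  apply: measurable_fun_sub_rV; [exact: measurable_cst|exact: measurable_snd].
- exact: (measurableT_comp mk mr).
- exact: (integrable_measure_preserving mr refl ik).
- rewrite -k1 /Rintegral; congr fine.
  by rewrite (integral_measure_preserving mr refl (f := EFin \o k))//; exact/measurable_EFinP.
- move=> z; have iz := integrable_convx_kernel mk kM sG z.
  have := integrable_measure_preserving (measurable_shift_rV z.2)
    (fun f mf f0 => lebesgue_rV_shift z.2 mf f0) iz.
  apply: eq_integrable => // w _ /=; rewrite opprD addrCA subrr addr0 sub0r.
  congr (G _ * _)%:E.
  by case: z iz => t x _ /=; congr pair; rewrite /= ?addr0 1?addrC.
- move=> w; rewrite sub0r => /kr; rewrite normrN => wr; apply: He.
  by rewrite normr_st/= normr0 gt_max wr (le_lt_trans _ wr).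
Qed.

Lemma L1_convt (th : R -> R) (H : S -> R) (e r : R) :
  measurable_fun setT th -> (forall t, 0 <= th t) ->
  leb.-integrable setT (EFin \o th) -> \int[leb]_x th x = 1 ->
  (forall x, th x != 0 -> `|x| < r) -> measurable_fun setT H ->
  (forall z : S, leb.-integrable setT (EFin \o (fun s => H (s, z.2) * th (z.1 - s)))) ->
  0 <= e ->
  (forall v : R * 'rV[R]_n, `|v| < r ->
    (L1dist mu (fun z : S => H (z + v)%R) H <= e%:E)%E) ->
  (L1dist mu (convt th H) H <= e%:E)%E.
Proof.
move=> mk k0 ik k1 kr mG iz e0 He.
have mr : measurable_fun setT (fun s : measurableTypeR R => (0 - s)%R : measurableTypeR R).
  exact: measurable_funB.
have refl := fun f mf f0 => @lebesgue_reflect R 0 f mf f0.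
have -> : convt th H = fun z : S => \int[leb]_s (H (z + ((s, 0) : R * 'rV[R]_n)) * th (0 - s)).
  by apply/funext => z; rewrite convtE//; apply: eq_Rintegral => w _; rewrite sub0r.
apply: (L1_average (nu := leb) (mu := mu) (H := H) (k := fun w => th (0 - w))
  (s := fun w (z : S) => (z + ((w, 0) : R * 'rV[R]_n) : R * 'rV[R]_n) : S)) => //.
- apply/measurable_fun_pairP; split.
    apply: (measurable_funD (f := fun zw : S * measurableTypeR R => (zw.1.1 : R))
      (g := fun zw => (zw.2 : R))) => //.
    exact: (measurableT_comp measurable_fst measurable_fst).
    exact: measurable_snd.
  have -> : snd \o (fun zw : S * measurableTypeR R => (zw.1 + ((zw.2, 0) : R * 'rV[R]_n) : R * 'rV[R]_n) : S) =
      (fun zw => zw.1.2).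
    by apply/funext => zw /=; rewrite addr0.
  exact: (measurableT_comp measurable_snd measurable_fst).
- exact: (measurableT_comp mk mr).
- exact: (integrable_measure_preserving mr refl ik).
- rewrite -k1 /Rintegral; congr fine.
  by rewrite (integral_measure_preserving mr refl (f := EFin \o th))//; exact/measurable_EFinP.
- move=> z; have ms : measurable_fun setT (fun s : measurableTypeR R => (s + z.1)%R : measurableTypeR R).
    exact: measurable_funD.
  have := integrable_measure_preserving ms
    (fun f mf f0 => lebesgue_shift z.1 mf f0) (iz z).
  apply: eq_integrable => // w _ /=; rewrite opprD addrCA subrr addr0 sub0r.
  congr (H _ * _)%:E.
  by case: z ms => t x _ /=; congr pair; rewrite /= ?addr0 1?addrC.
- move=> w; rewrite sub0r => /kr; rewrite normrN => wr; apply: He.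
  by rewrite normr_st/= normr0 gt_max wr (le_lt_trans _ wr).
Qed.

End approximate_identities.

(** * Smooth functions and kernels *)

Section directional_derivatives.
Context {R : realType}.

(** Both difference quotients are the same function of h, so directional derivatives become
    one-variable derivatives along a line. *)
Lemma line_growthE {V W : normedModType R} (f : V -> W) (a v : V) (s : R) :
  (fun h => h^-1 *: (((fun k : R => f (k *: v + a)) \o shift s) (h *: 1) - f (s *: v + a)))
  = (fun h => h^-1 *: ((f \o shift (s *: v + a)) (h *: v) - f (s *: v + a))).
Proof.
apply/funext => h /=; congr (_ *: (f _ - _)).
by rewrite (_ : h *: 1 = h) ?scalerDl ?addrA//; exact: mulr1.
Qed.

Lemma derive_line {V W : normedModType R} (f : V -> W) (a v : V) (s : R) :
  'D_1 (fun k : R => f (k *: v + a)) s = 'D_v f (s *: v + a).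
Proof. by rewrite /derive line_growthE. Qed.

Lemma derivable_line {V W : normedModType R} (f : V -> W) (a v : V) (s : R) :
  derivable f (s *: v + a) v -> derivable (fun k : R => f (k *: v + a)) s 1.
Proof. by rewrite /derivable line_growthE. Qed.

Lemma derivable_line0 {V W : normedModType R} (f : V -> W) (a v : V) :
  derivable (fun k : R => f (k *: v + a)) 0 1 -> derivable f a v.
Proof. by rewrite /derivable line_growthE scale0r add0r. Qed.

Lemma derive_line0 {V W : normedModType R} (f : V -> W) (a v : V) :
  'D_v f a = 'D_1 (fun k : R => f (k *: v + a)) 0.
Proof. by rewrite derive_line scale0r add0r. Qed.

(* A directional derivative only sees the restriction of the function to a
   line; compare near_eq_derive, which needs a full neighbourhood. *)
Lemma eq_derive_line {V W : normedModType R} (f g : V -> W) (a v : V) :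
  (\forall h \near (0 : R), f (h *: v + a) = g (h *: v + a)) ->
  'D_v f a = 'D_v g a.
Proof.
move=> fg; rewrite (derive_line0 f) (derive_line0 g).
by apply: near_eq_derive; exact: fg.
Qed.

Section affine_precomposition.
Context {U V : normedModType R}.
Variables (A : U -> V) (L : U -> V).
Hypothesis AL : forall h v x, A (h *: v + x) = h *: L v + A x.

(** [AL] sends the line through x with direction v to the line through A x with direction L v. As
    [Ck] speaks of directional derivatives only, this comparison of lines serves as the chain
    rule. *)
Lemma derive_affine (f : V -> R) x v : 'D_v (f \o A) x = 'D_(L v) f (A x).
Proof.
rewrite derive_line0 [RHS]derive_line0; congr derive.
by apply/funext => h /=; rewrite AL.
Qed.

Lemma derivable_affine (f : V -> R) x v :
  derivable f (A x) (L v) -> derivable (f \o A) x v.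
Proof.
move=> df; apply: derivable_line0.
rewrite (_ : (fun k : R => _) = fun k : R => f (k *: L v + A x)); last first.
  by apply/funext => h /=; rewrite AL.
by apply: derivable_line; rewrite scale0r add0r.
Qed.

Lemma Ck_affine k (f : V -> R) : continuous A -> Ck k f -> Ck k (f \o A).
Proof.
move=> cA; elim: k f => [|k IH] f /= fk.
  by move=> x; apply: continuous_comp; [exact: cA|exact: fk].
have [cf df] := fk; split.
  by move=> x; apply: continuous_comp; [exact: cA|exact: cf].
move=> v; split => [x|].
  by apply: derivable_affine; have [h _] := df (L v); exact: h.
rewrite (_ : 'D_v (f \o A) = 'D_(L v) f \o A).
  by apply: IH; have [] := df (L v).
by apply/funext => x /=; rewrite derive_affine.
Qed.

Lemma smooth_affine (f : V -> R) : continuous A -> smooth f -> smooth (f \o A).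
Proof. by move=> cA sf k; exact: Ck_affine. Qed.

End affine_precomposition.

Section smooth_functions.
Context {V : normedModType R}.
Implicit Types f g : V -> R.

Lemma CkS k f : Ck k.+1 f -> Ck k f.
Proof.
elim: k f => [|k IH] f [cf df]//; split => // v.
by have [h1 h2] := df v; split => //; exact: IH.
Qed.

Lemma CkD k f g : Ck k f -> Ck k g -> Ck k (f + g).
Proof.
elim: k f g => [|k IH] f g /=.
  by move=> cf cg x; apply: continuousD; [exact: cf|exact: cg].
move=> [cf df] [cg dg]; split.
  by move=> x; apply: continuousD; [exact: cf|exact: cg].
move=> v; have [df1 df2] := df v; have [dg1 dg2] := dg v; split => [x|].
  exact: derivableD.
rewrite (_ : 'D_v (f + g) = 'D_v f + 'D_v g); first exact: IH.
by apply/funext => x; rewrite deriveD.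
Qed.

Lemma CkM k f g : Ck k f -> Ck k g -> Ck k (f * g).
Proof.
elim: k f g => [|k IH] f g /=.
  by move=> cf cg x; apply: continuousM; [exact: cf|exact: cg].
move=> fk gk; have [cf df] := fk; have [cg dg] := gk; split.
  by move=> x; apply: continuousM; [exact: cf|exact: cg].
move=> v; have [df1 df2] := df v; have [dg1 dg2] := dg v; split => [x|].
  exact: derivableM.
rewrite (_ : 'D_v (f * g) = f * 'D_v g + g * 'D_v f).
  by apply: CkD; apply: IH => //; exact: CkS.
by apply/funext => x; rewrite deriveM.
Qed.

Lemma Ck_cst k (c : R) : Ck k (cst c : V -> R).
Proof.
elim: k c => [|k IH] c /=; first by move=> x; exact: cvg_cst.
split => [x|v]; first exact: cvg_cst.
split => [x|]; first exact: derivable_cst.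
rewrite (_ : 'D_v _ = cst 0); first exact: IH.
by apply/funext => x; rewrite derive_cst.
Qed.

Lemma smoothM f g : smooth f -> smooth g -> smooth (f * g).
Proof. by move=> sf sg k; exact: CkM. Qed.

Lemma smooth_cst (c : R) : smooth (cst c : V -> R).
Proof. by move=> k; exact: Ck_cst. Qed.

Lemma smooth_continuous f : smooth f -> continuous f.
Proof. by move=> /(_ 0%N). Qed.

Lemma smooth_derivable f x v : smooth f -> derivable f x v.
Proof. by move=> /(_ 1%N)[_ /(_ v)[]]. Qed.

Lemma smooth_derive f v : smooth f -> smooth ('D_v f).
Proof. by move=> sf k; have /= [_ /(_ v)[]] := sf k.+1. Qed.

Lemma derive_eq0_off f (K : set V) v x : closed K -> (forall x, f x != 0 -> K x) ->
  'D_v f x != 0 -> K x.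
Proof.
move=> cK fK; apply: contra_neqP => nKx.
rewrite (near_eq_derive (g := cst 0)) ?derive_cst//.
have : nbhs x (~` K) by apply: open_nbhs_nbhs; split => //; exact: closed_openC.
apply: filterS => y nKy; apply/eqP; apply: contrapT => /negP fy.
exact/nKy/fK.
Qed.

Lemma bounded_of_compact f (K : set V) : continuous f -> compact K ->
  (forall x, f x != 0 -> K x) -> exists2 M : R, 0 <= M & forall x, `|f x| <= M.
Proof.
move=> cf cK fK.
have /compact_bounded[M [_ hM]] : compact (f @` K).
  by apply: continuous_compact => //; apply: continuous_subspaceT.
exists (`|M| + 1); first by rewrite addr_ge0.
move=> x; have [->|fx] := eqVneq (f x) 0; first by rewrite normr0 addr_ge0.
apply: hM; first by rewrite (le_lt_trans (ler_norm M))// ltrDl.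
by exists x => //; exact: fK.
Qed.

Lemma test_function_in f (K Q : set V) : hausdorff_space V -> smooth f ->
  compact K -> (forall x, f x != 0 -> K x) -> K `<=` Q -> test_function Q f.
Proof.
move=> hV sf cK fK KQ; have clK := compact_closed hV cK.
have tK : tsupp f `<=` K.
  by move/closure_id : clK => ->; apply: closureS => x; exact: fK.
split => //; last exact: subset_trans tK KQ.
by apply: subclosed_compact cK tK; exact: closed_closure.
Qed.

End smooth_functions.

Section mean_value_bound.
Context {V : normedModType R}.

Lemma mean_value_le (f : V -> R) (a v : V) (C : R) :
  (forall x, derivable f x v) -> (forall x, `|'D_v f x| <= C) ->
  forall h : R, 0 < h -> `|f (h *: v + a) - f a| <= C * h.
Proof.
move=> df fC h h0.
have [c _] : exists2 c : R, c \in `]0, h[ & f (h *: v + a) - f (0 *: v + a) =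
    'D_v f (c *: v + a) * (h - 0).
  apply: (@MVT _ (fun k : R => f (k *: v + a)) (fun k => 'D_v f (k *: v + a))) => //.
    move=> x _; apply: DeriveDef; last exact: derive_line.
    by apply: derivable_line; exact: df.
  apply: derivable_within_continuous => x _.
  by apply: derivable_line; exact: df.
rewrite scale0r add0r subr0 => ->.
by rewrite normrM (gtr0_norm h0) ler_wpM2r// ltW.
Qed.

End mean_value_bound.

Section derivative_under_integral.
Context {V : normedModType R} {d} {W : measurableType d}
  (nu : {measure set W -> \bar R}).
Variables (K : V -> W -> R) (a v : V) (G : W -> R) (C : R).
Hypotheses (intK : forall x, nu.-integrable setT (EFin \o (fun w => G w * K x w)))
  (iG : nu.-integrable setT (EFin \o G))
  (dK : forall x w, derivable (K ^~ w) x v)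
  (KC : forall x w, `|'D_v (K ^~ w) x| <= C).

Let f (h : R) w := G w * K (h *: v + a) w.

Let df (h : R) w : is_derive h (1 : R) (f ^~ w) (G w * 'D_v (K ^~ w) (h *: v + a)).
Proof.
have hK : is_derive h (1 : R) (fun h : R => K (h *: v + a) w)
    ('D_v (K ^~ w) (h *: v + a)).
  apply: DeriveDef; last exact: (derive_line (K^~ w)).
  by apply: (@derivable_line _ _ (K ^~ w)); exact: dK.
exact: (is_deriveZ (G w) hK).
Qed.

(** Collects once the common premises of the two theorems on differentiation under the integral: the
    parameter h runs over ]-1, 1[ and the majorant is C |G|. *)
Let under_hyp (T : Type) : (forall (I : set R := `]-1, 1[%classic), I 0 ->
  (forall x, I x -> nu.-integrable setT (EFin \o f x)) ->
  (forall (x : R) y, I x -> setT y -> derivable (f ^~ y) x (1 : R)) ->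
  (forall y, 0 <= C * `|G y|) ->
  nu.-integrable setT (EFin \o (fun y => C * `|G y|)) ->
  (forall x y, I x -> setT y -> `|partial1of2 f x y| <= C * `|G y|) -> T) -> T.
Proof.
apply.
- by rewrite /= in_itv/= ltrN10 ltr01.
- by move=> x _; exact: intK.
- by move=> x y _ _; have [] := df x y.
- move=> y; rewrite mulr_ge0//; exact: le_trans (normr_ge0 _) (KC a y).
- by apply: integrableZl_real; exact: integrable_norm.
- move=> x y _ _; rewrite partial1of2E (@derive_val _ _ _ _ _ _ _ (df x y)) normrM mulrC.
  by rewrite ler_wpM2r.
Qed.

Lemma derivable_integral : derivable (fun x => \int[nu]_w (G w * K x w)) a v.
Proof.
apply: derivable_line0; apply: under_hyp => I I0 h1 h2 h3 h4 h5.
exact: (derivable_under_integral measurableT I0 h1 h2 h3 h4 h5).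
Qed.

Lemma derive_integral : 'D_v (fun x => \int[nu]_w (G w * K x w)) a =
  \int[nu]_w (G w * 'D_v (K ^~ w) a).
Proof.
rewrite derive_line0 -derive1E; apply: under_hyp => I I0 h1 h2 h3 h4 h5.
rewrite (differentiation_under_integral measurableT I0 h1 h2 h3 h4 h5).
apply: eq_Rintegral => w _; rewrite partial1of2E (@derive_val _ _ _ _ _ _ _ (df 0 w)).
by rewrite scale0r add0r.
Qed.

End derivative_under_integral.

End directional_derivatives.

Section balls.
Context {R : realType} {n : nat}.
Local Notation S := (mspacetime R n).

Lemma rV_ball_compact (r : R) : compact [set x : 'rV[R]_n | `|x| <= r].
Proof.
have [r0|r0] := ltP r 0.
  rewrite (_ : [set x | _] = set0); first exact: compact0.
  by apply/seteqP; split => x //= xr; have := lt_le_trans r0 (le_trans (normr_ge0 x) xr); rewrite ltxx.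
have : compact [set x : 'rV[R]_n | forall i, `[- r, r]%classic (x ord0 i)].
  exact: (@rV_compact R n (fun=> `[- r, r]%classic) (fun=> @segment_compact R _ _)).
congr compact; apply/seteqP; split => x /=.
  move=> h; rewrite [X in X <= _]/Num.norm/= mx_normrE.
  apply: bigmax_le => // -[i j] _; rewrite /= ord1.
  by have := h j; rewrite in_itv/= -ler_norml.
by move=> xr i; rewrite in_itv/= -ler_norml (le_trans (normr_coord_le x i)).
Qed.

Lemma st_ball_compact (r : R) : compact [set z : R * 'rV[R]_n | `|z| <= r].
Proof.
have cI : compact `[- r, r]%classic by exact: segment_compact.
have := compact_setX cI (@rV_ball_compact r).
congr compact; apply/seteqP; split => -[t x] /=.
  by rewrite in_itv/= -ler_norml => -[tr xr]; rewrite normr_st ge_max/= tr.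
by rewrite normr_st ge_max/= => /andP[tr xr]; rewrite in_itv/= -ler_norml.
Qed.

Lemma measurable_norm_rV : measurable_fun setT (fun x : 'rV[R]_n => `|x|).
Proof. by apply: continuous_measurable_rV => x; exact: norm_continuous. Qed.

Lemma measurable_norm_st : measurable_fun setT (fun z : S => `|z : R * 'rV[R]_n|).
Proof. by apply: continuous_measurable_st => x; exact: norm_continuous. Qed.

Lemma measurable_ball_rV (r : R) : measurable [set x : 'rV[R]_n | `|x| <= r].
Proof.
rewrite (_ : [set x | _] = setT `&` (fun x : 'rV[R]_n => `|x|) @^-1` `]-oo, r]%classic).
  exact: (measurable_norm_rV measurableT (measurable_itv _)).
by rewrite setTI; apply/seteqP; split => x /=; rewrite in_itv.
Qed.

Lemma measurable_ball_st (r : R) : measurable ([set z : R * 'rV[R]_n | `|z| <= r] : set S).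
Proof.
rewrite (_ : [set z | _] = setT `&` (fun z : R * 'rV[R]_n => `|z|) @^-1` `]-oo, r]%classic).
  exact: (measurable_norm_st measurableT (measurable_itv _)).
by rewrite setTI; apply/seteqP; split => x /=; rewrite in_itv.
Qed.

Lemma lebesgue_rV_ball_lty (r : R) : (lebesgue_rV n [set x : 'rV[R]_n | (`|x| <= r)%R] < +oo)%E.
Proof.
pose I : set (measurableTypeR R) := `[- r, r]%classic.
have mI : measurable I by exact: measurable_itv.
apply: (@le_lt_trans _ _ (lebesgue_rV n [set x | forall i, I (x ord0 i)])).
  apply: le_measure; rewrite ?inE.
  - exact: measurable_ball_rV.
  - exact: (measurable_box (fun=> mI)).
  - by move=> x /= xr i; rewrite /I/= in_itv/= -ler_norml (le_trans (normr_coord_le x i)).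
rewrite (lebesgue_rV_box (A := fun=> I))//.
rewrite -ge0_fin_numE; last by apply: prode_ge0.
apply: prode_fin_num => _ _.
by rewrite /I lebesgue_measure_itv/=; case: ifP.
Qed.

Lemma lebesgue_st_ball_lty (r : R) :
  (lebesgue_st n ([set z : R * 'rV[R]_n | (`|z| <= r)%R] : set S) < +oo)%E.
Proof.
pose I : set (measurableTypeR R) := `[- r, r]%classic.
have mI : measurable I by exact: measurable_itv.
apply: (@le_lt_trans _ _ (lebesgue_st n (I `*` [set x : 'rV[R]_n | (`|x| <= r)%R]))).
  apply: le_measure; rewrite ?inE.
  - exact: measurable_ball_st.
  - by apply: measurableX => //; exact: measurable_ball_rV.
  - move=> -[t x]/=; rewrite normr_st ge_max/= => /andP[tr xr].
    by rewrite /I/= in_itv/= -ler_norml.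
rewrite [X in (X < _)%E](product_measure1E lebesgue_measure (lebesgue_rV n) mI (measurable_ball_rV r)).
have If : (lebesgue_measure I \is a fin_num).
  by rewrite /I lebesgue_measure_itv/=; case: ifP.
by rewrite lte_mul_pinfty//; exact: lebesgue_rV_ball_lty.
Qed.

Lemma integrable_indic_lty d (T : measurableType d) (m : {measure set T -> \bar R})
    (A : set T) : measurable A -> (m A < +oo)%E -> m.-integrable setT (EFin \o \1_A).
Proof.
move=> mA Aoo; apply/integrableP; split.
  by apply/measurable_EFinP; exact: measurable_indic.
under eq_integral do rewrite /= ger0_norm//.
by rewrite integral_indic// setIT.
Qed.

Lemma integrable_bounded_support d (T : measurableType d) (m : {measure set T -> \bar R})
    (A : set T) (f : T -> R) (M : R) : measurable A -> (m A < +oo)%E ->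
  measurable_fun setT f -> (forall x, `|f x| <= M) -> (forall x, f x != 0 -> A x) ->
  m.-integrable setT (EFin \o f).
Proof.
move=> mA Aoo mf fM fA.
apply: (@integrable_real_le _ _ _ _ _ (fun x => M * \1_A x)) => //.
  move=> x; have [->|fx] := eqVneq (f x) 0.
    by rewrite normr0 mulr_ge0// (le_trans _ (fM x)).
  by rewrite indicE mem_set ?mulr1//; exact: fA.
by apply: integrableZl_real; exact: integrable_indic_lty.
Qed.

End balls.

(** * Integration by parts *)

Section integration_by_parts.
Context {R : realType} {n : nat}.
Local Notation S := (mspacetime R n).
Local Notation mu := (lebesgue_st n).

(* By translation invariance every difference quotient has integral zero. *)
Lemma integral_derive0 (F : R * 'rV[R]_n -> R) (v : R * 'rV[R]_n) (C r : R) :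
  mu.-integrable setT (EFin \o (F : S -> R)) ->
  measurable_fun setT ('D_v F : S -> R) ->
  (forall z, derivable F z v) -> (forall z, `|'D_v F z| <= C) ->
  (forall z, F z != 0 -> `|z| <= r) ->
  mu.-integrable setT (EFin \o ('D_v F : S -> R)) /\ \int[mu]_(z in setT) 'D_v F z = 0.
Proof.
move=> iF mDF dF DFC Fr.
have C0 : 0 <= C by exact: le_trans (normr_ge0 _) (DFC 0).
have mF := measurable_integrable_real iF.
pose h k : R := k.+1%:R^-1.
have h0 k : 0 < h k by rewrite /h invr_gt0.
pose q k (z : S) := (h k)^-1 * (F (z + h k *: v) - F z).
have iFs k : mu.-integrable setT (EFin \o (fun z : S => F (z + h k *: v))).
  exact: (integrable_measure_preserving (measurable_shift_st (h k *: v))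
    (fun f mf f0 => lebesgue_st_shift (h k *: v) mf f0) iF).
have iq k : mu.-integrable setT (EFin \o q k).
  by apply: integrableZl_real; exact: integrableB_real.
have q0 k : \int[mu]_z q k z = 0.
  rewrite RintegralZl//; last exact: integrableB_real.
  rewrite RintegralB//; apply/eqP; rewrite mulf_eq0 subr_eq0; apply/orP; right.
  rewrite /Rintegral; apply/eqP; congr fine.
  exact: (integral_measure_preserving (measurable_shift_st (h k *: v))
    (fun f mf f0 => lebesgue_st_shift (h k *: v) mf f0) (f := EFin \o F) (measurable_int _ iF)).
(* Since [h k] is at most 1, both [F] and its shifts vanish outside this ball; with the mean value
   bound, [C] times its indicator dominates every quotient. *)
pose B := [set z : R * 'rV[R]_n | `|z| <= r + `|v|] : set S.
have mB : measurable B by exact: measurable_ball_st.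
have qB k z : `|q k z| <= C * \1_B z.
  have [Bz|Bz] := pselect (B z).
    rewrite indicE mem_set// mulr1 normrM gtr0_norm ?invr_gt0// mulrC.
    by rewrite ler_pdivrMr// [z + _]addrC; exact: (mean_value_le _ dF DFC (h0 k)).
  suff -> : q k z = 0 by rewrite normr0 mulr_ge0.
  rewrite /q; have -> : F z = 0.
    apply/eqP; apply: contrapT => /negP /Fr zr; apply: Bz.
    by rewrite /B/= (le_trans zr)// lerDl.
  have -> : F (z + h k *: v) = 0.
    apply/eqP; apply: contrapT => /negP /Fr zr; apply: Bz; rewrite /B/=.
    rewrite -[X in `|X|](addrK (h k *: v)) (le_trans (ler_normB _ _))// lerD//.
    rewrite normrZ gtr0_norm// ler_piMl// /h invf_le1// ler1n//.
  by rewrite subrr mulr0.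
have [] := @dominated_convergence _ S R mu setT measurableT
  (fun k z => (q k z)%:E) (EFin \o 'D_v F) (fun z => (C * \1_B z)%:E).
- by move=> k; apply: measurable_int (iq k).
- exact/measurable_EFinP.
- apply/aeW => z _; apply: cvg_EFinW.
  have /cvg_ex[l hl] := dF z.
  have -> : 'D_v F z = l by apply/cvg_lim.
  have hk : (forall k, h k != 0) /\ h k @[k --> \oo] --> 0.
    by split => [k|]; [rewrite gt_eqF|exact: cvg_harmonic].
  move/cvgr_dnbhsP : hl => /(_ _ hk).
  apply: cvg_trans; apply: near_eq_cvg; apply: nearW => k.
  by rewrite /q /= [z + _]addrC.
- by apply: integrableZl_real; apply: integrable_indic_lty => //; exact: lebesgue_st_ball_lty.
- by apply/aeW => z k _; rewrite abse_EFin lee_fin; exact: qB.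
move=> iD _ cvgD; split; first exact: iD.
rewrite /Rintegral.
have -> : (\int[mu]_z ('D_v F z)%:E)%E = 0%E; last by [].
have E k : (\int[mu]_z (q k z)%:E)%E = 0%E by rewrite -EFin_Rintegral// q0.
have c0 : (\int[mu]_z (q k z)%:E)%E @[k --> \oo] --> 0%E.
  by rewrite (_ : (fun k => _) = cst 0%E); [exact: cvg_cst|apply/funext => k; exact: E].
by apply: (cvg_unique _ cvgD c0).
Qed.

End integration_by_parts.

(** * Mollification kernels in space and in time *)

Section kernels.
Context {R : realType}.

Lemma test_function_norm_lt1 n (eta : 'rV[R]_n -> R) x :
  test_function [set x | enorm x < 1] eta -> eta x != 0 -> enorm x < 1.
Proof. by move=> [_ _ sup] etax; apply: sup; exact: subset_closure. Qed.

Lemma dotvZ n (a : R) (x : 'rV[R]_n) : dotv (a *: x) (a *: x) = a ^+ 2 * dotv x x.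
Proof. by rewrite /dotv mulr_sumr; apply: eq_bigr => i _; rewrite !mxE; ring. Qed.

Lemma enormZ n (a : R) (x : 'rV[R]_n) : enorm (a *: x) = `|a| * enorm x.
Proof. by rewrite /enorm dotvZ sqrtrM ?sqr_ge0// sqrtr_sqr. Qed.

Section space_kernel.
Context {n : nat}.
Variables (eta : 'rV[R]_n -> R) (l : R).
Hypotheses (l0 : 0 < l) (reta : radial_kernel eta).
Let k := scaled_kernel eta l.

Lemma scaled_kernel_ge0 x : 0 <= k x.
Proof.
have [_ h _ _] := reta; rewrite mulr_ge0//; first by rewrite invr_ge0 exprn_ge0// ltW.
by have /andP[] := h (l^-1 *: x).
Qed.

Lemma scaled_kernel_smooth : smooth k.
Proof.
have [[se _ _] _ _ _] := reta.
have -> : k = cst (l ^- n) * (eta \o (fun x => l^-1 *: x)) by [].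
apply: smoothM; first exact: smooth_cst.
apply: (@smooth_affine _ _ _ (fun x => l^-1 *: x) (fun x => l^-1 *: x)) => //.
- by move=> h v x; rewrite scalerDr !scalerA mulrC.
- exact: scaler_continuous.
Qed.

Lemma scaled_kernel_supp x : k x != 0 -> `|x| < l.
Proof.
rewrite mulf_eq0 negb_or => /andP[_ ex]; have [te _ _ _] := reta.
have := test_function_norm_lt1 te ex.
rewrite enormZ gtr0_norm ?invr_gt0// mulrC ltr_pdivrMr// mul1r.
exact: le_lt_trans (normr_le_enorm x).
Qed.

Lemma scaled_kernel_measurable : measurable_fun setT k.
Proof.
by apply: continuous_measurable_rV; exact: smooth_continuous scaled_kernel_smooth.
Qed.

Lemma scaled_kernel_integrable : (lebesgue_rV n).-integrable setT (EFin \o k).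
Proof.
have [M _ kM] := bounded_of_compact (smooth_continuous scaled_kernel_smooth)
  (@rV_ball_compact R n l) (fun x kx => ltW (scaled_kernel_supp kx)).
exact: (integrable_bounded_support (measurable_ball_rV l) (lebesgue_rV_ball_lty l)
  scaled_kernel_measurable kM (fun x kx => ltW (scaled_kernel_supp kx))).
Qed.

Lemma scaled_kernel_int : \int[lebesgue_rV n]_x k x = 1.
Proof.
have [[se _ _] eta01 _ e1] := reta.
have me : measurable_fun setT eta.
  by apply: continuous_measurable_rV; exact: smooth_continuous se.
have li0 : l^-1 != 0 by rewrite invr_eq0 gt_eqF.
have e0 x : (0 <= (eta x)%:E)%E by rewrite lee_fin; have /andP[] := eta01 x.
have mee : measurable_fun setT (EFin \o eta) by exact/measurable_EFinP.
have := lebesgue_rV_affine 0 li0 mee e0.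
(* [fine] maps infinite values to 0, so a real integral equal to 1 forces the extended integral to
   be 1. *)
have -> : (\int[lebesgue_rV n]_x (EFin \o eta) x = 1)%E.
  move: e1; rewrite /Rintegral; case: (integral _ _ _) => [r /= ->//| |] /= /eqP;
  by rewrite eq_sym oner_eq0.
rewrite mule1 gtr0_norm ?invr_gt0// invrK /= => h.
rewrite /Rintegral; under eq_integral do rewrite EFinM.
rewrite ge0_integralZl//; last 2 first.
- apply/measurable_EFinP; apply: (measurableT_comp me).
  have := measurable_affine_rV l^-1 (0 : 'rV[R]_n); congr (measurable_fun _ _).
  by apply/funext => x; rewrite addr0.
- by rewrite lee_fin invr_ge0 exprn_ge0// ltW.
under eq_integral do rewrite -[l^-1 *: _]addr0.
by rewrite h -EFinM/= mulVf// expf_neq0// gt_eqF.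
Qed.

End space_kernel.

Section time_kernel.
Context {m : nat}.
Variable eta : 'rV[R]_m.+1 -> R.
Hypothesis reta : radial_kernel eta.
Let e1 : 'rV[R]_m.+1 := basis_vec ord0.

Let enorm_e1 (s : R) : enorm (s *: e1) = `|s|.
Proof.
rewrite enormZ /enorm /dotv (bigD1 ord0)//= big1; last first.
  by move=> i i0; rewrite !mxE eqxx (negbTE i0) mul0r.
by rewrite !mxE !eqxx mulr1 addr0 sqrtr1 mulr1.
Qed.

(** The time kernel is obtained from [eta] itself: its restriction to a coordinate axis is a smooth
    bump in one variable. An axis exists because the dimension is m.+1. *)
Let th0 (s : R) := eta (s *: e1).

Let th0_affine (a : R) : smooth (fun s : R => th0 (a * s)).
Proof.
have [[se _ _] _ _ _] := reta.
apply: (@smooth_affine _ _ _ (fun s : R => (a * s) *: e1) (fun s : R => (a * s) *: e1)) => //.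
- by move=> h v x; rewrite scalerA -scalerDl (_ : h *: v = h * v)//; congr (_ *: _); ring.
- have -> : (fun s : R => (a * s) *: e1) = fun s : R => s *: (a *: e1).
    by apply/funext => s; rewrite scalerA mulrC.
  exact: scalel_continuous.
Qed.

Let th0_continuous : continuous th0.
Proof.
rewrite (_ : th0 = fun s => th0 (1 * s)); last by apply/funext => s; rewrite mul1r.
exact: smooth_continuous (th0_affine 1).
Qed.

Let th0_ge0 s : 0 <= th0 s.
Proof. by have [_ h _ _] := reta; have /andP[] := h (s *: e1). Qed.

Let th0_supp s : th0 s != 0 -> `|s| < 1.
Proof.
by have [te _ _ _] := reta => /(test_function_norm_lt1 te); rewrite enorm_e1.
Qed.

Let th0_integrable : lebesgue_measure.-integrable setT (EFin \o th0).
Proof.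
have supp s : th0 s != 0 -> `[-1, 1]%classic s.
  by move=> /th0_supp/ltW; rewrite /= in_itv/= -ler_norml.
have [M _ kM] := bounded_of_compact th0_continuous (@segment_compact R (-1) 1) supp.
apply: (integrable_bounded_support (A := `[-1, 1]%classic : set (measurableTypeR R)) _ _ _ kM supp).
- exact: measurable_itv.
- suff : (@lebesgue_measure R `[(-1)%R, 1%R]%classic < +oo)%E by [].
  by rewrite lebesgue_measure_itv/= lte_fin; case: ifP => // _; rewrite -EFinB ltry.
- exact: continuous_measurable_fun.
Qed.

(** If [th0] vanished identically, radiality would carry this to every point and contradict the unit
    integral of [eta]. Continuity then gives an interval around [s0] on which [th0] exceeds half its
    value there. *)
Let th0_pos : 0 < \int[lebesgue_measure]_s th0 s.
Proof.
have [s0 s0P] : exists s, 0 < th0 s.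
  apply: contrapT => nex.
  have eta0 x : eta x = 0.
    have [_ _ rad _] := reta.
    rewrite (rad x (enorm x *: e1)); last by rewrite enorm_e1 ger0_norm// enorm_ge0.
    apply/eqP; rewrite eq_le th0_ge0 andbT leNgt; apply/negP => h.
    by apply: nex; exists (enorm x).
  have [_ _ _] := reta; under eq_Rintegral do rewrite eta0.
  rewrite /Rintegral integral0 /= => /eqP.
  by rewrite eq_sym oner_eq0.
pose c := th0 s0 / 2; have c0 : 0 < c by rewrite divr_gt0.
have [d /= d0 hd] : \forall s \near s0, c < th0 s.
  have := @th0_continuous s0 => /cvgrPdist_lt/(_ _ c0).
  apply: filterS => s; rewrite ltr_distlC => /andP[h _].
  by apply: le_lt_trans h; rewrite [th0 s0]splitr addrK.
pose I : set (measurableTypeR R) := `]s0 - d, s0 + d[%classic.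
have mI : measurable I by exact: measurable_itv.
have Ioo : (lebesgue_measure I = (d *+ 2)%:E)%E.
  rewrite lebesgue_measure_itv/= lte_fin ltrD2l gtrN// -EFinB.
  by congr EFin; ring.
have Ilt : (lebesgue_measure I < +oo)%E by rewrite Ioo ltry.
have : \int[lebesgue_measure]_s (c * \1_I s) <= \int[lebesgue_measure]_s th0 s.
  apply: le_Rintegral => //.
    by apply: integrableZl_real; exact: integrable_indic_lty.
  move=> s _; have [Is|Is] := pselect (I s); last by rewrite indicE memNset// mulr0.
  rewrite indicE mem_set// mulr1 ltW//; apply: hd; rewrite /= ltr_distlC.
  by move: Is; rewrite /I/= in_itv.
apply: lt_le_trans; rewrite RintegralZl//; last first.
  by exact: integrable_indic_lty.
rewrite mulr_gt0// /Rintegral integral_indic// setIT.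
suff -> : fine (lebesgue_measure I) = d *+ 2 by rewrite mulrn_wgt0.
by rewrite Ioo.
Qed.

Lemma time_kernel_exists (r : R) : 0 < r -> exists th : R -> R,
  [/\ smooth th, forall t, 0 <= th t, lebesgue_measure.-integrable setT (EFin \o th),
      \int[lebesgue_measure]_t th t = 1 & forall t, th t != 0 -> `|t| < r].
Proof.
move=> r0; pose c0 := \int[lebesgue_measure]_s th0 s.
(* Rescaling time by r multiplies the mass [c0] by r; the factor [a] restores mass 1. *)
pose a := (c0 * r)^-1; have a0 : 0 < a by rewrite invr_gt0 mulr_gt0// th0_pos.
have mth0 : measurable_fun setT th0 by exact: continuous_measurable_fun.
have ri0 : r^-1 != 0 by rewrite invr_eq0 gt_eqF.
have mthr : measurable_fun setT (fun t => th0 (r^-1 * t)).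
  by apply: (measurableT_comp mth0); exact: measurable_funM.
have h : (\int[lebesgue_measure]_t (th0 (r^-1 * t))%:E = (r * c0)%:E)%E.
  have mE : measurable_fun setT (EFin \o th0) by exact/measurable_EFinP.
  have E0 t : (0 <= (EFin \o th0) t)%E by rewrite lee_fin.
  have := lebesgue_affine 0 ri0 mE E0.
  under eq_integral do rewrite addr0.
  by move=> ->; rewrite gtr0_norm ?invr_gt0// invrK EFinM -EFin_Rintegral.
exists (fun t => a * th0 (r^-1 * t)); split.
- have -> : (fun t => a * th0 (r^-1 * t)) = cst a * (fun t => th0 (r^-1 * t)) by [].
  by apply: smoothM; [exact: smooth_cst|exact: th0_affine].
- by move=> t; rewrite mulr_ge0// ltW.
- apply: integrableZl_real; apply: integrable_real_lty => //.
  by under eq_integral do rewrite abse_EFin ger0_norm//; rewrite h ltry.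
- rewrite RintegralZl//; last first.
    apply: integrable_real_lty => //.
    by under eq_integral do rewrite abse_EFin ger0_norm//; rewrite h ltry.
  by rewrite /Rintegral h /= /a [c0 * r]mulrC mulVf// mulf_neq0 ?gt_eqF// th0_pos.
- move=> t; rewrite mulf_eq0 negb_or => /andP[_ /th0_supp].
  by rewrite normrM gtr0_norm ?invr_gt0// mulrC ltr_pdivrMr// mul1r.
Qed.

End time_kernel.

End kernels.

Section convolution_derivatives.
Context {R : realType} {n : nat}.
Local Notation S := (mspacetime R n).
Local Notation mu := (lebesgue_st n).
Local Notation lam := (lebesgue_rV n).

Lemma derive_oppv {V : normedModType R} (f : V -> R) (a v : V) :
  derivable f a v -> derivable f a (- v) /\ 'D_(- v) f a = - 'D_v f a.
Proof.
move=> df.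
have h1 : is_derive (0 : R) (1 : R) (fun k : R => f (k *: v + a)) ('D_v f a).
  apply: DeriveDef; last by rewrite derive_line scale0r add0r.
  by apply: derivable_line; rewrite scale0r add0r.
have h2 : is_derive (0 : R) (1 : R) (fun k : R => - k) (-1).
  exact: (is_deriveN (is_derive_id (0 : R) (1 : R))).
have h3 : is_derive (0 : R) (1 : R) (fun k : R => f (k *: - v + a)) (- 'D_v f a).
  have -> : (fun k : R => f (k *: - v + a)) = (fun k : R => f (k *: v + a)) \o -%R.
    by apply/funext => k /=; rewrite scalerN scaleNr.
  rewrite -mulrN1; apply: is_derive1_comp => //.
  by rewrite oppr0.
split; first by apply: derivable_line0; case: h3.
by rewrite derive_line0; case: h3.
Qed.

Section smooth_kernel_st.
Variables (ka : R * 'rV[R]_n -> R) (r : R).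
Hypotheses (ska : smooth ka) (kar : forall z, ka z != 0 -> `|z| <= r).

Lemma derive_kernel_supp v z : 'D_v ka z != 0 -> `|z| <= r.
Proof.
apply: (derive_eq0_off (f := ka) (K := [set z | `|z| <= r])) => //.
by apply: compact_closed; [exact: norm_hausdorff|exact: st_ball_compact].
Qed.

Lemma kernel_bounded : exists2 M : R, 0 <= M & forall z, `|ka z| <= M.
Proof.
exact: (bounded_of_compact (smooth_continuous ska) (@st_ball_compact R n r) kar).
Qed.

Lemma derive_kernel_bounded v : exists2 M : R, 0 <= M & forall z, `|'D_v ka z| <= M.
Proof.
exact: (bounded_of_compact (smooth_continuous (smooth_derive v ska))
  (@st_ball_compact R n r) (@derive_kernel_supp v)).
Qed.

Lemma measurable_kernel : measurable_fun setT (ka : S -> R).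
Proof. exact: continuous_measurable_st (smooth_continuous ska). Qed.

Lemma measurable_derive_kernel v : measurable_fun setT ('D_v ka : S -> R).
Proof. exact: continuous_measurable_st (smooth_continuous (smooth_derive v ska)). Qed.

Lemma is_derive_convst (G : S -> R) z v : mu.-integrable setT (EFin \o G) ->
  is_derive z v (convst ka G : R * 'rV[R]_n -> R) (convst ('D_v ka) G z).
Proof.
move=> iG; have [M _ kM] := kernel_bounded; have [M' _ dkM] := derive_kernel_bounded v.
have AL w h (v' x : R * 'rV[R]_n) : h *: v' + x - w = h *: v' + (x - w) by rewrite addrA.
have dK x w : derivable (fun z : R * 'rV[R]_n => ka (z - w)) x v.
  apply: (@derivable_affine _ _ _ (fun z => z - w) id) => //; exact: smooth_derivable.
have DK x w : 'D_v (fun z : R * 'rV[R]_n => ka (z - w)) x = 'D_v ka (x - w).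
  exact: (@derive_affine _ _ _ (fun z => z - w) id (AL w) ka).
have iK (x : R * 'rV[R]_n) : mu.-integrable setT (EFin \o (fun w => G w * ka (x - w))).
  exact: (integrable_convst_kernel measurable_kernel kM iG x).
have KC (x : R * 'rV[R]_n) w : `|'D_v (fun z : R * 'rV[R]_n => ka (z - w)) x| <= M'.
  by rewrite DK.
apply: DeriveDef.
  exact: (@derivable_integral _ _ _ S mu (fun (z w : R * 'rV[R]_n) => ka (z - w)) z v
    G M' iK iG dK KC).
rewrite (@derive_integral _ _ _ S mu (fun (z w : R * 'rV[R]_n) => ka (z - w)) z v
  G M' iK iG dK KC).
by apply: eq_Rintegral => w _; rewrite DK.
Qed.

(** These reflected kernels are the test functions that turn the weak equations into pointwise
    identities between convolutions. *)
Lemma test_function_kernel (Q : set (R * 'rV[R]_n)) z :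
  (forall w, `|z - w| <= r -> Q w) -> test_function Q (fun w => ka (z - w)).
Proof.
move=> zQ; pose K := (fun w : R * 'rV[R]_n => z - w) @` [set w | `|w| <= r].
apply: (@test_function_in _ _ _ K).
- exact: norm_hausdorff.
- apply: (@smooth_affine _ _ _ (fun w => z - w) (fun w => - w)) => //.
    by move=> h v x; rewrite scalerN opprD addrCA.
  move=> w; apply: cvgB; [exact: cvg_cst|exact: cvg_id].
- apply: continuous_compact; last exact: st_ball_compact.
  apply: continuous_subspaceT => w; apply: cvgB; [exact: cvg_cst|exact: cvg_id].
- move=> w /kar h; exists (z - w) => //.
  by rewrite opprB addrC subrK.
- by move=> _ [w wr <-]; apply: zQ; rewrite opprB addrC subrK.
Qed.

Lemma derive_reflected_kernel z v w :
  'D_v (fun w => ka (z - w)) w = - 'D_v ka (z - w).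
Proof.
rewrite (@derive_affine _ _ _ (fun w => z - w) (fun w => - w)); last first.
  by move=> h u x; rewrite scalerN opprD addrCA.
have dka : derivable ka (z - w) v by exact: smooth_derivable.
by have [_] := derive_oppv dka.
Qed.

End smooth_kernel_st.

Section tensor_kernel.
Variables (th : R -> R) (k : 'rV[R]_n -> R).
Hypotheses (sth : smooth th) (sk : smooth k).

Lemma tensk_smooth : smooth (tensk th k).
Proof.
have -> : tensk th k = (th \o fst) * (k \o snd) by [].
apply: smoothM.
  apply: (@smooth_affine _ _ _ fst fst) => // z; exact: cvg_fst.
apply: (@smooth_affine _ _ _ snd snd) => // z; exact: cvg_snd.
Qed.

(** A space derivative keeps the time factor, so differentiated mollified fields are again
    convolutions with product kernels and converge in the same way as the time kernel shrinks. *)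
Lemma derive_tensk_x (w : 'rV[R]_n) :
  'D_((0, w) : R * 'rV[R]_n) (tensk th k) = tensk th ('D_w k).
Proof.
apply/funext => -[t x]; rewrite derive_line0.
have -> : (fun h : R => tensk th k (h *: ((0, w) : R * 'rV[R]_n) + (t, x))) =
    (th t \*: (fun h : R => k (h *: w + x))).
  by apply/funext => h; rewrite /tensk /= scaler0 add0r.
have dk : derivable (fun h : R => k (h *: w + x)) 0 1.
  by apply: derivable_line; exact: smooth_derivable.
by rewrite deriveZ//= derive_line scale0r add0r.
Qed.

End tensor_kernel.

(** The direction has zero time component, so the whole difference quotient stays in the slice at
    time [z.1]; integrability of that slice suffices for differentiation under the integral. *)
Lemma is_derive_convx (k : 'rV[R]_n -> R) (r : R) (G : S -> R) (z : R * 'rV[R]_n) w :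
  smooth k -> (forall x, k x != 0 -> `|x| <= r) -> integrable_slices G ->
  is_derive z ((0, w) : R * 'rV[R]_n) (convx k G : R * 'rV[R]_n -> R)
    (convx ('D_w k) G z).
Proof.
move=> sk kr sG; have [M _ kM] : exists2 M : R, 0 <= M & forall x, `|k x| <= M.
  exact: (bounded_of_compact (smooth_continuous sk) (@rV_ball_compact R n r) kr).
have [M' _ dkM] : exists2 M : R, 0 <= M & forall x, `|'D_w k x| <= M.
  apply: (bounded_of_compact (smooth_continuous (smooth_derive w sk)) (@rV_ball_compact R n r)).
  move=> x; apply: (derive_eq0_off (f := k) (K := [set x | `|x| <= r])) => //.
  by apply: compact_closed; [exact: norm_hausdorff|exact: rV_ball_compact].
have mk : measurable_fun setT k by exact: continuous_measurable_rV (smooth_continuous sk).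
have AL y h (v x : 'rV[R]_n) : h *: v + x - y = h *: v + (x - y) by rewrite addrA.
have dK (x y : 'rV[R]_n) : derivable (fun x => k (x - y)) x w.
  apply: (@derivable_affine _ _ _ (fun x => x - y) id) => //; exact: smooth_derivable.
have DK (x y : 'rV[R]_n) : 'D_w (fun x => k (x - y)) x = 'D_w k (x - y).
  exact: (@derive_affine _ _ _ (fun x => x - y) id (AL y) k).
have iK (x : 'rV[R]_n) : lam.-integrable setT (EFin \o (fun y => G (z.1, y) * k (x - y))).
  exact: (integrable_convx_kernel mk kM sG (z.1, x)).
have KC (x y : 'rV[R]_n) : `|'D_w (fun x => k (x - y)) x| <= M' by rewrite DK.
pose F (x : 'rV[R]_n) := \int[lam]_y (G (z.1, y) * k (x - y)).
have dF : derivable F z.2 w.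
  exact: (@derivable_integral _ _ _ 'rV[R]_n lam (fun (x y : 'rV[R]_n) => k (x - y)) z.2 w
    (fun y => G (z.1, y)) M' iK (sG z.1) dK KC).
have DF : 'D_w F z.2 = convx ('D_w k) G z.
  rewrite (@derive_integral _ _ _ 'rV[R]_n lam (fun (x y : 'rV[R]_n) => k (x - y)) z.2 w
    (fun y => G (z.1, y)) M' iK (sG z.1) dK KC).
  by apply: eq_Rintegral => y _; rewrite DK.
have lineE : (fun h : R => convx k G (h *: ((0, w) : R * 'rV[R]_n) + z)) =
    (fun h : R => F (h *: w + z.2)).
  by apply/funext => h; rewrite /convx /F /= scaler0 add0r.
apply: DeriveDef.
  apply: derivable_line0; rewrite lineE.
  by apply: derivable_line; rewrite scale0r add0r.
by rewrite derive_line0 lineE derive_line scale0r add0r.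
Qed.

End convolution_derivatives.

(** * The mollified equations and the energy identity *)

Section weak_equations.
Context {R : realType} {n : nat}.
Local Notation S := (mspacetime R n).
Local Notation mu := (lebesgue_st n).

Lemma Rintegral_ae_eq d (T : measurableType d) (m : {measure set T -> \bar R})
    (Q : set T) (g h : T -> R) : measurable Q -> measurable_fun Q g ->
  measurable_fun setT h -> {ae m, forall x, (g \_ Q) x = h x} ->
  \int[m]_(x in Q) g x = \int[m]_x h x.
Proof.
move=> mQ mg mh gh; rewrite Rintegral_mkcond /Rintegral; congr fine.
apply: ae_eq_integral => //.
- by apply/measurable_EFinP; exact/(measurable_restrictT _ mQ).
- exact/measurable_EFinP.
- by move: gh; apply: filterS => x -> _.
Qed.

Variables (Q Q0 : set S).
Hypotheses (mQ : measurable Q) (Q0Q : Q0 `<=` Q).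

(** The kernel vanishes outside [Q0], so an original field [g] on [Q] may be exchanged for any
    globally defined [G] that agrees with it almost everywhere on [Q0]. *)
Lemma integral_kernel_ae (g G : S -> R) (ka : R * 'rV[R]_n -> R) (z : R * 'rV[R]_n) :
  measurable_fun Q g -> measurable_fun setT G -> measurable_fun setT (ka : S -> R) ->
  (forall w, ka (z - w) != 0 -> Q0 w) ->
  {ae mu, forall w, Q0 w -> g w = G w} ->
  \int[mu]_(w in Q) (g w * ka (z - w)) = convst ka G z.
Proof.
move=> mg mG mka kaQ gG.
have mk : measurable_fun setT (fun w : S => ka (z - w)).
  apply: (measurableT_comp mka).
  exact: (measurableT_comp (@measurable_sub_st R n) (pair1_measurable z)).
apply: Rintegral_ae_eq => //.
- by apply: measurable_funM => //; exact: measurable_funTS.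
- exact: measurable_funM.
- move: gG; apply: filterS => w gG; rewrite patchE.
  have [k0|kn] := eqVneq (ka (z - w)) 0; first by rewrite k0 !mulr0; case: ifP.
  by have Qw := kaQ _ kn; rewrite mem_set ?gG//; exact: Q0Q.
Qed.

Variables (rho p : R * 'rV[R]_n -> R) (u f : R * 'rV[R]_n -> 'rV[R]_n).
Hypothesis euler : euler_weak_solution Q rho p u f.
Variables (GR Gp : S -> R) (Gm Gb : 'I_n -> S -> R) (GS : 'I_n -> 'I_n -> S -> R).
Hypotheses (iGR : mu.-integrable setT (EFin \o GR)) (iGp : mu.-integrable setT (EFin \o Gp))
  (iGm : forall i, mu.-integrable setT (EFin \o Gm i))
  (iGb : forall i, mu.-integrable setT (EFin \o Gb i))
  (iGS : forall i j, mu.-integrable setT (EFin \o GS i j)).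
Hypotheses (mrho : measurable_fun Q (rho : S -> R)) (mp : measurable_fun Q (p : S -> R))
  (mu_ : forall i, measurable_fun Q (fun z : S => u z ord0 i))
  (mf : forall i, measurable_fun Q (fun z : S => f z ord0 i)).
Hypotheses (aeR : {ae mu, forall w, Q0 w -> rho w = GR w})
  (aep : {ae mu, forall w, Q0 w -> p w = Gp w})
  (aem : forall i, {ae mu, forall w, Q0 w -> rho w * u w ord0 i = Gm i w})
  (aeb : forall i, {ae mu, forall w, Q0 w -> rho w * f w ord0 i = Gb i w})
  (aeS : forall i j, {ae mu, forall w, Q0 w -> rho w * tensor (u w) (u w) i j = GS i j w}).
Variables (ka : R * 'rV[R]_n -> R) (r : R) (z : R * 'rV[R]_n).
Hypotheses (ska : smooth ka) (kar : forall z, ka z != 0 -> `|z| <= r)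
  (zQ : forall w, `|z - w| <= r -> Q0 w).

Let psi w := ka (z - w).

Let psi_test : test_function Q psi.
Proof. by apply: (test_function_kernel ska kar) => w /zQ /Q0Q. Qed.

Let int_psi g G : measurable_fun Q g -> mu.-integrable setT (EFin \o G) ->
  {ae mu, forall w, Q0 w -> g w = G w} ->
  distr_of Q g psi = convst ka G z.
Proof.
move=> mg iG gG; apply: integral_kernel_ae => //.
- exact: measurable_integrable_real iG.
- exact: measurable_kernel.
- by move=> w /kar; exact: zQ.
Qed.

(** The reflection in [psi] produces the minus sign that later cancels the one in the definition of
    distributional derivatives. *)
Let int_Dpsi g G v : measurable_fun Q g -> mu.-integrable setT (EFin \o G) ->
  {ae mu, forall w, Q0 w -> g w = G w} ->
  distr_of Q g ('D_v psi) = - convst ('D_v ka) G z.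
Proof.
move=> mg iG gG; have mG := measurable_integrable_real iG.
have mD := measurable_derive_kernel ska v.
have [M' _ dkM] := derive_kernel_bounded ska kar v.
transitivity (convst (fun w => - 'D_v ka w) G z).
  rewrite -(integral_kernel_ae mg mG (ka := fun w => - 'D_v ka w) _ _ gG); first last.
  - by move=> w; rewrite oppr_eq0 => /(derive_kernel_supp kar); exact: zQ.
  - exact: measurable_funN.
  by apply: eq_Rintegral => w _; rewrite (derive_reflected_kernel ska).
have iK := integrable_convst_kernel mD dkM iG z.
rewrite /convst -mulN1r -RintegralZl//.
by apply: eq_Rintegral => w _; rewrite mulN1r mulrN.
Qed.

Let et : R * 'rV[R]_n := (1, 0).
Let ex j : R * 'rV[R]_n := (0, basis_vec j).

Lemma mollified_mass :
  convst ('D_et ka) GR z + \sum_j convst ('D_(ex j) ka) (Gm j) z = 0.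
Proof.
have [_ /(_ psi psi_test) h _] := euler; move: h.
rewrite /distr_div !fctE !fct_sumE /distr_dt /distr_dx.
rewrite (int_Dpsi et mrho iGR aeR) opprK => h; apply: etrans h; congr (_ + _).
apply: eq_bigr => j _.
rewrite (@int_Dpsi _ (Gm j) (ex j)) ?opprK//.
by apply: measurable_funM.
Qed.

Lemma mollified_momentum i :
  convst ('D_et ka) (Gm i) z + \sum_j convst ('D_(ex j) ka) (GS i j) z +
  convst ('D_(ex i) ka) Gp z = convst ka (Gb i) z.
Proof.
have [/(_ i psi psi_test) h _ _] := euler; move: h.
rewrite /distr_div !fctE !fct_sumE /distr_dt /distr_dx.
rewrite (@int_Dpsi _ (Gm i) et) ?opprK//; last exact: measurable_funM.
rewrite (@int_Dpsi _ Gp (ex i)) ?opprK//.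
rewrite (@int_psi _ (Gb i))//; last exact: measurable_funM.
move=> h; apply: etrans h; congr (_ + _ + _); apply: eq_bigr => j _.
rewrite (@int_Dpsi _ (GS i j) (ex j)) ?opprK//.
apply: measurable_funM => //.
rewrite (_ : (fun w : S => _) = fun w : S => u w ord0 i * u w ord0 j).
  exact: measurable_funM.
by apply/funext => w; rewrite /tensor !mxE big_ord1 !mxE.
Qed.

End weak_equations.

Section measurable_inverse.
Context {R : realType}.

(** The inverse is the pointwise limit of the continuous functions x / (x^2 + 1/(k+1)), which also
    vanish at 0, in accordance with the convention that the inverse of 0 is 0. *)
Lemma measurable_invr : measurable_fun setT (fun x : R => x^-1).
Proof.
pose g k (x : R) := x * (x ^+ 2 + k.+1%:R^-1)^-1.
have den k (x : R) : 0 < x ^+ 2 + k.+1%:R^-1 by rewrite ltr_wpDl ?sqr_ge0// invr_gt0.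
apply: (measurable_fun_cvg (h := g)) => [k|x _].
  apply: continuous_measurable_fun => x; apply: cvgM; first exact: cvg_id.
  apply: cvgV; first by rewrite gt_eqF// den.
  by apply: cvgD; [apply: cvgM; exact: cvg_id|exact: cvg_cst].
have [->|x0] := eqVneq x 0.
  rewrite invr0 (_ : g ^~ 0 = cst 0); first exact: cvg_cst.
  by apply/funext => k; rewrite /g mul0r.
have -> : x^-1 = x * (x ^+ 2 + 0)^-1.
  by rewrite addr0 expr2 invfM mulrA divff// mul1r.
apply: cvgM; first exact: cvg_cst.
apply: cvgV; first by rewrite addr0 sqrf_eq0.
by apply: cvgD; [exact: cvg_cst|exact: cvg_harmonic].
Qed.

End measurable_inverse.

(** * Calculus of functions differentiable on the support of the test function *)

Section differentiable_on.
Context {R : realType} {n : nat}.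
Local Notation S := (mspacetime R n).
Local Notation mu := (lebesgue_st n).
Variables (K : set (R * 'rV[R]_n)) (v : R * 'rV[R]_n).
Implicit Types f df : R * 'rV[R]_n -> R.

Definition bounded_on f := exists M : R, forall z, K z -> `|f z| <= M.

(** A class closed under sums, products and inverses, so that derivatives of the energy quantities
    are assembled from those of the mollified fields. Derivatives and bounds are asked on [K] only,
    where the density is bounded below; measurability is global because the integrals are. *)
Definition derivable_on f df :=
  [/\ measurable_fun setT (f : S -> R), measurable_fun setT (df : S -> R),
      bounded_on f, bounded_on df & forall z, K z -> is_derive z v f (df z)].

Lemma bounded_onD f g : bounded_on f -> bounded_on g -> bounded_on (fun z => f z + g z).
Proof.
move=> [M fM] [M' gM]; exists (M + M') => z Kz.
by rewrite (le_trans (ler_normD _ _))// lerD ?fM ?gM.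
Qed.

Lemma bounded_onM f g : bounded_on f -> bounded_on g -> bounded_on (fun z => f z * g z).
Proof.
move=> [M fM] [M' gM]; exists (M * M') => z Kz.
by rewrite normrM ler_pM ?fM ?gM.
Qed.

Lemma derivable_onD f df g dg : derivable_on f df -> derivable_on g dg ->
  derivable_on (fun z => f z + g z) (fun z => df z + dg z).
Proof.
move=> [mf mdf bf bdf hf] [mg mdg bg bdg hg]; split.
- exact: measurable_funD.
- exact: measurable_funD.
- exact: bounded_onD.
- exact: bounded_onD.
- by move=> z Kz; have := is_deriveD (hf z Kz) (hg z Kz).
Qed.

Lemma derivable_onM f df g dg : derivable_on f df -> derivable_on g dg ->
  derivable_on (fun z => f z * g z) (fun z => f z * dg z + g z * df z).
Proof.
move=> [mf mdf bf bdf hf] [mg mdg bg bdg hg]; split.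
- exact: measurable_funM.
- by apply: measurable_funD; exact: measurable_funM.
- exact: bounded_onM.
- by apply: bounded_onD; exact: bounded_onM.
- by move=> z Kz; have := is_deriveM (hf z Kz) (hg z Kz).
Qed.

Lemma derivable_on_cst (c : R) : derivable_on (fun=> c) (fun=> 0).
Proof.
split; [exact: measurable_cst|exact: measurable_cst|..].
- by exists (`|c|).
- by exists (`|0 : R|).
- by move=> z _; exact: is_derive_cst.
Qed.

Lemma derivable_on_sum m (f df : 'I_m -> R * 'rV[R]_n -> R) :
  (forall i, derivable_on (f i) (df i)) ->
  derivable_on (fun z => \sum_i f i z) (fun z => \sum_i df i z).
Proof.
elim: m f df => [|m IH] f df h.
  rewrite (_ : (fun z => _) = fun=> 0); last by apply/funext => z; rewrite big_ord0.
  rewrite (_ : (fun z => _) = fun=> 0); last by apply/funext => z; rewrite big_ord0.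
  exact: derivable_on_cst.
rewrite (_ : (fun z => _) = fun z => f ord0 z + \sum_i f (lift ord0 i) z); last first.
  by apply/funext => z; rewrite big_ord_recl.
rewrite (_ : (fun z => \sum_i df i z) = fun z => df ord0 z + \sum_i df (lift ord0 i) z); last first.
  by apply/funext => z; rewrite big_ord_recl.
by apply: derivable_onD => //; apply: IH.
Qed.

Lemma derivable_onV f df (c : R) : 0 < c -> (forall z, K z -> c <= f z) ->
  derivable_on f df ->
  derivable_on (fun z => (f z)^-1) (fun z => - (f z)^-1 ^+ 2 * df z).
Proof.
move=> c0 fc [mf mdf bf bdf hf].
have mfV : measurable_fun setT (fun z : S => (f z)^-1).
  exact: (measurableT_comp measurable_invr mf).
have bV : bounded_on (fun z => (f z)^-1).
  exists c^-1 => z Kz; have f0 := lt_le_trans c0 (fc z Kz).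
  by rewrite ger0_norm ?invr_ge0 ?(ltW f0)// lef_pV2// ?posrE// fc.
split => //.
- apply: measurable_funM => //; apply: measurable_funN.
  exact: measurable_funM.
- apply: bounded_onM => //.
  have [M hM] := bounded_onM bV bV; exists M => z /hM.
  by rewrite normrN.
- move=> z Kz; have f0 : f z != 0 by rewrite gt_eqF// (lt_le_trans c0)// fc.
  have [dfz Dfz] := hf z Kz; apply: DeriveDef; first exact: derivableV.
  by rewrite deriveV// Dfz -exprVn.
Qed.

Variables (phi : R * 'rV[R]_n -> R) (r : R).
Hypotheses (clK : closed K) (Kr : forall z, K z -> `|z| <= r)
  (sphi : smooth phi) (phiK : forall z, phi z != 0 -> K z).

(** The product phi f is differentiable everywhere: by the product rule on [K], and off [K] because
    phi vanishes near each point of that open set. Its derivative then integrates to zero by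
    [integral_derive0]. *)
Lemma integral_test_derivable_on f df : derivable_on f df ->
  mu.-integrable setT (EFin \o ((fun z => phi z * df z + f z * 'D_v phi z) : S -> R)) /\
  \int[mu]_(z in setT) (phi z * df z + f z * 'D_v phi z) = 0.
Proof.
move=> [mf mdf [Mf bf] [Md bd] hf].
have phiKr z : phi z != 0 -> `|z| <= r by move=> /phiK/Kr.
have [P P0 phiP] := bounded_of_compact (smooth_continuous sphi) (@st_ball_compact R n r) phiKr.
have [P' P'0 DphiP] := derive_kernel_bounded sphi phiKr v.
have DphiK z : 'D_v phi z != 0 -> K z by exact: derive_eq0_off.
have mphi := measurable_kernel sphi.
have mDphi := measurable_derive_kernel sphi v.
pose F z := phi z * f z.
pose DF z := phi z * df z + f z * 'D_v phi z.
have offK z : ~ K z -> \forall y \near z, F y = 0.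
  move=> nKz; have : nbhs z (~` K) by apply: open_nbhs_nbhs; split => //; exact: closed_openC.
  apply: filterS => y nKy; rewrite /F (_ : phi y = 0) ?mul0r//.
  by apply/eqP; apply: contrapT => /negP /phiK.
have off0 z : ~ K z -> DF z = 0.
  move=> nKz; rewrite /DF (_ : phi z = 0) 1?(_ : 'D_v phi z = 0) ?mul0r ?mulr0 ?addr0//.
    by apply/eqP; apply: contrapT => /negP /DphiK.
  by apply/eqP; apply: contrapT => /negP /phiK.
have dF z : is_derive z v F (DF z).
  have [Kz|nKz] := pselect (K z).
    have dphi : is_derive z v phi ('D_v phi z).
      by apply: DeriveDef => //; exact: smooth_derivable.
    exact: (is_deriveM dphi (hf z Kz)).
  rewrite off0//; have d0 := @is_derive_cst _ (R * 'rV[R]_n)%type _ (0 : R) z v.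
  apply: near_eq_is_derive d0.
  by move: (offK z nKz); apply: filterS => y ->.
have DFE : 'D_v F = DF by apply/funext => z; exact: (@derive_val _ _ _ _ _ _ _ (dF z)).
have mF : measurable_fun setT (F : S -> R) by exact: measurable_funM.
have mDF : measurable_fun setT (DF : S -> R).
  by apply: measurable_funD; exact: measurable_funM.
have FK z : F z != 0 -> `|z| <= r.
  by move=> Fz; apply: phiKr; apply: contra_neq Fz => h; rewrite /F h mul0r.
have FM z : `|F z| <= P * `|Mf|.
  have [Kz|nKz] := pselect (K z).
    by rewrite normrM ler_pM// (le_trans (bf z Kz))// ler_norm.
  have -> : F z = 0 by exact: nbhs_singleton (offK z nKz).
  by rewrite normr0 mulr_ge0.
have DFM z : `|'D_v F z| <= P * `|Md| + `|Mf| * P'.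
  rewrite (@derive_val _ _ _ _ _ _ _ (dF z)); have [Kz|nKz] := pselect (K z).
    rewrite (le_trans (ler_normD _ _))// lerD// normrM ler_pM//.
      by rewrite (le_trans (bd z Kz))// ler_norm.
    by rewrite (le_trans (bf z Kz))// ler_norm.
  by rewrite off0// normr0 addr_ge0// mulr_ge0.
have iF : mu.-integrable setT (EFin \o (F : S -> R)).
  exact: (integrable_bounded_support (measurable_ball_st r) (lebesgue_st_ball_lty r) mF FM FK).
have mDF' : measurable_fun setT ('D_v F : S -> R) by rewrite DFE.
have dF' z : derivable F z v by have [] := dF z.
have := integral_derive0 iF mDF' dF' DFM FK.
by rewrite DFE.
Qed.

End differentiable_on.

Section convst_derivable_on.
Context {R : realType} {n : nat}.
Local Notation S := (mspacetime R n).
Local Notation mu := (lebesgue_st n).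

Lemma convst_bounded (ka : R * 'rV[R]_n -> R) (M : R) (G : S -> R) z :
  measurable_fun setT (ka : S -> R) -> (forall w, `|ka w| <= M) ->
  mu.-integrable setT (EFin \o G) ->
  `|convst ka G z| <= M * \int[mu]_w `|G w|.
Proof.
move=> mka kM iG; rewrite -RintegralZl//; last exact: integrable_norm.
apply: le_Rintegral_norm.
- exact: (integrable_convst_kernel mka kM iG).
- by apply: integrableZl_real; exact: integrable_norm.
- by move=> w; rewrite normrM mulrC ler_wpM2r.
Qed.

Lemma derivable_on_convst K v (ka : R * 'rV[R]_n -> R) (r : R) (G : S -> R) :
  smooth ka -> (forall z, ka z != 0 -> `|z| <= r) -> mu.-integrable setT (EFin \o G) ->
  derivable_on K v (convst ka G) (convst ('D_v ka) G).
Proof.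
move=> ska kar iG; have mG := measurable_integrable_real iG.
have [M _ kM] := kernel_bounded ska kar.
have [M' _ dkM] := derive_kernel_bounded ska kar v.
have mk := measurable_kernel ska.
have mDk := measurable_derive_kernel ska v.
split.
- exact: measurable_convst.
- exact: measurable_convst.
- by exists (M * \int[mu]_w `|G w|) => z _; exact: convst_bounded.
- by exists (M' * \int[mu]_w `|G w|) => z _; exact: convst_bounded.
- by move=> z _; exact: (is_derive_convst ska kar).
Qed.

End convst_derivable_on.

(** * The algebra of the energy balance *)

Section energy_forms.
Context {R : realType} {n : nat}.
Implicit Types (r p : R) (m b dr fx : 'I_n -> R) (Sg dm : 'I_n -> 'I_n -> R).

(* With r = density, m = momentum, Sg = momentum flux, b = force density and
   dr j, dm i j the x_j-derivatives of r and m i, these are the quantities of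
   the paper written with the velocity m / r. *)
Definition eform r m : R := (\sum_i m i * (m i * r^-1)) * 2^-1.

(** With U = m / r, this is the flux U Sg - (|U|^2 / 2) m + p U. When Sg i j = r U i U j it reduces
    to U (r |U|^2 / 2 + p), the flux in the defect; before the limit the discrepancy between Sg and
    that product is what [jform] records. *)
Definition wform r m Sg p j : R :=
  \sum_i m i * r^-1 * Sg i j +
  (-1) * (((\sum_i m i * r^-1 * (m i * r^-1)) * 2^-1) * m j) + p * (m j * r^-1).

(** The quotient rule for m i / r, in the shape produced by [derivable_onM] and [derivable_onV]. *)
Definition gform r m dr dm i j : R := m i * (- r^-1 ^+ 2 * dr j) + r^-1 * dm i j.

Definition jform r m Sg p dr dm : R :=
  \sum_i \sum_j (m i * r^-1 * m j - Sg i j) * gform r m dr dm i j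
  - p * \sum_i gform r m dr dm i i.

Definition rform r m Sg p b (f ft : R) fx : R :=
  eform r m * ft + \sum_j fx j * wform r m Sg p j
  + f * \sum_i m i * r^-1 * b i.

(** Contract the momentum equation with U = m / r and subtract |U|^2 / 2 times the mass equation.
    The left-hand side is the time derivative of [eform] plus the divergence of [wform], as expanded
    by the product rules of [derivable_on]. *)
Lemma energy_balance r m Sg p b dr dm dtr dtm (dS : 'I_n -> 'I_n -> R) dp :
  r != 0 -> dtr + \sum_j dm j j = 0 ->
  (forall i, dtm i + \sum_j dS i j + dp i = b i) ->
  (\sum_i (m i * (m i * (- r^-1 ^+ 2 * dtr) + r^-1 * dtm i)
           + m i * r^-1 * dtm i)) * 2^-1 +
  \sum_j (\sum_i (m i * r^-1 * dS i j + Sg i j * gform r m dr dm i j)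
    + (-1) * (((\sum_i m i * r^-1 * (m i * r^-1)) * 2^-1) * dm j j
       + m j * ((\sum_i (m i * r^-1 * gform r m dr dm i j
                        + m i * r^-1 * gform r m dr dm i j)) * 2^-1))
    + (p * gform r m dr dm j j + m j * r^-1 * dp j)) =
  \sum_i m i * r^-1 * b i - jform r m Sg p dr dm.
Proof.
move=> r0 mass mom; pose U i := m i * r^-1; pose D := gform r m dr dm.
pose q := \sum_i U i * U i.
have -> : (\sum_i (m i * (m i * (- r^-1 ^+ 2 * dtr) + r^-1 * dtm i)
           + m i * r^-1 * dtm i)) * 2^-1 = \sum_i U i * dtm i - q * 2^-1 * dtr.
  rewrite /q !mulr_suml -sumrB; apply: eq_bigr => i _; rewrite /U.
  by field.
have -> : dtr = - \sum_j dm j j by apply/eqP; rewrite -addr_eq0 mass.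
rewrite -/D.
under [X in _ + X = _]eq_bigr => j _.
  rewrite (_ : _ + _ = \sum_i (U i * dS i j + Sg i j * D i j - U i * m j * D i j)
    - q * 2^-1 * dm j j + (p * D j j + U j * dp j)); last first.
    rewrite [in RHS]sumrB; congr (_ + _).
    rewrite -addrA; congr (_ + _); rewrite -opprD mulN1r; congr (- _).
    rewrite addrC; congr (_ + _).
    rewrite mulrA mulr_sumr mulr_suml; apply: eq_bigr => i _.
    by rewrite /U; field.
  over.
rewrite !big_split/= sumrN.
rewrite /jform -/D.
have -> : \sum_j \sum_i (U i * dS i j + Sg i j * D i j - U i * m j * D i j) =
  \sum_i \sum_j (U i * dS i j) - \sum_i \sum_j (U i * m j - Sg i j) * D i j.
  rewrite exchange_big -sumrB; apply: eq_bigr => i _; rewrite -sumrB.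
  by apply: eq_bigr => j _; ring.
have -> : \sum_i m i / r * b i = \sum_i U i * dtm i + \sum_i \sum_j U i * dS i j
    + \sum_j U j * dp j.
  rewrite -!big_split/=; apply: eq_bigr => i _; rewrite -mom -mulr_sumr /U.
  by ring.
rewrite -[\sum_j p * D j j]mulr_sumr -[\sum_j q * 2^-1 * dm j j]mulr_sumr.
by ring.
Qed.

End energy_forms.

Section energy_identity.
Context {R : realType} {n : nat}.
Local Notation S := (mspacetime R n).
Local Notation mu := (lebesgue_st n).

Lemma Rintegral_opp0 d (T : measurableType d) (m : {measure set T -> \bar R})
    (f1 f2 g : T -> R) :
  m.-integrable setT (EFin \o f1) -> \int[m]_x f1 x = 0 ->
  m.-integrable setT (EFin \o f2) -> \int[m]_x f2 x = 0 ->
  (forall x, g x = - (f1 x + f2 x)) -> \int[m]_x g x = 0.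
Proof.
move=> i1 e1 i2 e2 gE; transitivity (\int[m]_x (-1 * (f1 x + f2 x))).
  by apply: eq_Rintegral => x _; rewrite gE mulN1r.
rewrite RintegralZl//; last exact: integrableD_real.
by rewrite RintegralD// e1 e2 addr0 mulr0.
Qed.

Let et : R * 'rV[R]_n := (1, 0).
Let ex j : R * 'rV[R]_n := (0, basis_vec j).

Variables (K : set (R * 'rV[R]_n)) (phi : R * 'rV[R]_n -> R) (rad c : R).
Hypotheses (clK : closed K) (Kr : forall z, K z -> `|z| <= rad)
  (sphi : smooth phi) (phiK : forall z, phi z != 0 -> K z) (c0 : 0 < c).
Variables (r p dtr : R * 'rV[R]_n -> R) (m b dtm dr dp : 'I_n -> R * 'rV[R]_n -> R)
  (Sg dm dS : 'I_n -> 'I_n -> R * 'rV[R]_n -> R).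
Hypotheses (rc : forall z, K z -> c <= r z)
  (Dtr : derivable_on K et r dtr) (Dtm : forall i, derivable_on K et (m i) (dtm i))
  (Dr : forall j, derivable_on K (ex j) r (dr j))
  (Dm : forall i j, derivable_on K (ex j) (m i) (dm i j))
  (DS : forall i j, derivable_on K (ex j) (Sg i j) (dS i j))
  (Dp : forall j, derivable_on K (ex j) p (dp j)).
Hypotheses (mass : forall z, K z -> dtr z + \sum_j dm j j z = 0)
  (momentum : forall z, K z -> forall i, dtm i z + \sum_j dS i j z + dp i z = b i z).

Definition jfield z := jform (r z) (m ^~ z) (fun i j => Sg i j z) (p z)
  (dr ^~ z) (fun i j => dm i j z).

Definition rfield z := rform (r z) (m ^~ z) (fun i j => Sg i j z) (p z) (b ^~ z)
  (phi z) ('D_et phi z) (fun j => 'D_(ex j) phi z).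

(** The time part and the space parts are total derivatives against phi and integrate to zero. On
    [K], [energy_balance] identifies minus their sum with the integrand; off [K] phi and its
    derivatives vanish. *)
Lemma energy_identity : \int[mu]_(z in setT) (phi z * jfield z - rfield z) = 0.
Proof.
have Vt := derivable_onV c0 rc Dtr.
have Vx j := derivable_onV c0 rc (Dr j).
(* [De] and [Dw] follow the syntax of [eform] and [wform] term by term, so that their derivatives
   match the left-hand side of [energy_balance]. *)
have De := derivable_onM (derivable_on_sum (fun i =>
  derivable_onM (Dtm i) (derivable_onM (Dtm i) Vt))) (derivable_on_cst K et 2^-1).
have Dw j := derivable_onD (derivable_onD (derivable_on_sum (fun i =>
    derivable_onM (derivable_onM (Dm i j) (Vx j)) (DS i j)))
  (derivable_onM (derivable_on_cst K (ex j) (-1)) (derivable_onM (derivable_onM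
    (derivable_on_sum (fun i => derivable_onM (derivable_onM (Dm i j) (Vx j))
      (derivable_onM (Dm i j) (Vx j)))) (derivable_on_cst K (ex j) 2^-1)) (Dm j j))))
  (derivable_onM (Dp j) (derivable_onM (Dm j j) (Vx j))).
have [ie e0] := integral_test_derivable_on clK Kr sphi phiK De.
have [iw w0] := Rintegral_sum_ord (fun j =>
  (integral_test_derivable_on clK Kr sphi phiK (Dw j)).1).
rewrite big1 in w0; last first.
  by move=> j _; exact: (integral_test_derivable_on clK Kr sphi phiK (Dw j)).2.
apply: (Rintegral_opp0 ie e0 iw w0) => z.
have [Kz|nKz] := pselect (K z); last first.
  have phi0 : phi z = 0 by apply/eqP; apply: contrapT => /negP /phiK.
  have Dphi0 v : 'D_v phi z = 0.
    apply/eqP; apply: contrapT => /negP h; apply: nKz.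
    by apply: derive_eq0_off h.
  have -> : rfield z = 0.
    rewrite /rfield /rform phi0 Dphi0 mulr0 mul0r addr0 add0r big1// => j _.
    by rewrite Dphi0 mul0r.
  rewrite phi0 !mul0r Dphi0 mulr0 !add0r big1 ?subr0 ?oppr0// => j _.
  by rewrite Dphi0 mul0r add0r mulr0.
have r0 : r z != 0 by rewrite gt_eqF// (lt_le_trans c0)// rc.
have := @energy_balance R n (r z) (m ^~ z) (fun i j => Sg i j z) (p z) (b ^~ z) (dr ^~ z)
  (fun i j => dm i j z) (dtr z) (dtm ^~ z) (fun i j => dS i j z) (dp ^~ z) r0 (mass Kz)
  (momentum Kz).
rewrite -/(jfield z) => bal; rewrite [X in _ = - (_ + X)]big_split/= -mulr_sumr.
set E1 := (X in - (phi z * X + _ + _)); set e := (X in - (_ + X * _ + _)).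
set DW := (X in - (_ + (phi z * X + _))).
set W := (X in - (_ + (_ + X))).
have {}bal : E1 + DW = \sum_i m i z * (r z)^-1 * b i z - jfield z.
  rewrite -bal; congr (_ + _); first by rewrite /E1; ring.
  by apply: eq_bigr => j _; rewrite /gform; ring.
have WE : \sum_j 'D_(ex j) phi z *
    wform (r z) (m ^~ z) (fun i j => Sg i j z) (p z) j = W.
  by apply: eq_bigr => j _; rewrite mulrC.
rewrite /rfield /rform WE -/e; move: bal.
set B := (\sum_i m i z * (r z)^-1 * b i z) => bal.
have -> : B = E1 + DW + jfield z by rewrite bal subrK.
have -> : eform (r z) (m ^~ z) = e by [].
by ring.
Qed.

End energy_identity.

(** * Domination and passage to the limit *)

Section form_bounds.
Context {R : realType} {n : nat}.
Variables (r p f ft X Y L : R) (m b dr fx : 'I_n -> R) (Sg dm : 'I_n -> 'I_n -> R).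
Hypotheses (X0 : 0 <= X) (Y0 : 0 <= Y) (L0 : 0 <= L)
  (uX : forall i, `|m i * r^-1| <= X) (mX : forall i, `|m i| <= X)
  (SY : forall i j, `|Sg i j| <= Y) (pY : `|p| <= Y) (bY : forall i, `|b i| <= Y)
  (fL : `|f| <= L) (ftL : `|ft| <= L) (fxL : forall j, `|fx j| <= L).
(** Every term of the forms is cubic in velocity-like quantities or a product of one with a flux,
    pressure or force. The kinetic term is only quadratic, and X^2 <= 1 + X^3 accounts for the
    summand 1. *)
Let T := 1 + X ^+ 3 + X * Y.
Let N : R := n%:R.

Lemma norm_sum_le (c : R) (g : 'I_n -> R) : (forall i, `|g i| <= c) ->
  `|\sum_i g i| <= N * c.
Proof.
move=> gc; rewrite (le_trans (ler_norm_sum _ _ _))//.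
rewrite (le_trans (ler_sum _ (fun i _ => gc i)))//.
by rewrite sumr_const card_ord -mulr_natl.
Qed.

Let X2T : X ^+ 2 <= T.
Proof.
have [X1|X1] := leP X 1.
  have : X ^+ 2 <= 1 by rewrite expr_le1.
  have : 0 <= X ^+ 3 + X * Y by rewrite addr_ge0 ?exprn_ge0 ?mulr_ge0.
  by rewrite /T; lra.
have : X ^+ 2 <= X ^+ 3 by rewrite [leRHS]exprS ler_peMl ?sqr_ge0// ltW.
have : 0 <= X * Y by rewrite mulr_ge0.
by rewrite /T; lra.
Qed.

Let XYT : X ^+ 3 + X * Y <= T.
Proof. by rewrite /T; lra. Qed.

Let T0 : 0 <= T.
Proof. by rewrite (le_trans _ X2T)// sqr_ge0. Qed.

Lemma jform_bound : (forall i j, `|gform r m dr dm i j| <= X) ->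
  `|jform r m Sg p dr dm| <= (N + N) * (N + 1) * T.
Proof.
move=> gX; rewrite /jform (le_trans (ler_normB _ _))//.
have h1 : `|\sum_i \sum_j (m i * r^-1 * m j - Sg i j) * gform r m dr dm i j| <= N * (N * T).
  apply: norm_sum_le => i; apply: norm_sum_le => j.
  rewrite normrM (le_trans _ XYT)//.
  have -> : X ^+ 3 + X * Y = (X * X + Y) * X by ring.
  apply: ler_pM => //; rewrite (le_trans (ler_normB _ _))// lerD//.
  by rewrite normrM ler_pM.
have h2 : `|p * \sum_i gform r m dr dm i i| <= N * T.
  rewrite normrM (le_trans (ler_pM _ _ pY (norm_sum_le (fun i => gX i i))))//.
  rewrite mulrCA ler_wpM2l// (le_trans _ XYT)// [Y * X]mulrC lerDr exprn_ge0//.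
have N0 : 0 <= N by rewrite /N ler0n.
have NT := mulr_ge0 N0 T0; have NNT := mulr_ge0 N0 NT.
apply: (le_trans (lerD h1 h2)).
have -> : (N + N) * (N + 1) * T = N * (N * T) + N * T + (N * (N * T) + N * T) by ring.
by rewrite lerDl addr_ge0.
Qed.

Lemma rform_bound : `|rform r m Sg p b f ft fx| <= L * ((N + N) * (N + 1) * T).
Proof.
have N0 : 0 <= N by rewrite /N ler0n.
have h1 : `|eform r m| <= N * T.
  rewrite /eform normrM [`|2^-1|]ger0_norm ?invr_ge0 ?ler0n//.
  have h : `|\sum_i m i * (m i * r^-1)| <= N * X ^+ 2.
    by apply: norm_sum_le => i; rewrite normrM expr2 ler_pM.
  apply: (@le_trans _ _ (N * X ^+ 2)); last by rewrite ler_wpM2l.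
  by apply: le_trans h; rewrite ler_piMr// invf_le1// ler1n.
have h2 j : `|wform r m Sg p j| <= (N + 1) * T.
  rewrite /wform (le_trans (ler_normD _ _))// mulrDl mul1r lerD//.
    rewrite (le_trans (ler_normD _ _))// mulN1r normrN.
    apply: (@le_trans _ _ (N * (X * Y) + N * X ^+ 3)); last first.
      by rewrite -mulrDr ler_wpM2l// addrC.
    rewrite lerD//.
      by apply: norm_sum_le => i; rewrite normrM ler_pM.
    rewrite !normrM [`|2^-1|]ger0_norm ?invr_ge0 ?ler0n//.
    have h : `|\sum_i m i * r^-1 * (m i * r^-1)| <= N * X ^+ 2.
      by apply: norm_sum_le => i; rewrite normrM expr2 ler_pM.
    have -> : N * X ^+ 3 = (N * X ^+ 2) * X by ring.
    apply: ler_pM; rewrite ?mulr_ge0 ?invr_ge0 ?ler0n//.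
    by apply: le_trans h; rewrite ler_piMr// invf_le1// ler1n.
  rewrite normrM (le_trans (ler_pM _ _ pY (uX j)))// mulrC (le_trans _ XYT)//.
  by rewrite lerDr exprn_ge0.
have h3 : `|\sum_i m i * r^-1 * b i| <= N * T.
  apply: norm_sum_le => i; rewrite normrM (le_trans (ler_pM _ _ (uX i) (bY i)))//.
  by rewrite (le_trans _ XYT)// lerDr exprn_ge0.
rewrite /rform.
have k1 : `|eform r m * ft| <= N * T * L by rewrite normrM ler_pM.
have k2 : `|\sum_j fx j * wform r m Sg p j| <= N * (L * ((N + 1) * T)).
  by apply: norm_sum_le => j; rewrite normrM ler_pM.
have k3 : `|f * \sum_i m i * r^-1 * b i| <= L * (N * T) by rewrite normrM ler_pM.
rewrite (le_trans (ler_normD _ _))// (le_trans (lerD (ler_normD _ _) (lexx _)))//.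
apply: (le_trans (lerD (lerD k1 k2) k3)).
have NTL := mulr_ge0 (mulr_ge0 N0 (mulr_ge0 N0 T0)) L0.
rewrite -subr_ge0; have -> : L * ((N + N) * (N + 1) * T) -
  (N * T * L + N * (L * ((N + 1) * T)) + L * (N * T)) = N * (N * T) * L - N * T * L.
  by ring.
rewrite -mulrBl -mulrBr.
(* The surplus is a nonnegative multiple of N N - N, which is nonnegative because N is a natural
   number. *)
have [n0|n1] := posnP n; first by rewrite (_ : N = 0) ?mul0r// /N n0.
rewrite !mulr_ge0// -{2}[T]mul1r -mulrBl mulr_ge0// subr_ge0 /N.
by rewrite ler1n.
Qed.

End form_bounds.

Section dominated_value.
Context {R : realType} {n : nat}.
Variables (M c A L : R).
Hypotheses (M0 : 0 <= M) (c0 : 0 < c) (A0 : 0 <= A) (L0 : 0 <= L).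

(** [Lam * a] bounds at once the momentum, the velocity and the velocity gradient: the summands come
    from |m|, from |m / r| and from the two terms of the quotient rule. *)
Let Lam := M + M * c^-1 + (M * (M * A) * c^-1 ^+ 2 + M * c^-1).

(** L + L pays for the two terms phi times [jform] and [rform]; the last factor comes from [TE],
    where the two Jensen inequalities turn cubic and mixed products into E. The kernel enters only
    through the mass bound [A], so the constant is uniform in the scale whenever [A] is. *)
Definition dom_const : R := (L + L) * ((n%:R + n%:R) * (n%:R + 1)) *
  (1 + Lam ^+ 3 * A ^+ 2 + Lam * M * (A ^+ 3 + 1)).

Lemma Lam_ge0 : 0 <= Lam.
Proof.
have ci0 : 0 <= c^-1 by rewrite invr_ge0 ltW.
by rewrite /Lam !addr_ge0// ?mulr_ge0// exprn_ge0.
Qed.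

Lemma dom_const_ge0 : 0 <= dom_const.
Proof.
have h := Lam_ge0.
have e1 : 0 <= Lam ^+ 3 * A ^+ 2 by rewrite mulr_ge0 ?exprn_ge0.
have e2 : 0 <= Lam * M * (A ^+ 3 + 1).
  by rewrite !mulr_ge0 ?Lam_ge0// addr_ge0// exprn_ge0.
rewrite /dom_const mulr_ge0//; last by rewrite !addr_ge0.
by rewrite mulr_ge0 ?addr_ge0// mulr_ge0 ?addr_ge0.
Qed.

Variables (a q E r p f ft : R) (m b dr fx : 'I_n -> R) (Sg dm : 'I_n -> 'I_n -> R).
Hypotheses (a0 : 0 <= a) (q0 : 0 <= q) (E0 : 0 <= E) (a3 : a ^+ 3 <= A ^+ 2 * E)
  (aq : a * q <= (A ^+ 3 + 1) * E)
  (rc : c <= r) (ma : forall i, `|m i| <= M * a) (Sq : forall i j, `|Sg i j| <= M * q)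
  (pq : `|p| <= M * q) (bq : forall i, `|b i| <= M * q)
  (fL : `|f| <= L) (ftL : `|ft| <= L) (fxL : forall j, `|fx j| <= L).

Let ci0 : 0 <= c^-1. Proof. by rewrite invr_ge0 ltW. Qed.
Let rV : `|r^-1| <= c^-1.
Proof.
have r0 := lt_le_trans c0 rc.
by rewrite ger0_norm ?invr_ge0 ?(ltW r0)// lef_pV2// posrE.
Qed.

Let X := Lam * a.
Let Y := M * q.

Let X0 : 0 <= X. Proof. by rewrite mulr_ge0// Lam_ge0. Qed.
Let Y0 : 0 <= Y. Proof. by rewrite mulr_ge0. Qed.
Let mX i : `|m i| <= X.
Proof.
rewrite (le_trans (ma i))// ler_wpM2r// /Lam -addrA lerDl.
by rewrite !addr_ge0// ?mulr_ge0// exprn_ge0.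
Qed.
Let uX i : `|m i * r^-1| <= X.
Proof.
rewrite normrM (le_trans (ler_pM _ _ (ma i) rV))//.
have -> : X = M * a * c^-1 + (M + (M * (M * A) * c^-1 ^+ 2 + M * c^-1)) * a.
  by rewrite /X /Lam; ring.
by rewrite lerDl mulr_ge0// !addr_ge0// ?mulr_ge0// exprn_ge0.
Qed.

Let TE : 1 + X ^+ 3 + X * Y <= (1 + Lam ^+ 3 * A ^+ 2 + Lam * M * (A ^+ 3 + 1)) * (1 + E).
Proof.
have h1 : X ^+ 3 <= Lam ^+ 3 * A ^+ 2 * E.
  by rewrite /X exprMn -mulrA ler_wpM2l// exprn_ge0// Lam_ge0.
have h2 : X * Y <= Lam * M * (A ^+ 3 + 1) * E.
  have -> : X * Y = Lam * M * (a * q) by rewrite /X /Y; ring.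
  by rewrite -[leRHS]mulrA ler_wpM2l// mulr_ge0// Lam_ge0.
apply: (le_trans (lerD (lerD (lexx 1) h1) h2)).
have e1 : 0 <= Lam ^+ 3 * A ^+ 2.
  by rewrite mulr_ge0 ?exprn_ge0// Lam_ge0.
have e2 : 0 <= Lam * M * (A ^+ 3 + 1).
  by rewrite !mulr_ge0 ?Lam_ge0// addr_ge0// exprn_ge0.
rewrite -subr_ge0; set l1 := Lam ^+ 3 * A ^+ 2 in e1 *; set l2 := _ * (_ + 1) in e2 *.
have -> : (1 + l1 + l2) * (1 + E) - (1 + l1 * E + l2 * E) = E + l1 + l2 by ring.
by rewrite !addr_ge0.
Qed.

Let N1 : (0 : R) <= (n%:R + n%:R) * (n%:R + 1).
Proof. by rewrite mulr_ge0 ?addr_ge0. Qed.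

Lemma rform_dominated : `|rform r m Sg p b f ft fx| <= dom_const * (1 + E).
Proof.
have hr := rform_bound X0 Y0 L0 uX mX Sq pq bq fL ftL fxL.
set T := 1 + X ^+ 3 + X * Y in hr *.
apply: (@le_trans _ _ ((L + L) * ((n%:R + n%:R) * (n%:R + 1) * T))).
  by rewrite (le_trans hr)// [leRHS]mulrDl lerDl (le_trans _ hr).
by rewrite [leLHS]mulrA /dom_const -[leRHS]mulrA ler_wpM2l// mulr_ge0// addr_ge0.
Qed.

Hypotheses (drA : forall j, `|dr j| <= M * A) (dma : forall i j, `|dm i j| <= M * a).

(** The density is bounded outright, so its derivative costs only M A and no power of the weight.
    The term m dr / r^2 therefore stays linear in [a], which keeps [jform] cubic. *)
Let gX i j : `|gform r m dr dm i j| <= X.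
Proof.
rewrite /gform (le_trans (ler_normD _ _))//.
have h1 : `|m i * (- r^-1 ^+ 2 * dr j)| <= M * a * (c^-1 ^+ 2 * (M * A)).
  rewrite normrM ler_pM// normrM normrN normrX ler_pM ?exprn_ge0//.
  by rewrite lerXn2r// nnegrE.
have h2 : `|r^-1 * dm i j| <= c^-1 * (M * a) by rewrite normrM ler_pM.
apply: (le_trans (lerD h1 h2)).
have -> : X = M * a * (c^-1 ^+ 2 * (M * A)) + c^-1 * (M * a) + (M + M * c^-1) * a.
  by rewrite /X /Lam; ring.
by rewrite lerDl mulr_ge0// addr_ge0// mulr_ge0.
Qed.

Lemma jform_rform_dominated :
  `|f * jform r m Sg p dr dm - rform r m Sg p b f ft fx| <= dom_const * (1 + E).
Proof.
have hj := jform_bound X0 Y0 uX mX Sq pq gX.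
have hr := rform_bound X0 Y0 L0 uX mX Sq pq bq fL ftL fxL.
set T := 1 + X ^+ 3 + X * Y in hj hr *.
rewrite (le_trans (ler_normB _ _))//.
apply: (@le_trans _ _ ((L + L) * ((n%:R + n%:R) * (n%:R + 1) * T))).
  by rewrite [leRHS]mulrDl lerD// normrM ler_pM.
by rewrite [leLHS]mulrA /dom_const -[leRHS]mulrA ler_wpM2l// mulr_ge0// addr_ge0.
Qed.

End dominated_value.

Section forms_measurable.
Context {d} {T : measurableType d} {R : realType} {n : nat}.
Variables (r p f ft : T -> R) (m b dr fx : 'I_n -> T -> R) (Sg dm : 'I_n -> 'I_n -> T -> R).
Hypotheses (mr : measurable_fun setT r) (mp : measurable_fun setT p)
  (mf : measurable_fun setT f) (mft : measurable_fun setT ft)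
  (mm : forall i, measurable_fun setT (m i)) (mb : forall i, measurable_fun setT (b i))
  (mdr : forall i, measurable_fun setT (dr i)) (mfx : forall i, measurable_fun setT (fx i))
  (mS : forall i j, measurable_fun setT (Sg i j)) (mdm : forall i j, measurable_fun setT (dm i j)).

Lemma measurable_fun_sum_real k (h : 'I_k -> T -> R) :
  (forall i, measurable_fun setT (h i)) -> measurable_fun setT (fun x => \sum_i h i x).
Proof. by move=> mh; apply: measurable_sum => i; exact: mh. Qed.

Let mrV : measurable_fun setT (fun z => (r z)^-1).
Proof. exact: (measurableT_comp measurable_invr mr). Qed.

Let mu_ i : measurable_fun setT (fun z => m i z * (r z)^-1).
Proof. exact: measurable_funM. Qed.

Let mg i j : measurable_fun setT
  (fun z => gform (r z) (m ^~ z) (dr ^~ z) (fun i j => dm i j z) i j).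
Proof.
apply: measurable_funD; last exact: measurable_funM.
apply: measurable_funM => //; apply: measurable_funM => //.
by apply: measurable_funN; exact: measurable_funM.
Qed.

Lemma measurable_jform : measurable_fun setT
  (fun z => jform (r z) (m ^~ z) (fun i j => Sg i j z) (p z) (dr ^~ z) (fun i j => dm i j z)).
Proof.
apply: measurable_funB.
  apply: measurable_fun_sum_real => i; apply: measurable_fun_sum_real => j.
  apply: measurable_funM => //; apply: measurable_funB => //.
  exact: measurable_funM.
apply: measurable_funM => //.
by apply: measurable_fun_sum_real => i; exact: mg.
Qed.

Lemma measurable_rform : measurable_fun setT
  (fun z => rform (r z) (m ^~ z) (fun i j => Sg i j z) (p z) (b ^~ z) (f z) (ft z) (fx ^~ z)).
Proof.
have me : measurable_fun setT (fun z => eform (r z) (m ^~ z)).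
  apply: measurable_funM => //; apply: measurable_fun_sum_real => i.
  exact: measurable_funM.
have mw j : measurable_fun setT (fun z => wform (r z) (m ^~ z) (fun i j => Sg i j z) (p z) j).
  apply: measurable_funD; last exact: measurable_funM.
  apply: measurable_funD.
    by apply: measurable_fun_sum_real => i; exact: measurable_funM.
  apply: measurable_funM => //; apply: measurable_funM => //; apply: measurable_funM => //.
  by apply: measurable_fun_sum_real => i; exact: measurable_funM.
apply: measurable_funD.
  apply: measurable_funD; first exact: measurable_funM.
  by apply: measurable_fun_sum_real => j; exact: measurable_funM.
apply: measurable_funM => //.
by apply: measurable_fun_sum_real => i; exact: measurable_funM.
Qed.

End forms_measurable.

Section forms_continuous.
Context {R : realType} {n : nat}.
Variables (r p : nat -> R) (m b dr : 'I_n -> nat -> R) (Sg dm : 'I_n -> 'I_n -> nat -> R).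
Variables (r' p' f ft : R) (m' b' dr' fx : 'I_n -> R) (Sg' dm' : 'I_n -> 'I_n -> R).
Hypotheses (r0 : r' != 0) (cr : r k @[k --> \oo] --> r') (cp : p k @[k --> \oo] --> p')
  (cm : forall i, m i k @[k --> \oo] --> m' i) (cb : forall i, b i k @[k --> \oo] --> b' i)
  (cdr : forall i, dr i k @[k --> \oo] --> dr' i)
  (cS : forall i j, Sg i j k @[k --> \oo] --> Sg' i j)
  (cdm : forall i j, dm i j k @[k --> \oo] --> dm' i j).

Lemma cvg_sum_real k (h : 'I_k -> nat -> R) (h' : 'I_k -> R) :
  (forall i, h i x @[x --> \oo] --> h' i) ->
  \sum_i h i x @[x --> \oo] --> \sum_i h' i.
Proof.
elim: k h h' => [|k IH] h h' ch.
  rewrite big_ord0 (_ : (fun x => _) = cst 0); first exact: cvg_cst.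
  by apply/funext => x; rewrite big_ord0.
rewrite big_ord_recl (_ : (fun x => _) = fun x => h ord0 x + \sum_i h (lift ord0 i) x).
  by apply: cvgD => //; apply: IH => i; exact: ch.
by apply/funext => x; rewrite big_ord_recl.
Qed.

Let crV : (r k)^-1 @[k --> \oo] --> r'^-1. Proof. exact: cvgV. Qed.
Let cu i : m i k * (r k)^-1 @[k --> \oo] --> m' i * r'^-1. Proof. exact: cvgM. Qed.

Let cg i j : gform (r k) (m ^~ k) (dr ^~ k) (fun i j => dm i j k) i j @[k --> \oo]
  --> gform r' m' dr' dm' i j.
Proof.
apply: cvgD; last exact: cvgM.
apply: cvgM => //; apply: cvgM => //; apply: cvgN; exact: cvgM.
Qed.

Lemma jform_cvg : jform (r k) (m ^~ k) (fun i j => Sg i j k) (p k) (dr ^~ k)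
    (fun i j => dm i j k) @[k --> \oo] --> jform r' m' Sg' p' dr' dm'.
Proof.
apply: cvgB.
  apply: cvg_sum_real => i; apply: cvg_sum_real => j.
  by apply: cvgM => //; apply: cvgB => //; exact: cvgM.
by apply: cvgM => //; apply: cvg_sum_real => i; exact: cg.
Qed.

Lemma rform_cvg : rform (r k) (m ^~ k) (fun i j => Sg i j k) (p k) (b ^~ k) f ft fx
    @[k --> \oo] --> rform r' m' Sg' p' b' f ft fx.
Proof.
have ce : eform (r k) (m ^~ k) @[k --> \oo] --> eform r' m'.
  apply: cvgM; last exact: cvg_cst.
  by apply: cvg_sum_real => i; exact: cvgM.
have cw j : wform (r k) (m ^~ k) (fun i j => Sg i j k) (p k) j @[k --> \oo]
    --> wform r' m' Sg' p' j.
  apply: cvgD; last exact: cvgM.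
  apply: cvgD; first by apply: cvg_sum_real => i; exact: cvgM.
  apply: cvgM; first exact: cvg_cst.
  apply: cvgM => //; apply: cvgM; last exact: cvg_cst.
  by apply: cvg_sum_real => i; exact: cvgM.
apply: cvgD.
  apply: cvgD; first by apply: cvgM => //; exact: cvg_cst.
  by apply: cvg_sum_real => j; apply: cvgM => //; exact: cvg_cst.
by apply: cvgM; [exact: cvg_cst|apply: cvg_sum_real => i; exact: cvgM].
Qed.

End forms_continuous.

(** * Fields dominated by a single weight *)

Section sources.
Context {R : realType} {n : nat}.
Local Notation S := (mspacetime R n).
Local Notation mu := (lebesgue_st n).
Local Notation lam := (lebesgue_rV n).

(* The density, pressure, momentum, force and momentum flux, all dominated by
   powers of a single weight y with y ^+ 3 integrable. *)
Record sources (Q0 : set S) (y : S -> R) (M c : R) (GR Gp : S -> R)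
    (Gm Gb : 'I_n -> S -> R) (GS : 'I_n -> 'I_n -> S -> R) : Prop := Sources {
  src_M0 : 0 <= M ;
  src_c0 : 0 < c ;
  src_my : measurable_fun setT y ;
  src_y01 : forall w, y w = 0 \/ 1 <= y w ;
  src_iy : mu.-integrable setT (EFin \o (fun w => y w ^+ 3)) ;
  src_sy : integrable_slices (fun w => y w ^+ 3) ;
  src_mR : measurable_fun setT GR ;
  src_mp : measurable_fun setT Gp ;
  src_mm : forall i, measurable_fun setT (Gm i) ;
  src_mb : forall i, measurable_fun setT (Gb i) ;
  src_mS : forall i j, measurable_fun setT (GS i j) ;
  src_RM : forall w, `|GR w| <= M ;
  src_Ry : forall w, `|GR w| <= M * y w ;
  src_m_le : forall i w, `|Gm i w| <= M * y w ;
  src_p_le : forall w, `|Gp w| <= M * y w ^+ 2 ;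
  src_b_le : forall i w, `|Gb i w| <= M * y w ^+ 2 ;
  src_S_le : forall i j w, `|GS i j w| <= M * y w ^+ 2 ;
  src_Rc : forall w, Q0 w -> c <= GR w }.

Variables (Q0 : set S) (y : S -> R) (M c : R) (GR Gp : S -> R)
  (Gm Gb : 'I_n -> S -> R) (GS : 'I_n -> 'I_n -> S -> R).
Hypothesis src : sources Q0 y M c GR Gp Gm Gb GS.

Lemma src_y_ge0 w : 0 <= y w.
Proof. by case: (src_y01 src w) => [->|/(le_trans ler01)]. Qed.

(** This is the use of the dichotomy y = 0 or 1 <= y. The exponent starts at 1 because 0 ^+ 0 is
    1. *)
Lemma src_y_le3 w k : (1 <= k <= 3)%N -> y w ^+ k <= y w ^+ 3.
Proof.
move=> /andP[k1 k3]; case: (src_y01 src w) => [->|y1].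
  by rewrite !expr0n/= eqn0Ngt k1.
exact: ler_weXn2l.
Qed.

Let measurable_pow k : measurable_fun setT (fun w => y w ^+ k).
Proof. exact: measurable_funX (src_my src). Qed.

Lemma src_integrable_pow k : (1 <= k <= 3)%N ->
  mu.-integrable setT (EFin \o (fun w => y w ^+ k)).
Proof.
move=> k13; apply: (integrable_real_le _ _ (src_iy src)) => // w.
by rewrite ger0_norm ?exprn_ge0 ?src_y_ge0// src_y_le3.
Qed.

Lemma src_slices_pow k : (1 <= k <= 3)%N -> integrable_slices (fun w => y w ^+ k).
Proof.
move=> k13 t; apply: (integrable_real_le _ _ (src_sy src t)) => [|x].
  exact: (measurable_slice t (measurable_pow k)).
by rewrite ger0_norm ?exprn_ge0 ?src_y_ge0// src_y_le3.
Qed.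

Lemma src_integrable (G : S -> R) k : (1 <= k <= 3)%N -> measurable_fun setT G ->
  (forall w, `|G w| <= M * y w ^+ k) ->
  mu.-integrable setT (EFin \o G) /\ integrable_slices G.
Proof.
move=> k13 mG Gy; split.
  apply: (integrable_real_le mG Gy); apply: integrableZl_real.
  exact: src_integrable_pow.
move=> t; apply: (integrable_real_le _ (fun x => Gy (t, x))).
  exact: (measurable_slice t mG).
by apply: integrableZl_real; exact: (src_slices_pow k13).
Qed.

(* The fields entering the energy forms: density and pressure; momentum, force
   and density derivative (by the second index); flux and momentum derivative.
   The derivatives are convolutions of the density and of the momentum with a
   differentiated kernel. *)
Definition src_index : finType := ((bool + 'I_n * 'I_3) + ('I_n * 'I_n * bool))%type.

Variable k : 'rV[R]_n -> R.

(** One finite family allows a common threshold of scales and a common null set to be chosen for all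
    fields at once. *)
Definition src_field (i : src_index) : S -> R :=
  match i with
  | inl (inl b) => if b then GR else Gp
  | inl (inr (i, o)) => if o == 0 then Gm i else if o == 1 then Gb i else GR
  | inr (i, j, b) => if b then GS i j else Gm i
  end.

Definition src_kernel (i : src_index) : 'rV[R]_n -> R :=
  match i with
  | inl (inl b) => k
  | inl (inr (i, o)) => if o == 0 then k else if o == 1 then k else 'D_(basis_vec i) k
  | inr (i, j, b) => if b then k else 'D_(basis_vec j) k
  end.

Lemma src_field_measurable i : measurable_fun setT (src_field i).
Proof.
case: i => [[[|]|[i o]]|[[i j] [|]]] /=.
- exact: src_mR src.
- exact: src_mp src.
- by case: ifP => _; [exact: src_mm src i|case: ifP => _;
    [exact: src_mb src i|exact: src_mR src]].
- exact: src_mS src i j.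
- exact: src_mm src i.
Qed.

Lemma src_field_integrable i : mu.-integrable setT (EFin \o src_field i) /\
  integrable_slices (src_field i).
Proof.
have h1 (G : S -> R) : measurable_fun setT G -> (forall w, `|G w| <= M * y w) ->
    mu.-integrable setT (EFin \o G) /\ integrable_slices G.
  by move=> mG Gy; apply: (@src_integrable G 1) => // w; rewrite expr1.
have iR := h1 _ (src_mR src) (src_Ry src).
have im i' := h1 _ (src_mm src i') (src_m_le src i').
case: i => [[[|]|[i o]]|[[i j] [|]]] /=.
- exact: iR.
- exact: (@src_integrable _ 2 _ (src_mp src) (src_p_le src)).
- case: ifP => _; [exact: im|case: ifP => _; [|exact: iR]].
  exact: (@src_integrable _ 2 _ (src_mb src i) (src_b_le src i)).
- exact: (@src_integrable _ 2 _ (src_mS src i j) (src_S_le src i j)).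
- exact: im.
Qed.

End sources.
Arguments src_index n : clear implicits.

Section field_forms.
Context {R : realType} {n : nat}.

Definition iR : src_index n := inl (inl true).
Definition ip : src_index n := inl (inl false).
Definition im (i : 'I_n) : src_index n := inl (inr (i, 0)).
Definition ib (i : 'I_n) : src_index n := inl (inr (i, 1)).
Definition idR (i : 'I_n) : src_index n := inl (inr (i, 2%:R)).
Definition iS (i j : 'I_n) : src_index n := inr (i, j, true).
Definition idm (i j : 'I_n) : src_index n := inr (i, j, false).

Definition jval (X : src_index n -> R) : R :=
  jform (X iR) (fun i => X (im i)) (fun i j => X (iS i j)) (X ip) (fun j => X (idR j))
    (fun i j => X (idm i j)).

Definition rval (X : src_index n -> R) (f ft : R) (fx : 'I_n -> R) : R :=
  rform (X iR) (fun i => X (im i)) (fun i j => X (iS i j)) (X ip) (fun i => X (ib i)) f ft fx.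

End field_forms.

Section average_dominated.
Context {R : realType} {n : nat}.
Local Notation S := (mspacetime R n).
Variables (Q0 : set S) (y : S -> R) (M c : R) (GR Gp : S -> R)
  (Gm Gb : 'I_n -> S -> R) (GS : 'I_n -> 'I_n -> S -> R).
Hypothesis src : sources Q0 y M c GR Gp Gm Gb GS.
Context {d} {W : measurableType d} (nu : {measure set W -> \bar R}).
Variables (e : W -> S) (be : W -> R) (A : R) (kap : src_index n -> W -> R).
Hypotheses (A0 : 0 < A) (ibe : nu.-integrable setT (EFin \o be))
  (ib1 : nu.-integrable setT (EFin \o (fun w => y (e w) * be w)))
  (ib2 : nu.-integrable setT (EFin \o (fun w => y (e w) ^+ 2 * be w)))
  (ib3 : nu.-integrable setT (EFin \o (fun w => y (e w) ^+ 3 * be w)))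
  (beA : \int[nu]_w be w <= A)
  (kapb : forall i w, `|kap i w| <= be w)
  (iX : forall i, nu.-integrable setT
    (EFin \o (fun w => src_field GR Gp Gm Gb GS i (e w) * kap i w))).

Let X i := \int[nu]_w (src_field GR Gp Gm Gb GS i (e w) * kap i w).
Let a := \int[nu]_w (y (e w) * be w).
Let q := \int[nu]_w (y (e w) ^+ 2 * be w).
Let E := \int[nu]_w (y (e w) ^+ 3 * be w).

Let y0 w := src_y_ge0 src w.
Let be0 w : 0 <= be w := le_trans (normr_ge0 _) (kapb iR w).

Let X_le i (h : W -> R) : nu.-integrable setT (EFin \o (fun w => h w * be w)) ->
  (forall w, `|src_field GR Gp Gm Gb GS i (e w)| <= M * h w) ->
  `|X i| <= M * \int[nu]_w (h w * be w).
Proof.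
move=> ih hG; rewrite -RintegralZl//; apply: le_Rintegral_norm => //.
  exact: integrableZl_real.
by move=> w; rewrite normrM mulrA ler_pM.
Qed.

Let ma i : `|X (im i)| <= M * a.
Proof. by apply: X_le => // w; exact: src_m_le src i _. Qed.

Let dma i j : `|X (idm i j)| <= M * a.
Proof. by apply: X_le => // w; exact: src_m_le src i _. Qed.

Let pq : `|X ip| <= M * q.
Proof. by apply: X_le => // w; exact: src_p_le src _. Qed.

Let bq i : `|X (ib i)| <= M * q.
Proof. by apply: X_le => // w; exact: src_b_le src i _. Qed.

Let Sq i j : `|X (iS i j)| <= M * q.
Proof. by apply: X_le => // w; exact: src_S_le src i j _. Qed.

Let drA j : `|X (idR j)| <= M * A.
Proof.
apply: (@le_trans _ _ (M * \int[nu]_w (1 * be w))).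
  apply: X_le => [|w]; last by rewrite mulr1; exact: src_RM src _.
  by apply: eq_integrable ibe => // w _; rewrite /= mul1r.
apply: ler_wpM2l; first exact: src_M0 src.
by under eq_Rintegral do rewrite mul1r.
Qed.

Let a0 : 0 <= a. Proof. by apply: Rintegral_ge0 => w _; rewrite mulr_ge0. Qed.
Let q0 : 0 <= q. Proof. by apply: Rintegral_ge0 => w _; rewrite mulr_ge0 ?exprn_ge0. Qed.
Let E0 : 0 <= E. Proof. by apply: Rintegral_ge0 => w _; rewrite mulr_ge0 ?exprn_ge0. Qed.

Let a3 : a ^+ 3 <= A ^+ 2 * E.
Proof. exact: (jensen_cube A0 be0 (fun w => y0 (e w))). Qed.

Let aq : a * q <= (A ^+ 3 + 1) * E.
Proof. exact: (jensen_mul A0 be0 (fun w => y0 (e w))). Qed.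

Variables (L f ft : R) (fx : 'I_n -> R).
Hypotheses (L0 : 0 <= L) (fL : `|f| <= L) (ftL : `|ft| <= L) (fxL : forall j, `|fx j| <= L)
  (rc : c <= X iR).

(** The abstract average covers both mollifications: [e] is the identity of space-time for the
    product kernel, and x -> (t, x) for the space kernel. One weight [be] dominates all kernels, so
    a, q and E are averages against the same weight and Jensen's inequality links them. *)
Lemma average_rform_dominated : `|rval X f ft fx| <= dom_const (n := n) M c A L * (1 + E).
Proof.
exact: (rform_dominated (src_M0 src) (src_c0 src) (ltW A0) L0 a0 q0 E0 a3 aq rc ma Sq pq bq
  fL ftL fxL).
Qed.

Lemma average_jform_dominated :
  `|f * jval X - rval X f ft fx| <= dom_const (n := n) M c A L * (1 + E).
Proof.
exact: (jform_rform_dominated (src_M0 src) (src_c0 src) (ltW A0) L0 a0 q0 E0 a3 aq rc ma Sq pq bq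
  fL ftL fxL drA dma).
Qed.

End average_dominated.

Section kernel_bounds.
Context {R : realType} {n : nat}.
Local Notation S := (mspacetime R n).
Local Notation mu := (lebesgue_st n).
Local Notation lam := (lebesgue_rV n).
Local Notation leb := (@lebesgue_measure R).
Variables (k : 'rV[R]_n -> R) (l : R).
Hypotheses (sk : smooth k) (kl : forall x, k x != 0 -> `|x| <= l).

Lemma src_kernel_smooth i : smooth (src_kernel k i).
Proof.
by case: i => [[b|[i o]]|[[i j] [|]]] //=; [case: ifP => _ //; case: ifP => _ //|];
  exact: smooth_derive.
Qed.

Lemma src_kernel_supp i x : src_kernel k i x != 0 -> `|x| <= l.
Proof.
have clB : closed [set x : 'rV[R]_n | `|x| <= l].
  by apply: compact_closed; [exact: norm_hausdorff|exact: rV_ball_compact].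
have hD v : 'D_v k x != 0 -> `|x| <= l.
  exact: (@derive_eq0_off _ _ k _ v x clB kl).
case: i => [[b|[i o]]|[[i j] [|]]] /=; [exact: kl| |exact: kl|exact: hD].
case: ifP => _; first exact: kl.
by case: ifP => _; [exact: kl|exact: hD].
Qed.

Lemma src_kernel_measurable i : measurable_fun setT (src_kernel k i).
Proof. exact: continuous_measurable_rV (smooth_continuous (src_kernel_smooth i)). Qed.

Lemma src_kernel_bounded : exists2 Mk : R, 0 <= Mk & forall i x, `|src_kernel k i x| <= Mk.
Proof.
have /choice[Mi Mi_le] i : exists Mi : R, forall x, `|src_kernel k i x| <= Mi.
  have [Mi _ h] := bounded_of_compact (smooth_continuous (src_kernel_smooth i))
    (@rV_ball_compact R n l) (@src_kernel_supp i).
  by exists Mi.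
have Mi0 i : 0 <= Mi i by exact: le_trans (normr_ge0 _) (Mi_le i 0).
exists (\sum_i Mi i); first by apply: sumr_ge0 => i _.
move=> i x; rewrite (le_trans (Mi_le i x))// (bigD1 i)//= lerDl.
by apply: sumr_ge0 => j _.
Qed.

Lemma src_kernel_integrable i : lam.-integrable setT (EFin \o src_kernel k i).
Proof.
have [Mk _ kM] := src_kernel_bounded.
exact: (integrable_bounded_support (measurable_ball_rV l) (lebesgue_rV_ball_lty l)
  (src_kernel_measurable i) (kM i) (@src_kernel_supp i)).
Qed.

(** A nonnegative majorant shared by the kernel and its signed derivatives, so that one Jensen
    weight serves every field. Its mass need not be 1, which is why the estimates carry the
    parameter [A]. *)
Definition box_kernel (Mk : R) (x : 'rV[R]_n) : R := Mk * \1_[set x : 'rV[R]_n | `|x| <= l] x.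

Lemma src_kernel_le_box Mk : (forall i x, `|src_kernel k i x| <= Mk) ->
  forall i x, `|src_kernel k i x| <= box_kernel Mk x.
Proof.
move=> kM i x; rewrite /box_kernel; have [->|kx] := eqVneq (src_kernel k i x) 0.
  by rewrite normr0 mulr_ge0// (le_trans _ (kM i x)).
by rewrite indicE mem_set ?mulr1//=; exact: src_kernel_supp kx.
Qed.

End kernel_bounds.

Section box_kernel_facts.
Context {R : realType} {n : nat}.
Local Notation S := (mspacetime R n).
Local Notation mu := (lebesgue_st n).
Local Notation lam := (lebesgue_rV n).
Local Notation leb := (@lebesgue_measure R).
Variables (Mk l : R).
Hypothesis Mk0 : 0 <= Mk.
Local Notation Bk := (@box_kernel R n l Mk).

Lemma box_kernel_ge0 x : 0 <= Bk x.
Proof. by rewrite mulr_ge0. Qed.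

Lemma measurable_box_kernel : measurable_fun setT Bk.
Proof.
by apply: measurable_funM => //; apply: measurable_indic; exact: measurable_ball_rV.
Qed.

Lemma box_kernel_bounded x : `|Bk x| <= Mk.
Proof. by rewrite ger0_norm ?box_kernel_ge0// ler_piMr// indicE lern1 leq_b1. Qed.

Lemma integrable_box_kernel : lam.-integrable setT (EFin \o Bk).
Proof.
apply: integrableZl_real; apply: integrable_indic_lty; first exact: measurable_ball_rV.
exact: lebesgue_rV_ball_lty.
Qed.

Variable th : R -> R.
Hypotheses (mth : measurable_fun setT th) (th0 : forall t, 0 <= th t)
  (ith : leb.-integrable setT (EFin \o th)) (th1 : \int[leb]_t th t = 1).

(** The mass of the weight does not depend on the time kernel, so the same [A] works at all time
    scales. *)
Lemma integral_tensk_box z :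
  mu.-integrable setT (EFin \o (fun w : S => tensk th Bk (z - w))) /\
  \int[mu]_(w in setT) tensk th Bk (z - w) = \int[lam]_x Bk x.
Proof.
have mt : measurable_fun setT (tensk th Bk : S -> R).
  apply: measurable_funM; first exact: (measurableT_comp mth measurable_fst).
  exact: (measurableT_comp measurable_box_kernel measurable_snd).
have mtz : measurable_fun setT (fun w : S => tensk th Bk (z - w)).
  apply: (measurableT_comp mt).
  exact: (measurableT_comp (@measurable_sub_st R n) (pair1_measurable (z : S))).
have t0 w : 0 <= tensk th Bk (z - w) by rewrite mulr_ge0// box_kernel_ge0.
have mE : measurable_fun setT (fun w : S => (tensk th Bk (z - w))%:E) by exact/measurable_EFinP.
have E : (\int[mu]_(w in setT) (tensk th Bk (z - w))%:E = (\int[lam]_x Bk x)%:E)%E.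
  rewrite (fubini_st mE); last by move=> w; rewrite lee_fin.
  have mBE : measurable_fun setT (EFin \o Bk) by apply/measurable_EFinP; exact: measurable_box_kernel.
  have BE0 x : (0 <= (EFin \o Bk) x)%E by rewrite lee_fin box_kernel_ge0.
  transitivity (\int[leb]_s ((th (z.1 - s))%:E * (\int[lam]_x Bk x)%:E))%E.
    apply: eq_integral => s _.
    rewrite EFin_Rintegral; last exact: integrable_box_kernel.
    rewrite -(lebesgue_rV_reflect z.2 mBE BE0) -ge0_integralZl//.
    - exact: (measurableT_comp mBE (@measurable_reflect_rV R n z.2)).
    - by rewrite lee_fin.
  have mthz : measurable_fun setT (fun s : measurableTypeR R => (th (z.1 - s))%:E).
    by apply/measurable_EFinP; apply: (measurableT_comp mth); exact: measurable_funB.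
  rewrite ge0_integralZr//; last 2 first.
  - by move=> s _; rewrite lee_fin.
  - by rewrite lee_fin; apply: Rintegral_ge0 => x _; exact: box_kernel_ge0.
  have mthE : measurable_fun setT (EFin \o th) by exact/measurable_EFinP.
  have thE0 x : (0 <= (EFin \o th) x)%E by rewrite lee_fin.
  rewrite (lebesgue_reflect z.1 mthE thE0).
  by rewrite -EFin_Rintegral// th1 mul1e.
split; last by rewrite /Rintegral E.
apply: integrable_real_lty => //.
under eq_integral do rewrite abse_EFin ger0_norm//.
by rewrite E ltry.
Qed.

End box_kernel_facts.

Section lower_bounds.
Context {R : realType} {n : nat}.
Local Notation S := (mspacetime R n).
Local Notation lam := (lebesgue_rV n).
Local Notation leb := (@lebesgue_measure R).

Definition time_kernel (r : R) (th : R -> R) :=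
  [/\ smooth th, forall t, 0 <= th t, leb.-integrable setT (EFin \o th),
      \int[leb]_t th t = 1 & forall t, th t != 0 -> `|t| < r].

Definition space_kernel (l : R) (k : 'rV[R]_n -> R) :=
  [/\ smooth k, forall x, 0 <= k x, lam.-integrable setT (EFin \o k),
      \int[lam]_x k x = 1 & forall x, k x != 0 -> `|x| <= l].

Lemma time_kernel_bounded r th : time_kernel r th ->
  exists2 M : R, 0 <= M & forall t, `|th t| <= M.
Proof.
move=> [sth _ _ _ thr].
apply: (bounded_of_compact (smooth_continuous sth) (@segment_compact R (- r) r)).
by move=> t /thr/ltW; rewrite /= in_itv/= -ler_norml.
Qed.

Lemma time_kernel_measurable r th : time_kernel r th -> measurable_fun setT th.
Proof. by move=> [sth _ _ _ _]; apply: continuous_measurable_fun; exact: smooth_continuous. Qed.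

Lemma space_kernel_bounded l k : space_kernel l k ->
  exists2 M : R, 0 <= M & forall t, `|k t| <= M.
Proof.
move=> [sk _ _ _ kl].
exact: (bounded_of_compact (smooth_continuous sk) (@rV_ball_compact R n l) kl).
Qed.

Lemma space_kernel_measurable l k : space_kernel l k -> measurable_fun setT k.
Proof. by move=> [sk _ _ _ _]; apply: continuous_measurable_rV; exact: smooth_continuous. Qed.

Lemma reflected_space_kernel (l : R) (k : 'rV[R]_n -> R) x :
  space_kernel l k ->
  lam.-integrable setT (EFin \o (fun y => k (x - y))) /\
  \int[lam]_y k (x - y) = 1.
Proof.
move=> hk; have [sk k0 ik k1 kl] := hk; have mk := space_kernel_measurable hk.
have mr := @measurable_reflect_rV R n x.
have refl := fun f mf f0 => @lebesgue_rV_reflect R n x f mf f0.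
split; first exact: (integrable_measure_preserving mr refl ik).
rewrite -k1 /Rintegral; congr fine.
by rewrite (integral_measure_preserving mr refl (f := EFin \o k))//; exact/measurable_EFinP.
Qed.

Lemma convx_ge (k : 'rV[R]_n -> R) (l c : R) (G : S -> R) z : space_kernel l k ->
  integrable_slices G -> measurable_fun setT G ->
  (forall y, `|z.2 - y| <= l -> c <= G (z.1, y)) -> c <= convx k G z.
Proof.
move=> hk sG mG Gc; have [sk k0 ik k1 kl] := hk.
have mk := space_kernel_measurable hk; have [M _ kM] := space_kernel_bounded hk.
have [ir e1] := reflected_space_kernel z.2 hk.
have -> : c = \int[lam]_y (c * k (z.2 - y)) by rewrite RintegralZl// e1 mulr1.
apply: le_Rintegral => //.
- exact: integrableZl_real.
- exact: (integrable_convx_kernel mk kM sG z).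
- move=> y _; have [->|ky] := eqVneq (k (z.2 - y)) 0; first by rewrite !mulr0.
  by rewrite ler_wpM2r// Gc// kl.
Qed.

Lemma convt_ge (th : R -> R) (r c : R) (H : S -> R) z : time_kernel r th ->
  leb.-integrable setT (EFin \o (fun s => H (s, z.2))) ->
  (forall s, `|z.1 - s| < r -> c <= H (s, z.2)) -> c <= convt th H z.
Proof.
move=> hth iH Hc; have [sth th0 ith th1 thr] := hth.
have mth := time_kernel_measurable hth; have [M _ thM] := time_kernel_bounded hth.
have mr : measurable_fun setT (fun s : measurableTypeR R => (z.1 - s)%R : measurableTypeR R).
  exact: measurable_funB.
have refl := fun f mf f0 => @lebesgue_reflect R z.1 f mf f0.
have ir := integrable_measure_preserving mr refl ith.
have e1 : \int[leb]_y th (z.1 - y) = 1.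
  rewrite -th1 /Rintegral; congr fine.
  by rewrite (integral_measure_preserving mr refl (f := EFin \o th))//; exact/measurable_EFinP.
have -> : c = \int[leb]_y (c * th (z.1 - y)) by rewrite RintegralZl// e1 mulr1.
apply: le_Rintegral => //.
- exact: integrableZl_real.
- apply: (integrable_mul_bounded iH) => //.
  exact: (measurableT_comp mth mr).
- move=> s _; have [->|ths] := eqVneq (th (z.1 - s)) 0; first by rewrite !mulr0.
  by rewrite ler_wpM2r// Hc// thr.
Qed.

End lower_bounds.

Lemma fin_min_pos {R : realType} (I : finType) (P : I -> R -> Prop) (r0 : R) : 0 < r0 ->
  (forall i, exists2 r : R, 0 < r & forall s, s <= r -> P i s) ->
  exists r, [/\ 0 < r, r <= r0 & forall i, P i r].
Proof.
move=> r00 h; have /choice[r rP] i : exists r : R, 0 < r /\ forall s, s <= r -> P i s.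
  by have [r r1 r2] := h i; exists r.
exists (\big[Num.min/r0]_i r i); split.
- by apply: lt_bigmin => // i _; have [] := rP i.
- exact: bigmin_le_id.
- by move=> i; have [_] := rP i; apply; exact: bigmin_le_cond.
Qed.

(** Were convergence to fail, one could pick for each m a bad scale below [r m]. The thresholds are
    later chosen so that any such sequence of scales has the rates required by
    [dominated_fields]. *)
Lemma cvg_at_right0_seq {R : realType} (F : R -> R) (a : R) (r : nat -> R) :
  (forall m, 0 < r m) ->
  (forall l : nat -> R, (forall m, 0 < l m < r m) -> F (l m) @[m --> \oo] --> a) ->
  F l @[l --> 0^'+] --> a.
Proof.
move=> r0 h; apply/cvgrPdist_lt => e e0; apply: contrapT => nF.
have /choice[l lP] m : exists l : R, 0 < l < r m /\ e <= `|a - F l|.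
  apply: contrapT => nl; apply: nF; near=> l.
  rewrite ltNge; apply/negP => el; apply: nl; exists l; split => //.
  by apply/andP; split; near: l; [exact: nbhs_right_gt|exact: nbhs_right_lt].
have /cvgrPdist_lt/(_ e e0)[N _ /(_ N (leqnn N))] := h l (fun m => (lP m).1).
by rewrite ltNge (lP N).2.
Unshelve. all: by end_near. Qed.

Lemma space_kernel_scaled {R : realType} {n : nat} (eta : 'rV[R]_n -> R) l :
  radial_kernel eta -> 0 < l -> space_kernel l (scaled_kernel eta l).
Proof.
move=> reta l0; split.
- exact: scaled_kernel_smooth.
- exact: scaled_kernel_ge0.
- exact: scaled_kernel_integrable.
- exact: scaled_kernel_int.
- by move=> x /(scaled_kernel_supp l0 reta)/ltW.
Qed.

(** * The limits in the time scale and in the space scale *)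

Section mollified_energy.
Context {R : realType} {n : nat}.
Local Notation S := (mspacetime R n).
Local Notation mu := (lebesgue_st n).
Local Notation lam := (lebesgue_rV n).
Local Notation leb := (@lebesgue_measure R).
Variables (Q0 : set S) (y : S -> R) (M c : R) (GR Gp : S -> R)
  (Gm Gb : 'I_n -> S -> R) (GS : 'I_n -> 'I_n -> S -> R).
Hypothesis src : sources Q0 y M c GR Gp Gm Gb GS.
Let sf := src_field GR Gp Gm Gb GS.
Let et : R * 'rV[R]_n := (1, 0).
Let ex j : R * 'rV[R]_n := (0, basis_vec j).
Variables (del : R) (K : set (R * 'rV[R]_n)) (phi : R * 'rV[R]_n -> R) (rad L : R).
Hypotheses (del0 : 0 < del) (clK : closed K) (Kr : forall z, K z -> `|z| <= rad)
  (sphi : smooth phi) (phiK : forall z, phi z != 0 -> K z)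
  (KQ : forall z, K z -> forall w, `|z - w| <= del -> Q0 w)
  (L0 : 0 <= L) (phiL : forall z, `|phi z| <= L) (phitL : forall z, `|'D_et phi z| <= L)
  (phixL : forall j z, `|'D_(ex j) phi z| <= L).
Hypothesis time_kernels : forall r : R, 0 < r -> exists th, time_kernel r th.
Hypothesis Hmass : forall ka : R * 'rV[R]_n -> R, smooth ka ->
  (forall z, ka z != 0 -> `|z| <= del) -> forall z, K z ->
  convst ('D_et ka) GR z + \sum_j convst ('D_(ex j) ka) (Gm j) z = 0.
Hypothesis Hmomentum : forall ka : R * 'rV[R]_n -> R, smooth ka ->
  (forall z, ka z != 0 -> `|z| <= del) -> forall z, K z -> forall i,
  convst ('D_et ka) (Gm i) z + \sum_j convst ('D_(ex j) ka) (GS i j) z +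
  convst ('D_(ex i) ka) Gp z = convst ka (Gb i) z.
(** The side of the identity in which derivatives fall on phi only; evaluated at the fields
    themselves it integrates to the action of the defect on phi. *)
Definition flux (X : src_index n -> S -> R) (z : S) : R :=
  rval (X ^~ z) (phi z) ('D_et phi z) (fun j => 'D_(ex j) phi z).

Lemma flux_off X z : ~ K z -> flux X z = 0.
Proof.
move=> nKz; have phi0 : phi z = 0 by apply/eqP; apply: contrapT => /negP /phiK.
have Dphi0 v : 'D_v phi z = 0.
  apply/eqP; apply: contrapT => /negP h; apply: nKz.
  by apply: derive_eq0_off h.
rewrite /flux /rval /rform phi0 !Dphi0 !mul0r mulr0 big1 ?addr0// => j _.
by rewrite Dphi0 mul0r.
Qed.

Lemma measurable_flux X : (forall i, measurable_fun setT (X i)) ->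
  measurable_fun setT (flux X).
Proof.
move=> mX; have mphi := measurable_kernel sphi.
have mD v := measurable_derive_kernel sphi v.
by apply: measurable_rform => // i; exact: mD.
Qed.

Lemma flux_cvg (X : src_index n -> nat -> S -> R) (X' : src_index n -> S -> R) z :
  (K z -> c <= X' iR z) -> (forall i, X i m z @[m --> \oo] --> X' i z) ->
  flux (fun i => X i m) z @[m --> \oo] --> flux X' z.
Proof.
move=> Xc cX; have [Kz|nKz] := pselect (K z); last first.
  rewrite flux_off// (_ : (fun m => _) = cst 0); first exact: cvg_cst.
  by apply/funext => m; rewrite flux_off.
have r0 : X' iR z != 0 by rewrite gt_eqF// (lt_le_trans (src_c0 src))// Xc.
exact: rform_cvg.
Qed.

Definition energy_budget (X : src_index n -> S -> R) (z : S) : R :=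
  phi z * jval (X ^~ z) - flux X z.

Lemma energy_budget_off X z : ~ K z -> energy_budget X z = 0.
Proof.
move=> nKz; rewrite /energy_budget flux_off// subr0 (_ : phi z = 0) ?mul0r//.
by apply/eqP; apply: contrapT => /negP /phiK.
Qed.

Lemma measurable_energy_budget X : (forall i, measurable_fun setT (X i)) ->
  measurable_fun setT (energy_budget X).
Proof.
move=> mX; apply: measurable_funB; last exact: measurable_flux.
by apply: measurable_funM; [exact: measurable_kernel|exact: measurable_jform].
Qed.

Lemma energy_budget_cvg (X : src_index n -> nat -> S -> R) (X' : src_index n -> S -> R) z :
  (K z -> c <= X' iR z) -> (forall i, X i m z @[m --> \oo] --> X' i z) ->
  energy_budget (fun i => X i m) z @[m --> \oo] --> energy_budget X' z.
Proof.
move=> Xc cX; have [Kz|nKz] := pselect (K z); last first.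
  rewrite energy_budget_off// (_ : (fun m => _) = cst 0); first exact: cvg_cst.
  by apply/funext => m; rewrite energy_budget_off.
have r0 : X' iR z != 0 by rewrite gt_eqF// (lt_le_trans (src_c0 src))// Xc.
apply: cvgB; last exact: flux_cvg.
by apply: cvgM; [exact: cvg_cst|exact: jform_cvg].
Qed.

Let mG i : measurable_fun setT (sf i). Proof. exact: src_field_measurable src i. Qed.
Let iG i : mu.-integrable setT (EFin \o sf i).
Proof. by have [] := src_field_integrable src i. Qed.
Let sG i : integrable_slices (sf i).
Proof. by have [] := src_field_integrable src i. Qed.
Section fixed_scale.
Variables (k : 'rV[R]_n -> R) (l : R).
Hypotheses (hk : space_kernel l k) (ldel : l <= del).

Let sk : smooth k. Proof. by have [] := hk. Qed.
Let kl x : k x != 0 -> `|x| <= l. Proof. by have [_ _ _ _] := hk; exact. Qed.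

Let H i := convx (src_kernel k i) (sf i).

Let mker i : measurable_fun setT (src_kernel k i).
Proof. exact: src_kernel_measurable. Qed.

Let mH i : measurable_fun setT (H i). Proof. exact: measurable_convx. Qed.

(** Stated for all times within [del] of [z.1], since the subsequent time average of the mollified
    density uses them. *)
Lemma mollified_density_ge z : K z -> forall s, `|z.1 - s| <= del -> c <= H iR (s, z.2).
Proof.
move=> Kz s zs; apply: (convx_ge (z := (s, z.2)) hk (sG iR) (mG iR)).
move=> y' /= ky; apply: (src_Rc src); apply: (KQ Kz).
by rewrite normr_st ge_max/= zs (le_trans ky).
Qed.

(* Mollifying in time as well makes the equations classical; the time scale is
   then sent to zero with the space scale [l] fixed. *)
Lemma fixed_scale_identity : mu.-integrable setT (EFin \o energy_budget H) /\
  \int[mu]_(z in setT) energy_budget H z = 0.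
Proof.
have [Mk Mk0 kerM] := src_kernel_bounded sk kl.
have kerB := src_kernel_le_box kl kerM.
pose Bk := @box_kernel R n l Mk.
have mBk : measurable_fun setT Bk by exact: measurable_box_kernel.
have BkM x : `|Bk x| <= Mk by exact: box_kernel_bounded.
have iBk := @integrable_box_kernel R n Mk l.
have iy3 := src_iy src; have sy3 := src_sy src.
pose HE := convx Bk (fun w => y w ^+ 3).
have iH i : mu.-integrable setT (EFin \o H i).
  exact: (integrable_convx (mker i) (kerM i) (src_kernel_integrable sk kl i) (sG i) (iG i)).
have iHE : mu.-integrable setT (EFin \o HE) by exact: integrable_convx mBk BkM iBk sy3 iy3.
have tH i := integrable_convx_time (mker i) (kerM i) (sG i) (iG i).
have tHE := integrable_convx_time mBk BkM sy3 iy3.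
have mHE := measurable_integrable_real iHE.
(* The index None stands for the mollified weight [HE], whose fast convergence is needed alongside
   that of the fields because it supplies the majorant. *)
have /choice[r rP] m : exists r : R, [/\ 0 < r, r <= del &
    forall o : option (src_index n), let F := if o is Some i then H i else HE in
    forall v : R * 'rV[R]_n, `|v| < r ->
      (L1dist mu (fun z : S => F (z + v)%R) F <= (1 / (2 ^ m.+1)%:R)%:E)%E].
  apply: (fin_min_pos (P := fun (o : option (src_index n)) r =>
    let F := if o is Some i then H i else HE in
    forall v : R * 'rV[R]_n, `|v| < r ->
      (L1dist mu (fun z : S => F (z + v)%R) F <= (1 / (2 ^ m.+1)%:R)%:E)%E)) => // o.
  have em : 0 < 1 / (2 ^ m.+1)%:R :> R by rewrite divr_gt0// ltr0n expn_gt0.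
  have [rr rr0 h] : exists2 r : R, 0 < r & forall v : R * 'rV[R]_n, `|v| < r ->
    let F := if o is Some i then H i else HE in
    (L1dist mu (fun z : S => F (z + v)%R) F <= (1 / (2 ^ m.+1)%:R)%:E)%E.
    by case: o => [i|]; apply: L1_shift_st_delta => //; exact: iH.
  by exists rr => // s srr F v vs; apply: h; exact: lt_le_trans srr.
have /choice[th thP] m : exists th, time_kernel (r m) th.
  by apply: time_kernels; have [] := rP m.
pose X i m := convst (tensk (th m) (src_kernel k i)) (sf i).
pose E m := convst (tensk (th m) Bk) (fun w => y w ^+ 3).
have mth m := time_kernel_measurable (thP m).
have XE i m : X i m = convt (th m) (H i).
  have [Mt _ thM] := time_kernel_bounded (thP m).
  by apply/funext => z; exact: (convst_tensk z (mth m) (mker i) thM (kerM i) (iG i) (sG i)).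
have EE m : E m = convt (th m) HE.
  have [Mt _ thM] := time_kernel_bounded (thP m).
  by apply/funext => z; exact: (convst_tensk z (mth m) mBk thM BkM iy3 sy3).
have L1 m (F : S -> R) : measurable_fun setT F ->
    (forall x, leb.-integrable setT (EFin \o (fun s : measurableTypeR R => F (s, x)))) ->
    (forall v : R * 'rV[R]_n, `|v| < r m ->
      (L1dist mu (fun z : S => F (z + v)%R) F <= (1 / (2 ^ m.+1)%:R)%:E)%E) ->
    (L1dist mu (convt (th m) F) F <= (1 / (2 ^ m.+1)%:R)%:E)%E.
  move=> mF tF hF; have [sth th0 ith th1 thr] := thP m.
  have [Mt _ thM] := time_kernel_bounded (thP m).
  apply: (L1_convt (mth m) th0 ith th1 thr mF _ _ hF) => [z|].
    apply: (integrable_mul_bounded (tF z.2)) => //.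
    by apply: (measurableT_comp (mth m)); exact: measurable_funB.
  by rewrite divr_ge0.
have ska i m : smooth (tensk (th m) (src_kernel k i)).
  by have [sth _ _ _ _] := thP m; apply: tensk_smooth => //; exact: src_kernel_smooth.
have supp_tensk m (g : 'rV[R]_n -> R) : (forall x, g x != 0 -> `|x| <= l) ->
    forall z, tensk (th m) g z != 0 -> `|z| <= del.
  move=> gl z; rewrite mulf_eq0 negb_or => /andP[tz gz].
  have [_ _ _ _ thr] := thP m; have [_ rdel _] := rP m.
  by rewrite normr_st ge_max (le_trans (ltW (thr _ tz)))//= (le_trans (gl _ gz)).
have Xc m z : K z -> c <= X iR m z.
  move=> Kz; rewrite XE; apply: (convt_ge (thP m)); first exact: tH.
  move=> s zs; apply: mollified_density_ge => //; have [_ rdel _] := rP m.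
  by rewrite (le_trans (ltW zs)).
have Hc z : K z -> c <= H iR z.
  move=> Kz; have := mollified_density_ge Kz (s := z.1).
  by rewrite subrr normr0 => /(_ (ltW del0)); case: z Kz.
(* At each time scale the fields are smooth and satisfy the mollified equations exactly, so the
   budget already vanishes before the limit. *)
have budget0 m : \int[mu]_(z in setT) energy_budget (fun i => X i m) z = 0.
  have dD i v : derivable_on K v (X i m) (convst ('D_v (tensk (th m) (src_kernel k i))) (sf i)).
    apply: (@derivable_on_convst R n K v _ del (sf i) (ska i m)) => //.
    exact: (supp_tensk m _ (@src_kernel_supp R n k l kl i)).
  have sth : smooth (th m) by have [] := thP m.
  have kap_x j : 'D_(ex j) (tensk (th m) k) = tensk (th m) ('D_(basis_vec j) k).
    exact: derive_tensk_x.
  have skap : smooth (tensk (th m) k) by exact: tensk_smooth.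
  have kapd z : tensk (th m) k z != 0 -> `|z| <= del by apply: supp_tensk.
  apply: (@energy_identity R n K phi rad c clK Kr sphi phiK (src_c0 src)
    (X iR m) (X ip m) (convst ('D_et (tensk (th m) k)) GR)
    (fun i => X (im i) m) (fun i => X (ib i) m)
    (fun i => convst ('D_et (tensk (th m) k)) (Gm i)) (fun j => X (idR j) m)
    (fun j => convst ('D_(ex j) (tensk (th m) k)) Gp)
    (fun i j => X (iS i j) m) (fun i j => X (idm i j) m)
    (fun i j => convst ('D_(ex j) (tensk (th m) k)) (GS i j))).
  - exact: Xc.
  - exact: dD iR et.
  - by move=> i; exact: dD (im i) et.
  - move=> j; have := dD iR (ex j).
    by rewrite (_ : 'D_(ex j) _ = tensk (th m) ('D_(basis_vec j) k))//.
  - move=> i j; have := dD (im i) (ex j).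
    by rewrite (_ : 'D_(ex j) _ = tensk (th m) ('D_(basis_vec j) k))//.
  - by move=> i j; exact: dD (iS i j) (ex j).
  - by move=> j; exact: dD ip (ex j).
  - move=> z Kz; rewrite -[RHS](Hmass skap kapd Kz); congr (_ + _).
    by apply: eq_bigr => j _; rewrite kap_x.
  - by move=> z Kz i; exact: (Hmomentum skap kapd Kz).
(* The summand 1 makes [A] positive, as the Jensen inequalities require. *)
pose A := \int[lam]_x Bk x + 1.
have A0 : 0 < A.
  by rewrite ltr_wpDl//; apply: Rintegral_ge0 => x _; exact: box_kernel_ge0.
pose Cst := dom_const (n := n) M c A L.
have Cst0 : 0 <= Cst.
  exact: (@dom_const_ge0 R n M c A L (src_M0 src) (src_c0 src) (ltW A0) L0).
have E0 m z : 0 <= E m z.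
  apply: Rintegral_ge0 => w _; rewrite !mulr_ge0 ?exprn_ge0 ?(src_y_ge0 src)//.
  by have [_ th0 _ _ _] := thP m; exact: th0.
have budget_le m z : `|energy_budget (fun i => X i m) z| <=
    Cst * \1_[set z : R * 'rV[R]_n | `|z| <= rad] z + Cst * `|E m z|.
  have [Kz|nKz] := pselect (K z); last first.
    by rewrite energy_budget_off// normr0 addr_ge0// mulr_ge0.
  rewrite indicE mem_set/=; last exact: Kr.
  rewrite -mulrDr (ger0_norm (E0 m z)).
  have [Mt Mt0 thM] := time_kernel_bounded (thP m).
  have [sth th0 ith th1 thr] := thP m.
  have [ibe be1] := @integral_tensk_box R n Mk l Mk0 (th m) (mth m) th0 ith th1 z.
  have mtB : measurable_fun setT (tensk (th m) Bk : S -> R).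
    apply: measurable_funM; first exact: (measurableT_comp (mth m) measurable_fst).
    exact: (measurableT_comp mBk measurable_snd).
  have tBM w : `|tensk (th m) Bk w| <= Mt * Mk by rewrite /tensk normrM ler_pM.
  have iyb j : (1 <= j <= 3)%N -> mu.-integrable setT
      (EFin \o (fun w => y w ^+ j * tensk (th m) Bk (z - w))).
    move=> j13; exact: (integrable_convst_kernel mtB tBM (src_integrable_pow src j13) z).
  (* The weight is the time kernel times the box kernel, since the kernels for the gradient terms
     are differentiated and may change sign. *)
  apply: (average_jform_dominated src (nu := mu) (e := id)
    (be := fun w => tensk (th m) Bk (z - w))
    (kap := fun i w => tensk (th m) (src_kernel k i) (z - w)) A0) => //.
  - by have := iyb 1%N isT.
  - exact: iyb.
  - exact: iyb.
  - by rewrite be1 lerDl.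
  - move=> i w; rewrite /tensk normrM (ger0_norm (th0 _)) ler_wpM2l//.
  - move=> i; have mt : measurable_fun setT (tensk (th m) (src_kernel k i) : S -> R).
      exact: measurable_kernel (ska i m).
    have tM w : `|tensk (th m) (src_kernel k i) w| <= Mt * Mk by rewrite /tensk normrM ler_pM.
    exact: (integrable_convst_kernel mt tM (iG i) z).
  - exact: Xc.
have mX i m : measurable_fun setT (X i m).
  by rewrite XE; exact: measurable_convt.
have [ibudget cbudget] := @dominated_fields _ S R mu (src_index n) X H E HE
  (fun z => Cst * \1_[set z : R * 'rV[R]_n | `|z| <= rad] z) Cst
  (fun m => energy_budget (fun i => X i m)) (energy_budget H) mX mH
  (fun m => eq_ind_r (fun g => measurable_fun setT g) (measurable_convt (mth m) mHE) (EE m))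
  (fun i m => eq_ind_r (fun g => (L1dist mu g (H i) <= _)%E)
     (L1 m (H i) (mH i) (tH i) (let: And3 _ _ h := rP m in h (Some i))) (XE i m))
  (fun m => eq_ind_r (fun g => (L1dist mu g HE <= _)%E)
     (L1 m HE mHE tHE (let: And3 _ _ h := rP m in h None)) (EE m))
  iHE
  (integrableZl_real Cst (integrable_indic_lty (measurable_ball_st rad) (lebesgue_st_ball_lty rad)))
  (fun m => measurable_energy_budget (fun i => mX i m)) (measurable_energy_budget mH) budget_le Cst0
  (fun z hz => energy_budget_cvg (Hc z) hz).
split; first exact: ibudget.
move: cbudget; rewrite (_ : (fun m => _) = cst 0); last by apply/funext => m; rewrite budget0.
by move=> h; apply/esym; apply: (cvg_unique _ (cvg_cst 0) h).
Qed.

End fixed_scale.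

Variable ks : R -> 'rV[R]_n -> R.
Hypothesis hks : forall l, 0 < l -> space_kernel l (ks l).

Let Cst := dom_const (n := n) M c 1 L.
Let E l := convx (ks l) (fun w => y w ^+ 3).
Let B z := Cst * \1_[set z : R * 'rV[R]_n | `|z| <= rad] z.
Let iB : mu.-integrable setT (EFin \o B).
Proof.
exact: (integrableZl_real Cst (integrable_indic_lty (measurable_ball_st rad)
  (lebesgue_st_ball_lty rad))).
Qed.

Let Cst0 : 0 <= Cst.
Proof. exact: (@dom_const_ge0 R n M c 1 L (src_M0 src) (src_c0 src) ler01 L0). Qed.

(** [flux] involves no differentiated kernel, so the kernel itself, nonnegative of mass 1, is the
    Jensen weight. Then A = 1 and [Cst] does not depend on l; for [energy_budget] the constant
    depends on bounds for the differentiated kernel. *)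
Let flux_le l z : 0 < l -> l <= del ->
  `|flux (fun i => convx (ks l) (sf i)) z| <= B z + Cst * `|E l z|.
Proof.
move=> l0 ldel; have hk := hks l0; have [sk k0 ik k1 kl] := hk.
have mk := space_kernel_measurable hk; have [Mk Mk0 kM] := space_kernel_bounded hk.
have [Kz|nKz] := pselect (K z); last first.
  by rewrite flux_off// normr0 addr_ge0// mulr_ge0.
rewrite /B indicE mem_set/=; last exact: Kr.
have E0 : 0 <= E l z.
  by apply: Rintegral_ge0 => w _; rewrite mulr_ge0// exprn_ge0// (src_y_ge0 src).
rewrite -mulrDr (ger0_norm E0).
have [ibe be1] := reflected_space_kernel z.2 hk.
have iyb j : (1 <= j <= 3)%N -> lam.-integrable setT
    (EFin \o (fun x => y (z.1, x) ^+ j * ks l (z.2 - x))).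
  by move=> j13; exact: (integrable_convx_kernel mk kM (src_slices_pow src j13) z).
apply: (average_rform_dominated src (nu := lam) (e := fun x => (z.1, x) : S)
  (be := fun x => ks l (z.2 - x)) (kap := fun i x => ks l (z.2 - x)) ltr01) => //.
- by have := iyb 1%N isT.
- exact: iyb.
- exact: iyb.
- by rewrite be1.
- by move=> i w; rewrite ger0_norm.
- by move=> i; exact: (integrable_convx_kernel mk kM (sG i) z).
- have := mollified_density_ge hk ldel Kz (s := z.1).
  by rewrite subrr normr0 => /(_ (ltW del0)); case: (z).
Qed.

Let mX i l : 0 < l -> measurable_fun setT (convx (ks l) (sf i)).
Proof. by move=> l0; apply: measurable_convx => //; exact: space_kernel_measurable (hks l0). Qed.

Lemma scale_identity l : 0 < l -> l <= del ->
  let H i := convx (src_kernel (ks l) i) (sf i) in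
  \int[mu]_(z in setT) (phi z * jval (H ^~ z)) =
  \int[mu]_(z in setT) flux (fun i => convx (ks l) (sf i)) z.
Proof.
move=> l0 ldel H; have hk := hks l0; have [sk k0 ik k1 kl] := hk.
have mk := space_kernel_measurable hk; have [Mk Mk0 kM] := space_kernel_bounded hk.
have [iP P0] := fixed_scale_identity hk ldel.
have iF : mu.-integrable setT (EFin \o flux (fun i => convx (ks l) (sf i))).
  apply: (integrable_real_le _ (fun z => flux_le z l0 ldel)).
    by apply: measurable_flux => i; exact: mX.
  apply: integrableD_real; first exact: iB.
  apply: integrableZl_real; apply: integrable_norm.
  exact: (integrable_convx mk kM ik (src_sy src) (src_iy src)).
have -> : \int[mu]_(z in setT) (phi z * jval (H ^~ z)) =
    \int[mu]_(z in setT) (energy_budget H z + flux (fun i => convx (ks l) (sf i)) z).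
  (* [flux] reads only indices whose kernel is undifferentiated, so the two [flux] terms are
     convertible. *)
  by apply: eq_Rintegral => z _; rewrite /energy_budget subrK.
by rewrite RintegralD// P0 add0r.
Qed.

Lemma flux_limit :
  \int[mu]_(z in setT) flux (fun i => convx (ks l) (sf i)) z @[l --> 0^'+] -->
  \int[mu]_(z in setT) flux sf z.
Proof.
have iy3 := src_iy src; have sy3 := src_sy src.
have my3 := measurable_integrable_real iy3.
pose F (o : option (src_index n)) := if o is Some i then sf i else (fun w => y w ^+ 3).
have iF o : mu.-integrable setT (EFin \o F o) by case: o.
have sF o : integrable_slices (F o) by case: o.
have /choice[r rP] m : exists r : R, [/\ 0 < r, r <= del & forall o,
    forall v : R * 'rV[R]_n, `|v| < r ->
      (L1dist mu (fun z : S => F o (z + v)%R) (F o) <= (1 / (2 ^ m.+1)%:R)%:E)%E].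
  apply: (fin_min_pos (P := fun o r => forall v : R * 'rV[R]_n, `|v| < r ->
      (L1dist mu (fun z : S => F o (z + v)%R) (F o) <= (1 / (2 ^ m.+1)%:R)%:E)%E)) => // o.
  have em : 0 < 1 / (2 ^ m.+1)%:R :> R by rewrite divr_gt0// ltr0n expn_gt0.
  have [rr rr0 h] := L1_shift_st_delta (iF o) em.
  by exists rr => // s srr v vs; apply: h; exact: lt_le_trans srr.
apply: (cvg_at_right0_seq (r := r)) => [m|l lr]; first by have [] := rP m.
have l0 m : 0 < l m by have /andP[] := lr m.
have ldel m : l m <= del.
  by have /andP[_ /ltW h] := lr m; have [_ rdel _] := rP m; exact: le_trans rdel.
have L1 o m : (L1dist mu (convx (ks (l m)) (F o)) (F o) <= (1 / (2 ^ m.+1)%:R)%:E)%E.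
  have hk := hks (l0 m); have [sk k0 ik k1 kl] := hk.
  have mk := space_kernel_measurable hk; have [Mk Mk0 kM] := space_kernel_bounded hk.
  have /andP[_ lrm] := lr m; have [_ _ hr] := rP m.
  apply: (L1_convx mk kM k0 ik k1 _ (iF o) (sF o) _ (hr o)) => [x kx|].
    exact: le_lt_trans (kl x kx) lrm.
  by rewrite divr_ge0.
have mE m : measurable_fun setT (E (l m)).
  by apply: measurable_convx => //; exact: space_kernel_measurable (hks (l0 m)).
have Hc z : K z -> c <= sf iR z.
  by move=> Kz; apply: (src_Rc src); apply: (KQ Kz); rewrite subrr normr0 ltW.
have [] := @dominated_fields _ S R mu (src_index n) (fun i m => convx (ks (l m)) (sf i)) sf
  (fun m => E (l m)) (fun w => y w ^+ 3) B Cst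
  (fun m => flux (fun i => convx (ks (l m)) (sf i))) (flux sf)
  (fun i m => mX i (l0 m)) mG mE (fun i m => L1 (Some i) m) (fun m => L1 None m) iy3 iB
  (fun m => measurable_flux (fun i => mX i (l0 m))) (measurable_flux mG)
  (fun m z => flux_le z (l0 m) (ldel m)) Cst0
  (fun z hz => flux_cvg (Hc z) hz).
by [].
Qed.

Lemma scale_limit :
  \int[mu]_(z in setT) (phi z *
    jval (fun i => convx (src_kernel (ks l) i) (sf i) z)) @[l --> 0^'+] -->
  \int[mu]_(z in setT) flux sf z.
Proof.
apply: cvg_trans flux_limit; apply: near_eq_cvg; near=> l.
apply/esym/scale_identity; near: l; first exact: nbhs_right_gt.
exact: nbhs_right_le.
Unshelve. all: by end_near. Qed.

End mollified_energy.

(** * From weak solutions to dominated fields *)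

Section null_sets.
Import HBNNSimple.
Context d (T : measurableType d) (R : realType) (m : {measure set T -> \bar R}).

(* The library lemma [ae_eq_integral] asks for measurability on both sides. *)
Lemma ge0_integral_negligible_le (f g : T -> \bar R) (N : set T) :
  measurable N -> m N = 0%E -> (forall x, 0 <= f x)%E -> (forall x, 0 <= g x)%E ->
  (forall x, ~ N x -> f x = g x) -> (\int[m]_x f x <= \int[m]_x g x)%E.
Proof.
move=> mN N0 f0 g0 fg; rewrite !ge0_integralTE//.
apply: ge_ereal_sup => _ [h /= hf <-].
(* Each simple function below f is cut to zero on [N]: its integral is unchanged and it now lies
   below g everywhere. *)
pose h' := mul_nnsfun h (indic_nnsfun R (measurableC mN)).
have -> : sintegral m h = sintegral m h'.
  rewrite -!integralT_nnsfun; apply: ae_eq_integral => //.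
  - exact/measurable_EFinP.
  - exact/measurable_EFinP.
  - exists N; split => // x /= hN; apply: contrapT => nN; apply: hN => _.
    by rewrite [RHS](_ : _ = (h x * \1_(~` N) x)%:E)// indicE mem_set//= mulr1.
apply: ereal_sup_ubound; exists h' => //= x.
rewrite [X in X%:E](_ : _ = h x * \1_(~` N) x)// indicE; have [Nx|nN] := pselect (N x).
  by rewrite memNset ?mulr0//= => /(_ Nx).
by rewrite mem_set//= mulr1 -fg.
Qed.

(** Intended for integrands such as [J1], which are identified almost everywhere with a measurable
    function instead of being shown measurable themselves. *)
Lemma eq_Rintegral_ae (f g : T -> R) : {ae m, forall x, f x = g x} ->
  \int[m]_(x in setT) f x = \int[m]_(x in setT) g x.
Proof.
move=> [N [mN N0 fgN]]; have fg x : ~ N x -> f x = g x.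
  by move=> nN; apply: contrapT => h; apply: nN; exact: fgN.
have e (a b : T -> \bar R) : (forall x, 0 <= a x)%E -> (forall x, 0 <= b x)%E ->
    (forall x, ~ N x -> a x = b x) -> (\int[m]_x a x = \int[m]_x b x)%E.
  move=> a0 b0 ab; apply/eqP; rewrite eq_le !(ge0_integral_negligible_le mN N0)//.
  by move=> x /ab.
rewrite /Rintegral; congr fine; rewrite [LHS]integralE [RHS]integralE.
by congr (_ - _)%E; apply: e => x //; rewrite ?funeposE ?funenegE => /fg ->.
Qed.

Lemma eq_Rintegral_restrict_ae (Q : set T) (f g : T -> R) :
  {ae m, forall x, Q x -> f x = g x} -> (forall x, ~ Q x -> g x = 0) ->
  \int[m]_(x in Q) f x = \int[m]_(x in setT) g x.
Proof.
move=> fg g0; rewrite Rintegral_mkcond; apply: eq_Rintegral_ae.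
apply: filterS fg => x fgx; rewrite patchE; case: ifPn => [/set_mem/fgx//|/negP nQ].
by rewrite g0// => Qx; apply: nQ; exact: mem_set.
Qed.

End null_sets.

(** Local radii become a uniform one by compactness. The margin [del] leaves room for the
    mollification scales around the support of the test function. *)
Lemma compact_neighborhood {R : realType} {V : normedModType R} (K Q : set V) :
  compact K -> open Q -> K `<=` Q ->
  exists2 del : R, 0 < del & forall z, K z -> forall w, `|z - w| <= del -> Q w.
Proof.
move=> cK oQ KQ; have /compact_near_coveringP ncK := cK.
have [] := ncK R (0 : R)^'+ (fun e z => forall w, `|z - w| <= e -> Q w) _ _.
  move=> z Kz; have : nbhs z Q by apply: open_nbhs_nbhs; split => //; exact: KQ.
  move=> /nbhs_ballP[e /= e0 eQ]; have e2 : 0 < e / 2 by rewrite divr_gt0.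
  exists (ball z (e / 2), [set r | r < e / 2]) => /=.
    by split; [exact: nbhsx_ballx|exact: nbhs_right_lt].
  move=> [z' r] /= [zz' re] w zw; apply: eQ.
  move: zz'; rewrite -!ball_normE/= => zz'.
  rewrite -(subrK z' z) -addrA (le_lt_trans (ler_normD _ _))//.
  by rewrite (splitr e) ltrD// (le_lt_trans zw).
move=> e e0 h; exists (e / 2); first by rewrite divr_gt0.
move=> z Kz; apply: (h (e / 2)) => //=; last by rewrite divr_gt0.
by rewrite sub0r normrN gtr0_norm ?divr_gt0// ltr_pdivrMr// ltr_pMr// ltr1n.
Unshelve. all: by end_near. Qed.

Section almost_everywhere_logic.
Context d (T : measurableType d) (R : realType) (m : {measure set T -> \bar R}).
Implicit Types P : T -> Prop.

Lemma ae_imp P (P' : T -> Prop) : {ae m, forall x, P x} -> (forall x, P x -> P' x) ->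
  {ae m, forall x, P' x}.
Proof. by move=> h PP'; apply: filterS h. Qed.

Lemma ae_and P (P' : T -> Prop) : {ae m, forall x, P x} -> {ae m, forall x, P' x} ->
  {ae m, forall x, P x /\ P' x}.
Proof. exact: filterI. Qed.

End almost_everywhere_logic.

Section cube_integrable.
Context d (T : measurableType d) (R : realType) (m : {measure set T -> \bar R}).
Implicit Types f g : T -> R.

Definition cube_integrable f := [/\ measurable_fun setT f, forall x, 0 <= f x &
  m.-integrable setT (EFin \o (fun x => f x ^+ 3))].

Lemma cube_integrableD f g : cube_integrable f -> cube_integrable g ->
  cube_integrable (fun x => f x + g x).
Proof.
move=> [mf f0 if3] [mg g0 ig3]; split; first exact: measurable_funD.
  by move=> x; rewrite addr_ge0.
(* The constant is 2^3: the sum is at most twice the larger of the two functions. *)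
have i8 := integrableZl_real 8 (integrableD_real if3 ig3).
apply: (integrable_real_le _ _ i8) => [|x].
  by apply: measurable_funX; exact: measurable_funD.
rewrite ger0_norm ?exprn_ge0 ?addr_ge0//.
wlog fg : f g mf f0 if3 mg g0 ig3 i8 / f x <= g x.
  move=> h; have [/(h f g)->//|/ltW gf] := leP (f x) (g x).
  by rewrite addrC [X in _ <= _ * X]addrC h//; have := integrableZl_real 8 (integrableD_real ig3 if3).
apply: (@le_trans _ _ ((g x + g x) ^+ 3)).
  by rewrite lerXn2r ?nnegrE ?addr_ge0// lerD2r.
have -> : (g x + g x) ^+ 3 = 8 * g x ^+ 3 by ring.
by rewrite ler_pM2l// lerDr exprn_ge0.
Qed.

Lemma cube_integrable_sum n (f : 'I_n -> T -> R) : (forall i, cube_integrable (f i)) ->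
  cube_integrable (fun x => \sum_i f i x).
Proof.
elim: n f => [|n IH] f h.
  split.
  - by rewrite (_ : (fun x => _) = cst 0)//; apply/funext => x; rewrite big_ord0.
  - by move=> x; rewrite big_ord0.
  - rewrite (_ : _ \o _ = cst 0%E); first exact: integrable0.
    by apply/funext => x /=; rewrite big_ord0 expr0n.
rewrite (_ : (fun x => _) = fun x => f ord0 x + \sum_i f (lift ord0 i) x).
  by apply: cube_integrableD => //; apply: IH.
by apply/funext => x; rewrite big_ord_recl.
Qed.

Lemma LpOn_integral (Q : set T) (r : R) g : measurable Q -> 0 < r ->
  LpOn m Q r%:E g -> measurable_fun setT (g \_ Q) /\
  m.-integrable setT (EFin \o (fun x => `|(g \_ Q) x| `^ r)).
Proof.
move=> mQ r0 [mg]; rewrite /finite_norm unlock => gr.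
have mgQ : measurable_fun setT (g \_ Q) by exact: (measurable_restrictT g mQ).1 mg.
split => //; apply: integrable_real_lty.
  by apply: (measurableT_comp (measurable_powR r)); exact: measurableT_comp.
have := lty_poweRy (invr_neq0 (lt0r_neq0 r0)) gr.
rewrite (_ : (\int[m]_x _)%E = (\int[m]_x `|(`|(g \_ Q) x| `^ r)%:E|)%E)//.
apply: eq_integral => x _.
by rewrite [RHS]abse_EFin (ger0_norm (powR_ge0 _ _)) -poweR_EFin.
Qed.

Lemma LpOn3_cube (Q : set T) g : measurable Q -> LpOn m Q 3%:E g ->
  cube_integrable (fun x => `|(g \_ Q) x|).
Proof.
move=> mQ hg; have [mg ig] := @LpOn_integral Q 3 g mQ (ltr0Sn _ 2) hg; split => //.
  exact: measurableT_comp.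
rewrite (_ : (fun x => _) = fun x => `|(g \_ Q) x| `^ 3)//.
by apply/funext => x; rewrite powR_mulrn.
Qed.

(** Pressure and force enter the weight through their square roots, whose cube is the power 3/2. *)
Lemma LpOn32_cube (Q : set T) g : measurable Q -> LpOn m Q (3 / 2)%:E g ->
  cube_integrable (fun x => `|(g \_ Q) x| `^ 2^-1).
Proof.
have r0 : 0 < 3 / 2 :> R by rewrite divr_gt0.
move=> mQ hg; have [mg ig] := @LpOn_integral Q _ g mQ r0 hg; split.
- by apply: (measurableT_comp (measurable_powR _)); exact: measurableT_comp.
- by move=> x; exact: powR_ge0.
- rewrite (_ : (fun x => _) = fun x => `|(g \_ Q) x| `^ (3 / 2))//.
  by apply/funext => x; rewrite mulrC powRrM powR_mulrn// powR_ge0.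
Qed.

Lemma powR12_sqr (a : R) : 0 <= a -> (a `^ 2^-1) ^+ 2 = a.
Proof. by move=> a0; rewrite powR12_sqrt// sqr_sqrtr. Qed.

Lemma LpOnoo_bounded (Q : set T) g : LpOn m Q +oo%E g ->
  exists2 M : R, 0 <= M & {ae m, forall x, Q x -> `|g x| <= M}.
Proof.
move=> [mg]; rewrite /finite_norm unlock; case: ifPn => [mT|].
  rewrite (_ : abse \o _ = EFin \o (fun x => `|(g \_ Q) x|)) => [/ess_supr_bounded[M hM]|//].
  exists `|M| => //; apply: filterS hM => x; rewrite patchE => h Qx.
  by move: h; rewrite mem_set// => /le_trans; apply; exact: ler_norm.
(* The essential norm is defined by cases on the total measure; if that measure is zero, every
   property holds almost everywhere. *)
rewrite -leNgt => mT _; exists 0 => //; exists setT; split => //.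
by apply/eqP; rewrite eq_le mT measure_ge0.
Qed.

End cube_integrable.

Lemma tensorE {R : realType} {n : nat} (x y : 'rV[R]_n) i j :
  tensor x y i j = x ord0 i * y ord0 j.
Proof. by rewrite /tensor mxE big_ord1 mxE. Qed.

(** A null set of times times the whole space is null, because 0 times an infinite measure is 0. *)
Lemma negligible_fst {R : realType} {n : nat} (N : set (measurableTypeR R)) :
  {ae lebesgue_measure, forall t, ~ N t} ->
  {ae lebesgue_st n, forall w : mspacetime R n, ~ N w.1}.
Proof.
move=> [A [mA A0 NA]]; exists (A `*` setT); split.
- exact: measurableX.
- have := @product_measure1E _ _ _ _ R lebesgue_measure (lebesgue_rV n) A setT mA measurableT.
  move=> h; apply: (eq_trans h); transitivity (0 * @lebesgue_rV R n setT)%E; [congr (_ * _)%E; exact: A0|exact: mul0e].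
- by move=> w h; split => //; apply: NA.
Qed.

Section sources_of_fields.
Context {R : realType} {n : nat}.
Local Notation S := (mspacetime R n).
Local Notation mu := (lebesgue_st n).
Local Notation lam := (lebesgue_rV n).
Variables (Q Q0 : set S) (rad c : R) (rho p : S -> R) (u f : S -> 'rV[R]_n).
Hypotheses (mQ : measurable Q) (mQ0 : measurable Q0) (Q0Q : Q0 `<=` Q)
  (Q0rad : forall w : R * 'rV[R]_n, Q0 w -> `|w| <= rad) (c0 : 0 < c)
  (Lu : forall i, LpOn mu Q 3%:E (fun z => u z ord0 i))
  (Lp : LpOn mu Q (3 / 2)%:E p)
  (Lf : forall i, LpOn mu Q (3 / 2)%:E (fun z => f z ord0 i))
  (Lrho : LpOn mu Q +oo%E rho) (rhoc : {ae mu, forall z, Q z -> c <= rho z}).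

Let cube0 : cube_integrable mu (\1_Q0 : S -> R).
Proof.
split.
- exact: measurable_indic.
- by move=> w; rewrite indicE.
- rewrite (_ : _ \o _ = EFin \o \1_Q0).
    apply: integrable_indic_lty => //.
    apply: (le_lt_trans _ (lebesgue_st_ball_lty rad)); apply: le_measure.
    + by rewrite inE.
    + by rewrite inE; exact: measurable_ball_st.
    + exact: Q0rad.
  by apply/funext => w /=; rewrite indicE; case: (_ \in _); rewrite ?expr1n ?expr0n.
Qed.

Let U i w := `|((fun z => u z ord0 i) \_ Q) w|.
Let P w := `|(p \_ Q) w| `^ 2^-1.
Let F i w := `|((fun z => f z ord0 i) \_ Q) w| `^ 2^-1.
(** Linear in |u|, square root in |p| and |f|, hence cube integrable. The indicator makes [Y] at
    least 1 on [Q0], at finite cost because [Q0] is bounded. *)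
Let Y w := \1_Q0 w + \sum_i U i w + P w + \sum_i F i w.

Let cubeY : cube_integrable mu Y.
Proof.
apply: cube_integrableD; last first.
  by apply: cube_integrable_sum => i; exact: LpOn32_cube.
apply: cube_integrableD; last exact: LpOn32_cube.
apply: cube_integrableD; first exact: cube0.
by apply: cube_integrable_sum => i; exact: LpOn3_cube.
Qed.

Let U0 i w : 0 <= U i w. Proof. exact: normr_ge0. Qed.
Let P0 w : 0 <= P w. Proof. exact: powR_ge0. Qed.
Let F0 i w : 0 <= F i w. Proof. exact: powR_ge0. Qed.
Let sU0 w : 0 <= \sum_i U i w. Proof. exact: sumr_ge0. Qed.
Let sF0 w : 0 <= \sum_i F i w. Proof. exact: sumr_ge0. Qed.

Let ind0 w : 0 <= \1_Q0 w :> R. Proof. by rewrite indicE. Qed.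

Let Y1 w : Q0 w -> 1 <= Y w.
Proof.
by move=> Qw; rewrite /Y indicE mem_set//= -!addrA lerDl !addr_ge0.
Qed.

Let YU i w : Q0 w -> `|u w ord0 i| <= Y w.
Proof.
move=> Qw; have -> : `|u w ord0 i| = U i w by rewrite /U patchE mem_set//; exact: Q0Q.
apply: (@le_trans _ _ (\sum_i U i w)).
  by rewrite (bigD1 i)//= lerDl sumr_ge0.
by have := ind0 w; have := P0 w; have := sF0 w; rewrite /Y; lra.
Qed.

Let YP w : Q0 w -> `|p w| <= Y w ^+ 2.
Proof.
move=> Qw; rewrite -(powR12_sqr (normr_ge0 (p w))).
have -> : `|p w| `^ 2^-1 = P w by rewrite /P patchE mem_set//; exact: Q0Q.
have YP : P w <= Y w by have := ind0 w; have := sU0 w; have := sF0 w; rewrite /Y; lra.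
by rewrite lerXn2r ?nnegrE// (le_trans _ YP).
Qed.

Let YF i w : Q0 w -> `|f w ord0 i| <= Y w ^+ 2.
Proof.
move=> Qw; rewrite -(powR12_sqr (normr_ge0 (f w ord0 i))).
have -> : `|f w ord0 i| `^ 2^-1 = F i w by rewrite /F patchE mem_set//; exact: Q0Q.
have YF : F i w <= Y w.
  apply: (@le_trans _ _ (\sum_i F i w)).
    by rewrite (bigD1 i)//= lerDl sumr_ge0.
  by have := ind0 w; have := sU0 w; have := P0 w; rewrite /Y; lra.
by rewrite lerXn2r ?nnegrE// (le_trans _ YF).
Qed.

Let Y3 w : (0 <= (Y w ^+ 3)%:E)%E.
Proof. by have [_ Y0 _] := cubeY; rewrite lee_fin exprn_ge0. Qed.

Let mY3 : measurable_fun setT (fun w => (Y w ^+ 3)%:E).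
Proof. by have [mY _ _] := cubeY; apply/measurable_EFinP; exact: measurable_funX. Qed.

Let I3 t := (\int[lam]_x (Y (t, x) ^+ 3)%:E)%E.
Let mI3 : measurable_fun setT I3.
Proof. exact: (@measurable_fun_fubini_tonelli_F _ _ _ _ R lam _ mY3 Y3). Qed.

Let I3_lty : {ae lebesgue_measure, forall t, (I3 t < +oo)%E}.
Proof.
have [_ _ iY] := cubeY.
have iI : lebesgue_measure.-integrable setT I3.
  apply/integrableP; split; first exact: mI3.
  under eq_integral => t _ do rewrite gee0_abs ?integral_ge0//.
  rewrite -(fubini_st mY3 Y3); move/integrableP : iY => [_].
  apply: le_lt_trans; rewrite le_eqVlt; apply/orP; left; apply/eqP.
  by apply: eq_integral => w _; rewrite /= ger0_norm// -lee_fin Y3.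
have := integrable_ae measurableT iI; apply: filterS => t /(_ I).
by move=> /fin_numPlt/andP[].
Qed.

(* [Gd] discards the null set where the density leaves its essential bounds or
   the time slice of [Y ^+ 3] is not integrable. There the density is replaced
   by [c] and the other fields by [0], so that the bounds hold everywhere. *)
Lemma sources_exist : exists (Gd : set S) (y : S -> R) (M : R),
  [/\ measurable Gd, Gd `<=` Q0, {ae mu, forall w, Q0 w -> Gd w},
      forall w, Gd w -> c <= rho w &
    sources Q0 y M c (fun w => (rho \_ Gd) w + c * \1_(Q0 `\` Gd) w) (p \_ Gd)
      (fun i => (fun w => rho w * u w ord0 i) \_ Gd)
      (fun i => (fun w => rho w * f w ord0 i) \_ Gd)
      (fun i j => (fun w => rho w * tensor (u w) (u w) i j) \_ Gd)].
Proof.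
have [mrho _] := Lrho; have [M0 M00 rhoM] := LpOnoo_bounded Lrho.
have [mY Y0 iY] := cubeY.
have mrhoQ : measurable_fun setT (rho \_ Q) by exact: (measurable_restrictT rho mQ).1 mrho.
pose Gd : set S := Q0 `&` ((rho \_ Q) @^-1` `[c, M0]) `&` ([set t | (I3 t < +oo)%E] `*` setT).
have mT : measurable ([set t | (I3 t < +oo)%E] : set (measurableTypeR R)).
  have : measurable (setT `&` I3 @^-1` `[-oo%E, +oo%E[).
    by apply: mI3 => //; exact: emeasurable_itv.
  rewrite setTI; congr (measurable _).
  by apply/seteqP; split => t /=; rewrite in_itv/= leNye.
have mGd : measurable Gd.
  apply: measurableI; last exact: measurableX.
  by apply: measurableI => //; rewrite -[X in measurable X]setTI; exact: mrhoQ.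
have GdQ0 : Gd `<=` Q0 by move=> w [[]].
have GdQ : Gd `<=` Q by move=> w /GdQ0/Q0Q.
have Gdrho w : Gd w -> c <= rho w <= M0.
  move=> Gw; have Qw := GdQ _ Gw; case: Gw => [[_ /=]].
  by rewrite patchE mem_set// in_itv.
have aeGd : {ae mu, forall w, Q0 w -> Gd w}.
  have aeT : {ae mu, forall w, ~ ~ (I3 w.1 < +oo)%E}.
    apply: (@negligible_fst R n [set t | ~ (I3 t < +oo)%E]).
    by apply: filterS I3_lty => t h; exact.
  apply: (ae_imp (ae_and (ae_and aeT rhoM) rhoc)) => w [[/contrapT Tw rM] rc] Qw.
  have Qw' := Q0Q Qw; split; last by split.
  split => //=; rewrite patchE mem_set// in_itv/= rc//=.
  by rewrite (le_trans _ (rM Qw'))// ler_norm.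
(* [M0] serves the fields carrying the factor rho, [c] the substitute density, and 1 the pressure,
   which is bounded by Y^2 without a factor. *)
pose M := M0 + c + 1.
have M1 : 1 <= M by rewrite /M lerDr addr_ge0// ltW.
have Mge0 : 0 <= M by exact: le_trans M1.
have M0M : M0 <= M by rewrite /M -addrA lerDl addr_ge0// ltW.
have cM : c <= M by rewrite /M addrAC lerDr addr_ge0.
pose B := Q0 `\` Gd.
have mB : measurable B by exact: measurableD.
(* The value 1 on the discarded set is needed there for the substitute density [c] to stay below M
   y; outside [Q0] the weight is 0. *)
pose y w := (Y \_ Gd) w + \1_B w.
have cases w : [\/ Gd w, B w | ~ Q0 w].
  have [Gw|nG] := pselect (Gd w); first exact: Or31.
  by have [Qw|nQ] := pselect (Q0 w); [exact: Or32|exact: Or33].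
have inG (g : S -> R) w : Gd w -> (g \_ Gd) w = g w by move=> Gw; rewrite patchE mem_set.
have outG (g : S -> R) w : ~ Gd w -> (g \_ Gd) w = 0 by move=> nG; rewrite patchE memNset.
have indB w : B w -> \1_B w = 1 :> R by move=> Bw; rewrite indicE mem_set.
have indnB w : ~ B w -> \1_B w = 0 :> R by move=> nB; rewrite indicE memNset.
have GnB w : Gd w -> ~ B w by move=> Gw [].
have nQnG w : ~ Q0 w -> ~ Gd w by move=> nQ /GdQ0.
have nQnB w : ~ Q0 w -> ~ B w by move=> nQ [].
have yG w : Gd w -> y w = Y w by move=> Gw; rewrite /y inG// indnB ?addr0//; exact: GnB.
have yB w : B w -> y w = 1 by move=> Bw; rewrite /y indB// outG ?add0r//; case: Bw.
have yN w : ~ Q0 w -> y w = 0.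
  by move=> nQ; rewrite /y indnB ?outG ?addr0//; [exact: nQnG|exact: nQnB].
have y0 w : 0 <= y w.
  by case: (cases w) => [/yG->//|/yB->//|/yN->].
have mRG (g : S -> R) : measurable_fun Q g -> measurable_fun setT (g \_ Gd).
  move=> mg; apply: (measurable_restrictT g mGd).1.
  exact: measurable_funS mg.
have mmu i : measurable_fun Q (fun w => rho w * u w ord0 i).
  by apply: measurable_funM => //; have [] := Lu i.
have my : measurable_fun setT y.
  apply: measurable_funD; last exact: measurable_indic.
  apply: (measurable_restrictT Y mGd).1; exact: measurable_funS mY.
have yY w : y w <= Y w.
  case: (cases w) => [/yG->//|Bw|/yN->//]; last by rewrite yB// Y1//; case: Bw.
have restr_le (g : S -> R) k (C : R) w : 0 <= C -> (Gd w -> `|g w| <= C * Y w ^+ k) ->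
    `|(g \_ Gd) w| <= C * y w ^+ k.
  move=> C0 gk; have [Gw|nG] := pselect (Gd w); first by rewrite inG// yG// gk.
  by rewrite outG// normr0 mulr_ge0// exprn_ge0.
have rho_le w : Gd w -> `|rho w| <= M.
  move=> /Gdrho/andP[cr rM]; rewrite ger0_norm ?(le_trans rM)//.
  exact: le_trans (ltW c0) cr.
exists Gd, y, M; split => //; first by move=> w /Gdrho/andP[].
split => //.
- move=> w; case: (cases w) => [Gw|/yB->|/yN->]; [right|by right|by left].
  by rewrite yG// Y1//; exact: GdQ0.
- apply: (integrable_real_le _ _ iY) => [|w]; first exact: measurable_funX.
  by rewrite ger0_norm ?exprn_ge0// lerXn2r ?nnegrE.
- move=> t; have myt : measurable_fun setT (fun x => y (t, x) ^+ 3).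
    by apply: measurable_funX; exact: measurable_slice.
  have [It|nIt] := pselect (I3 t < +oo)%E.
    apply: integrable_real_lty => //; apply: le_lt_trans It.
    apply: ge0_le_integral => //.
    + by apply: measurableT_comp => //; exact/measurable_EFinP.
    + by apply/measurable_EFinP; apply: measurable_funX; exact: measurable_slice.
    + move=> x _; rewrite abse_EFin ger0_norm ?exprn_ge0// lee_fin.
      by rewrite lerXn2r ?nnegrE.
  (* On a bad time slice [Gd] is empty, so y is the indicator of a bounded set and remains
     integrable. *)
  have nG x : ~ Gd (t, x) by move=> [_ []].
  apply: (integrable_bounded_support (measurable_ball_rV rad) (lebesgue_rV_ball_lty rad)
    myt (M := 1)) => x.
    case: (cases (t, x)) => [/nG//|/yB->|/yN->]; first by rewrite expr1n normr1.
    by rewrite expr0n normr0.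
  case: (cases (t, x)) => [/nG//|[/Q0rad + _] _|/yN->]; last by rewrite expr0n eqxx.
  by rewrite normr_st/= ge_max => /andP[].
- apply: measurable_funD; first exact: mRG.
  by apply: measurable_funM => //; exact: measurable_indic.
- by apply: mRG; have [] := Lp.
- by move=> i; exact: mRG.
- by move=> i; apply: mRG; apply: measurable_funM => //; have [] := Lf i.
- move=> i j; apply: mRG; under eq_fun do rewrite tensorE.
  by apply: measurable_funM => //; apply: measurable_funM; [have [] := Lu i|have [] := Lu j].
- move=> w; case: (cases w) => [Gw|Bw|nQ].
  + by rewrite inG// indnB ?mulr0 ?addr0 ?rho_le//; exact: GnB.
  + by rewrite indB// outG ?add0r ?mulr1 ?gtr0_norm//; case: Bw.
  + by rewrite indnB ?outG ?mulr0 ?addr0 ?normr0//; [exact: nQnG|exact: nQnB].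
- move=> w; case: (cases w) => [Gw|Bw|nQ].
  + rewrite inG// indnB ?mulr0 ?addr0 ?yG//; last exact: GnB.
    by rewrite (le_trans (rho_le _ Gw))// ler_peMr// Y1//; exact: GdQ0.
  + by rewrite indB// outG ?add0r ?mulr1 ?gtr0_norm ?yB ?mulr1//; case: Bw.
  + by rewrite indnB ?outG ?mulr0 ?addr0 ?normr0 ?yN ?mulr0//; [exact: nQnG|exact: nQnB].
- move=> i w; rewrite -[y w]expr1; apply: restr_le => // Gw.
  by rewrite normrM expr1 ler_pM// ?rho_le// YU//; exact: GdQ0.
- move=> w; apply: restr_le => // Gw.
  rewrite (le_trans (YP (GdQ0 _ Gw)))// ler_peMl// exprn_ge0//.
- move=> i w; apply: restr_le => // Gw.
  by rewrite normrM ler_pM// ?rho_le// YF//; exact: GdQ0.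
- move=> i j w; apply: restr_le => // Gw.
  rewrite normrM ler_pM// ?rho_le// tensorE normrM expr2.
  by rewrite ler_pM// YU//; exact: GdQ0.
- move=> w Qw; case: (cases w) => [Gw|Bw|//].
  + rewrite inG// indnB ?mulr0 ?addr0//; last exact: GnB.
    by have /andP[] := Gdrho _ Gw.
  + by rewrite indB// outG ?add0r ?mulr1//; case: Bw.
Qed.

End sources_of_fields.

Lemma ae_slices {R : realType} {n : nat} (P : mspacetime R n -> Prop) :
  {ae lebesgue_st n, forall w : mspacetime R n, P w} ->
  {ae (@lebesgue_measure R), forall t, {ae lebesgue_rV n, forall y, P (t, y)}}.
Proof.
move=> [N [mN N0 PN]].
have mx : measurable_fun setT (fun t => lebesgue_rV n (xsection N t)).
  exact: measurable_fun_xsection.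
have : (\int[@lebesgue_measure R]_t `|lebesgue_rV n (xsection N t)| = 0)%E.
  rewrite -N0; apply: eq_integral => t _.
  by rewrite gee0_abs.
move/(ae_eq_integral_abs (@lebesgue_measure R) measurableT mx).1; apply: filterS => t /(_ I) Nt.
exists (xsection N t); split => //; first exact: measurable_xsection.
by move=> y nP; rewrite /xsection /= inE; exact: PN.
Qed.

(** [J1] uses the symmetric gradient, the energy balance the full one; against a symmetric matrix
    they give the same contraction. *)
Lemma ddot_sym {R : realType} {n : nat} (A B : 'M[R]_n) : (forall i j, A i j = A j i) ->
  ddot A (2^-1 *: (B + B^T)) = ddot A B.
Proof.
move=> sA; have e : ddot A B^T = ddot A B.
  rewrite /ddot exchange_big; apply: eq_bigr => i _; apply: eq_bigr => j _.
  by rewrite mxE sA.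
transitivity (2^-1 * (ddot A B + ddot A B^T)).
  rewrite /ddot -big_split mulr_sumr; apply: eq_bigr => i _.
  rewrite -big_split mulr_sumr; apply: eq_bigr => j _.
  by rewrite !mxE /=; ring.
by rewrite e; field.
Qed.

(** * Identification of J1 - J3 and of the defect *)

Section slice_values.
Context {R : realType} {n : nat}.
Local Notation S := (mspacetime R n).
Local Notation lam := (lebesgue_rV n).
Variables (Omega : set 'rV[R]_n) (T : R) (Q0 Gd : set S)
  (rho p : S -> R) (u : S -> 'rV[R]_n) (eta : 'rV[R]_n -> R).
Hypothesis Q0Q : Q0 `<=` (`]0, T[%classic `*` Omega).
Variables (GR Gp : S -> R) (Gm Gb : 'I_n -> S -> R) (GS : 'I_n -> 'I_n -> S -> R).
Hypotheses (GdR : forall w, Gd w -> rho w = GR w) (Gdp : forall w, Gd w -> p w = Gp w)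
  (Gdm : forall i w, Gd w -> rho w * u w ord0 i = Gm i w)
  (GdS : forall i j w, Gd w -> rho w * tensor (u w) (u w) i j = GS i j w).
Hypotheses (sR : integrable_slices GR) (sm : forall i, integrable_slices (Gm i)).
Variables (l : R) (reta : radial_kernel eta) (l0 : 0 < l).
Let k := scaled_kernel eta l.
Let sf := src_field GR Gp Gm Gb GS.
Let H i := convx (src_kernel k i) (sf i).

(** The kernel around x sees only [Q0], and on this slice [Q0] lies in [Gd] up to a null set; where
    the kernel vanishes, neither Omega nor the extension of the fields matters. *)
Lemma mollify_convx (g G : S -> R) t x :
  {ae lam, forall y, Q0 (t, y) -> Gd (t, y)} -> (forall w, Gd w -> g w = G w) ->
  (forall y, `|x - y| <= l -> Q0 (t, y)) ->
  mollify Omega eta l g (t, x) = convx k G (t, x).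
Proof.
move=> Gt gG xQ; apply: eq_Rintegral_restrict_ae.
  apply: (ae_imp Gt) => y Gy Oy /=; rewrite -/k.
  have [->|ky] := eqVneq (k (x - y)) 0; first by rewrite !mulr0.
  rewrite gG//; apply: Gy; apply: xQ; apply: ltW.
  exact: (scaled_kernel_supp l0 reta ky).
move=> y nO /=; rewrite -/k; have [->|ky] := eqVneq (k (x - y)) 0; first by rewrite mulr0.
by have /Q0Q[] := xQ y (ltW (scaled_kernel_supp l0 reta ky)).
Qed.

Variables (z : R * 'rV[R]_n) (del : R).
Hypotheses (zQ : forall w : R * 'rV[R]_n, `|z - w| <= del -> Q0 w) (ldel : l < del)
  (Gt : {ae lam, forall y, Q0 (z.1, y) -> Gd (z.1, y)}) (r0 : H iR z != 0).

Let mollifyE (g G : S -> R) x : (forall w, Gd w -> g w = G w) ->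
  `|z.2 - x| <= del - l -> mollify Omega eta l g (z.1, x) = convx k G (z.1, x).
Proof.
move=> gG zx; apply: (mollify_convx Gt gG) => y xy; apply: zQ.
rewrite normr_st/= subrr normr0 ge_max (ltW (lt_trans l0 ldel))/=.
rewrite -(subrK x z.2) -addrA (le_trans (ler_normD _ _))//.
by rewrite -(subrK l del) lerD.
Qed.

Let mollifyEz (g G : S -> R) : (forall w, Gd w -> g w = G w) ->
  mollify Omega eta l g z = convx k G z.
Proof.
move=> gG; have := @mollifyE g G z.2 gG; rewrite subrr normr0 => /(_ _).
by rewrite subr_ge0 (ltW ldel) -surjective_pairing; apply.
Qed.

(** At neighbouring times [mollify] and [convx] may differ, so equality holds along space directions
    inside the good slice and not on a full neighbourhood. This is why [eq_derive_line] is used. *)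
Let grad_favre i j : grad (favre_vec Omega eta l rho u) z i j =
  gform (H iR z) (fun i => H (im i) z) (fun j => H (idR j) z) (fun i j => H (idm i j) z) i j.
Proof.
rewrite mxE; pose v : R * 'rV[R]_n := (0, basis_vec j).
pose F (z' : R * 'rV[R]_n) := convx k (Gm i) z' * (convx k GR z')^-1.
transitivity ('D_v F z).
  apply: eq_derive_line; have dl : 0 < del - l by rewrite subr_gt0.
  (* Such h move the point by at most del - l, so the kernel ball of radius l around it stays within
     [del] of z. The added 1 keeps the denominator positive. *)
  apply/nbhs_ballP; exists ((del - l) / (`|v| + 1)) => /=.
    by rewrite divr_gt0// ltr_wpDl.
  move=> h; rewrite -ball_normE/= sub0r normrN => hv.
  have hvd : `|h *: v| <= del - l.
    rewrite normrZ (@le_trans _ _ (`|h| * (`|v| + 1)))// ?ler_wpM2l ?lerDl//.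
    by rewrite -ler_pdivlMr ?ltr_wpDl// ltW.
  have z1 : (h *: v + z).1 = z.1 by rewrite /= scaler0 add0r.
  have z2 : `|z.2 - (h *: v + z).2| <= del - l.
    rewrite /= opprD addrCA subrr addr0 normrN.
    by apply: le_trans hvd; rewrite normr_st le_max lexx orbT.
  have e (g G : S -> R) : (forall w, Gd w -> g w = G w) ->
      mollify Omega eta l g (h *: v + z) = convx k G (h *: v + z).
    by move=> gG; rewrite [h *: v + z]surjective_pairing z1 (mollifyE gG z2).
  by rewrite mxE /favre [X in X / _](e _ (Gm i) (Gdm i)) (e rho GR GdR).
have sk := scaled_kernel_smooth l reta.
have kl x : k x != 0 -> `|x| <= l by move=> /(scaled_kernel_supp l0 reta)/ltW.
have dm := is_derive_convx z (basis_vec j) sk kl (sm i).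
have [dR DR] := is_derive_convx z (basis_vec j) sk kl sR.
have dV : is_derive z v (fun z' => (convx k GR z')^-1)
    (- (convx k GR z)^-1 ^+ 2 * convx ('D_(basis_vec j) k) GR z).
  by apply: DeriveDef; [exact: derivableV|rewrite deriveV// DR -exprVn].
exact: (@derive_val _ _ _ _ _ _ _ (is_deriveM dm dV)).
Qed.

(** The outer mollified density cancels one of the two divisions by it in the Favre stress, giving U
    i times m j minus Sg i j; the stress is symmetric, so [ddot_sym] applies. *)
Lemma J_value : J1 Omega eta rho u l z - J3 Omega eta rho p u l z = jval (H ^~ z).
Proof.
rewrite /J1 /J3 /divergence /jval /jform.
have RE : mollify Omega eta l rho z = H iR z by exact: (mollifyEz GdR).
have UE i : favre_vec Omega eta l rho u z ord0 i = H (im i) z * (H iR z)^-1.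
  by rewrite mxE /favre RE (mollifyEz (Gdm i)).
congr (_ - _); last first.
  rewrite (mollifyEz Gdp); congr (_ * _).
  by apply: eq_bigr => i _; exact: grad_favre.
have SE i j : favre_mx Omega eta l rho (fun z' => tensor (u z') (u z')) z i j =
    H (iS i j) z * (H iR z)^-1.
  by rewrite mxE /favre RE (mollifyEz (GdS i j)).
have Ssym i j : favre_mx Omega eta l rho (fun z' => tensor (u z') (u z')) z i j =
    favre_mx Omega eta l rho (fun z' => tensor (u z') (u z')) z j i.
  rewrite !mxE; congr (favre _ _ _ _ _ _); apply/funext => w.
  by rewrite !tensorE mulrC.
rewrite /sym_grad ddot_sym; last first.
  move=> i j; rewrite mxE [RHS]mxE !tensorE mulrC; congr (_ + _).
  by rewrite mxE [RHS]mxE Ssym.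
rewrite RE /ddot mulr_sumr; apply: eq_bigr => i _; rewrite mulr_sumr.
apply: eq_bigr => j _; rewrite grad_favre mulrA; congr (_ * _).
rewrite mxE tensorE !UE mxE SE; field.
exact: r0.
Qed.

End slice_values.

Section defect_value.
Context {R : realType} {n : nat}.
Local Notation S := (mspacetime R n).
Local Notation mu := (lebesgue_st n).
Variables (Omega : set 'rV[R]_n) (T : R) (Q0 Gd : set S)
  (rho p : S -> R) (u f : S -> 'rV[R]_n) (eta : 'rV[R]_n -> R).
Let Q : set S := `]0, T[%classic `*` Omega.
Hypothesis Q0Q : Q0 `<=` Q.
Variables (y : S -> R) (M c : R).
Variables (GR Gp : S -> R) (Gm Gb : 'I_n -> S -> R) (GS : 'I_n -> 'I_n -> S -> R).
Hypotheses (GdR : forall w, Gd w -> rho w = GR w) (Gdp : forall w, Gd w -> p w = Gp w)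
  (Gdm : forall i w, Gd w -> rho w * u w ord0 i = Gm i w)
  (Gdb : forall i w, Gd w -> rho w * f w ord0 i = Gb i w)
  (GdS : forall i j w, Gd w -> rho w * tensor (u w) (u w) i j = GS i j w)
  (Gdc : forall w, Gd w -> c <= rho w) (aeGd : {ae mu, forall w, Q0 w -> Gd w}).
Hypothesis src : sources Q0 y M c GR Gp Gm Gb GS.
Let sf := src_field GR Gp Gm Gb GS.
Let et : R * 'rV[R]_n := (1, 0).
Let ex j : R * 'rV[R]_n := (0, basis_vec j).
Variables (del : R) (K : set (R * 'rV[R]_n)) (phi : R * 'rV[R]_n -> R) (rad L : R).
Hypotheses (del0 : 0 < del) (clK : closed K) (Kr : forall z, K z -> `|z| <= rad)
  (sphi : smooth phi) (phiK : forall z, phi z != 0 -> K z)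
  (KQ : forall z, K z -> forall w, `|z - w| <= del -> Q0 w)
  (L0 : 0 <= L) (phiL : forall z, `|phi z| <= L) (phitL : forall z, `|'D_et phi z| <= L)
  (phixL : forall j z, `|'D_(ex j) phi z| <= L).

Let KQ0 z : K z -> Q0 z.
Proof. by move=> Kz; apply: (KQ Kz); rewrite subrr normr0 ltW. Qed.

Let phi_off z : ~ K z -> phi z = 0.
Proof. by move=> nKz; apply/eqP; apply: contrapT => /negP /phiK. Qed.

Let Dphi_off v z : ~ K z -> 'D_v phi z = 0.
Proof.
by move=> nKz; apply/eqP; apply: contrapT => /negP h; apply: nKz; exact: derive_eq0_off h.
Qed.

(** By Fubini almost every time slice is good in the sense of [J_value], and bad times form a null
    set of space-time; outside [K] the factor phi vanishes. *)
Lemma distr_of_J (reta : radial_kernel eta) l : 0 < l -> l < del ->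
  distr_of Q (fun z => J1 Omega eta rho u l z - J3 Omega eta rho p u l z) phi =
  \int[mu]_(z in setT) (phi z *
    jval (fun i => convx (src_kernel (scaled_kernel eta l) i) (sf i) z)).
Proof.
move=> l0 ldel; apply: eq_Rintegral_restrict_ae; last first.
  by move=> z nQ; rewrite phi_off ?mul0r// => /KQ0/Q0Q.
have aeT : {ae mu, forall w : S,
    ~ ~ {ae lebesgue_rV n, forall x, Q0 (w.1, x) -> Gd (w.1, x)}}.
  apply: (@negligible_fst R n [set t | ~ {ae lebesgue_rV n, forall x, Q0 (t, x) -> Gd (t, x)}]).
  by apply: (ae_imp (ae_slices aeGd)) => t h; exact.
apply: (ae_imp aeT) => z /contrapT Gt Qz.
have [Kz|nKz] := pselect (K z); last by rewrite phi_off// mul0r mulr0.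
rewrite mulrC; congr (_ * _).
have sG i : integrable_slices (src_field GR Gp Gm Gb GS i).
  by have [] := src_field_integrable src i.
have hk := space_kernel_scaled reta l0.
have Hc : c <= convx (scaled_kernel eta l) GR z.
  have := mollified_density_ge src KQ hk (ltW ldel) Kz (s := z.1).
  by rewrite subrr normr0 => /(_ (ltW del0)); case: (z).
apply: (J_value Q0Q GdR Gdp Gdm GdS (sG iR) (fun i => sG (im i)) reta l0 (KQ Kz) ldel Gt).
by rewrite gt_eqF// (lt_le_trans (src_c0 src)).
Qed.

Let mG i : measurable_fun setT (sf i). Proof. exact: src_field_measurable src i. Qed.

(** Taken with all but one of the test factors equal to 0, this makes each term of [flux] integrable
    separately, so that its integral may be split. Pointwise, y, y^2 and y^3 play the parts of a, q
    and E, with A = 1. *)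
Lemma integrable_rval (a b : S -> R) (b' : 'I_n -> S -> R) :
  measurable_fun setT a -> measurable_fun setT b -> (forall j, measurable_fun setT (b' j)) ->
  (forall z, `|a z| <= L) -> (forall z, `|b z| <= L) -> (forall j z, `|b' j z| <= L) ->
  (forall z, ~ K z -> a z = 0) -> (forall z, ~ K z -> b z = 0) ->
  (forall j z, ~ K z -> b' j z = 0) ->
  mu.-integrable setT (EFin \o (fun z => rval (sf ^~ z) (a z) (b z) (b' ^~ z))).
Proof.
move=> ma mb mb' aL bL bL' aK bK bK'.
pose Cst := dom_const (n := n) M c 1 L.
have Cst0 : 0 <= Cst by exact: (@dom_const_ge0 R n M c 1 L (src_M0 src) (src_c0 src) ler01 L0).
have iB := integrableZl_real Cst (integrable_indic_lty (measurable_ball_st (n := n) rad)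
  (lebesgue_st_ball_lty rad)).
apply: (integrable_real_le _ _ (integrableD_real iB (integrableZl_real Cst (src_iy src)))).
  exact: measurable_rform.
move=> z; have y0 := src_y_ge0 src z; have y3 : 0 <= y z ^+ 3 by exact: exprn_ge0.
have [Kz|nKz] := pselect (K z); last first.
  rewrite /rval /rform aK// bK// mulr0 mul0r addr0 add0r big1 ?normr0.
    by apply: addr_ge0; apply: mulr_ge0.
  by move=> j _; rewrite bK' ?mul0r.
rewrite indicE mem_set/=; last exact: Kr.
rewrite -mulrDr; apply: (rform_dominated (src_M0 src) (src_c0 src) ler01 L0 y0 (q := y z ^+ 2)
  (E := y z ^+ 3)); rewrite ?exprn_ge0 ?expr1n ?mul1r//.
- by rewrite -exprS mulrDl mul1r lerDl exprn_ge0.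
- by apply: (src_Rc src); exact: KQ0.
- by move=> i; exact: src_m_le src i z.
- by move=> i j; exact: src_S_le src i j z.
- exact: src_p_le src z.
- by move=> i; exact: src_b_le src i z.
Qed.

Lemma enorm_sqr (x : 'rV[R]_n) : enorm x ^+ 2 = \sum_i x ord0 i ^+ 2.
Proof.
rewrite /enorm sqr_sqrtr; first by apply: eq_bigr => i _; rewrite expr2.
by apply: sumr_ge0 => i _; rewrite -expr2 sqr_ge0.
Qed.

(** On [Gd] the quotient Gm / GR is u, so the forms become the kinetic energy, its flux and the work
    of the force. The outer minus sign of [defect] cancels those of the distributional derivatives
    and of the force term. *)
Lemma flux_defect : \int[mu]_(z in setT) flux phi sf z = defect Q rho p u f phi.
Proof.
have mphi := measurable_kernel sphi; have mD v := measurable_derive_kernel sphi v.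
pose PE (z : S) := eform (GR z) (Gm ^~ z) * 'D_et phi z.
pose W z j := wform (GR z) (Gm ^~ z) (fun i j => GS i j z) (Gp z) j.
pose PW j (z : S) := 'D_(ex j) phi z * W z j.
pose PB (z : S) := phi z * \sum_i Gm i z * (GR z)^-1 * Gb i z.
have z0 (z : S) : `|0 : R| <= L by rewrite normr0.
have iE : mu.-integrable setT (EFin \o PE).
  have := integrable_rval (a := fun=> 0) (b := 'D_et phi) (b' := fun=> fun=> 0)
    (@measurable_cst _ _ _ _ _ _) (mD et) (fun=> @measurable_cst _ _ _ _ _ _)
    z0 phitL (fun=> z0) (fun z _ => erefl) (@Dphi_off et) (fun _ z _ => erefl).
  congr (_.-integrable _ _); apply/funext => z /=.
  by rewrite /rval /rform mul0r addr0 big1 ?addr0// => j _; rewrite mul0r.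
have iB : mu.-integrable setT (EFin \o PB).
  have := integrable_rval (a := phi) (b := fun=> 0) (b' := fun=> fun=> 0)
    mphi (@measurable_cst _ _ _ _ _ _) (fun=> @measurable_cst _ _ _ _ _ _)
    phiL z0 (fun=> z0) phi_off (fun z _ => erefl) (fun _ z _ => erefl).
  congr (_.-integrable _ _); apply/funext => z /=.
  by rewrite /rval /rform mulr0 add0r big1 ?add0r// => j _; rewrite mul0r.
have iW j : mu.-integrable setT (EFin \o PW j).
  have := integrable_rval (a := fun=> 0) (b := fun=> 0)
    (b' := fun j' z => if j' == j then 'D_(ex j) phi z else 0)
    (@measurable_cst _ _ _ _ _ _) (@measurable_cst _ _ _ _ _ _).
  have h1 j' : measurable_fun setT (fun z : S => if j' == j then 'D_(ex j) phi z else 0).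
    by case: eqP => _; [exact: mD|exact: measurable_cst].
  have h2 j' z : `|if j' == j then 'D_(ex j) phi z else 0| <= L.
    by case: eqP => _; rewrite ?normr0 ?phixL.
  have h3 j' z : ~ K z -> (if j' == j then 'D_(ex j) phi z else 0) = 0.
    by move=> nKz; case: eqP => // _; exact: Dphi_off.
  move=> /(_ h1 z0 z0 h2 (fun z _ => erefl) (fun z _ => erefl) h3).
  congr (_.-integrable _ _); apply/funext => z /=.
  rewrite /rval /rform mulr0 mul0r addr0 add0r (bigD1 j)//= eqxx big1 ?addr0//.
  by move=> j' /negPf ->; rewrite mul0r.
have [iWs eW] := Rintegral_sum_ord iW.
have -> : \int[mu]_(z in setT) flux phi sf z = \int[mu]_(z in setT) PE z +
    \sum_j \int[mu]_(z in setT) PW j z + \int[mu]_(z in setT) PB z.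
  rewrite -eW -RintegralD// -RintegralD//; last exact: integrableD_real.
have offQ z : ~ Q z -> ~ K z by move=> nQ /KQ0/Q0Q.
have split_int (g h : S -> R) (psi : R * 'rV[R]_n -> R) :
    (forall w, Gd w -> g w = h w) -> (forall z, ~ K z -> psi z = 0) ->
    \int[mu]_(z in setT) (h z * psi z) = distr_of Q g psi.
  move=> gh psiK; apply/esym/eq_Rintegral_restrict_ae => [|z /offQ/psiK->]; last first.
    by rewrite mulr0.
  apply: (ae_imp aeGd) => z Gz _; have [Kz|/psiK ->] := pselect (K z); last by rewrite !mulr0.
  by rewrite gh//; apply: Gz; exact: KQ0.
have rn0 w : Gd w -> rho w != 0.
  by move=> /Gdc cr; rewrite gt_eqF// (lt_le_trans (src_c0 src)).
have -> : \int[mu]_(z in setT) PE z = distr_of Q (kinetic rho u) ('D_et phi).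
  apply: split_int => [w Gw|]; last exact: Dphi_off.
  rewrite /kinetic /eform enorm_sqr mulr_sumr; congr (_ / _); apply: eq_bigr => i _.
  by rewrite -Gdm// -GdR//; field; exact: rn0.
have EW j : \int[mu]_(z in setT) PW j z =
    distr_of Q (fun z => u z ord0 j * (kinetic rho u z + p z)) ('D_(ex j) phi).
  rewrite -(split_int _ (W ^~ j)); [|move=> w Gw|exact: Dphi_off].
    by apply: eq_Rintegral => z _; rewrite mulrC.
  rewrite /W /wform /kinetic enorm_sqr -GdR// -Gdp//.
  have mE i : Gm i w * (rho w)^-1 = u w ord0 i.
    by rewrite -Gdm// mulrAC divff ?mul1r// rn0.
  under [in RHS]eq_bigr => i _.
    rewrite mE -GdS// tensorE (_ : _ * _ = rho w * u w ord0 j * u w ord0 i ^+ 2); last by ring.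
    over.
  rewrite -mulr_sumr mE -Gdm//.
  under [X in (-1) * (X / _ * _)]eq_bigr => i _ do rewrite mE -expr2.
  by field.
have -> : \int[mu]_(z in setT) PB z = distr_of Q (fun z => rho z * dotv (f z) (u z)) phi.
  rewrite -(split_int _ (fun z => \sum_i Gm i z * (GR z)^-1 * Gb i z)); [|move=> w Gw|exact: phi_off].
    by apply: eq_Rintegral => z _; rewrite mulrC.
  rewrite /dotv mulr_sumr; apply: eq_bigr => i _.
  by rewrite -Gdm// -GdR// -Gdb//; field; exact: rn0.
under eq_bigr do rewrite EW.
have sumE (G : 'I_n -> (spacetime R n -> R) -> R) : (\sum_i G i) phi = \sum_i G i phi.
  by rewrite fct_sumE.
transitivity (- (- distr_of Q (kinetic rho u) ('D_et phi) + distr_div (fun i => distr_of Q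
  (fun z => u z ord0 i * (kinetic rho u z + p z))) phi
  - distr_of Q (fun z => rho z * dotv (f z) (u z)) phi)); last by [].
rewrite /distr_div sumE.
under [X in - (_ + X - _)]eq_bigr => i _ do rewrite [distr_dx _ _ _](_ : _ =
  - distr_of Q (fun z => u z ord0 i * (kinetic rho u z + p z)) ('D_(ex i) phi))//.
by rewrite sumrN; ring.
Qed.

End defect_value.

Lemma open_setX {V W : topologicalType} (A : set V) (B : set W) :
  open A -> open B -> open (A `*` B).
Proof.
move=> oA oB; have -> : A `*` B = (fst @^-1` A) `&` (snd @^-1` B) by [].
by apply: openI; apply: open_comp => // z _; [exact: cvg_fst|exact: cvg_snd].
Qed.

Lemma compact_le_norm {R : realType} {V : normedModType R} (K : set V) : compact K ->
  exists rad : R, forall z, K z -> `|z| <= rad.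
Proof.
move=> /compact_bounded [M [_ h]]; exists (M + 1) => z Kz.
by apply: (h (M + 1)) => //; rewrite ltrDl.
Qed.

(** In dimension zero every sum over coordinates is empty, so both sides vanish. *)
Lemma J_cvg_defect0 (R : realType) (Omega : set 'rV[R]_0) (Q : set (spacetime R 0))
    (rho p : spacetime R 0 -> R) (u f : spacetime R 0 -> 'rV[R]_0) (eta : 'rV[R]_0 -> R) :
  distr_cvg0 Q
    (fun l => distr_of Q (fun z => J1 Omega eta rho u l z - J3 Omega eta rho p u l z))
    (defect Q rho p u f).
Proof.
move=> phi _.
have dist0 (g : spacetime R 0 -> R) psi : (forall z, g z = 0) -> distr_of Q g psi = 0.
  move=> g0; rewrite /distr_of (_ : (fun z => _) = fun=> 0).
    by rewrite /Rintegral integral0.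
  by apply/funext => z; rewrite g0 mul0r.
have dot0 (x y : 'rV[R]_0) : dotv x y = 0 by rewrite /dotv big_ord0.
have -> : defect Q rho p u f phi = 0.
  transitivity (- (- distr_of Q (kinetic rho u) ('D_(1, 0) phi) + distr_div (fun i => distr_of Q
    (fun z => u z ord0 i * (kinetic rho u z + p z))) phi
    - distr_of Q (fun z => rho z * dotv (f z) (u z)) phi)); first by [].
  rewrite /distr_div big_ord0 !dist0 ?oppr0 ?addr0 ?add0r ?oppr0// => z.
    by rewrite dot0 mulr0.
  by rewrite /kinetic /enorm dot0 sqrtr0 expr0n mulr0 mul0r.
rewrite (_ : (fun l => _) = cst 0); first exact: cvg_cst.
apply/funext => l; apply: dist0 => z.
by rewrite /J1 /J3 /ddot /divergence /mxtrace !big_ord0 !mulr0 subr0.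
Qed.

Theorem proposition5p2 (R : realType) (d : nat) (Omega : set 'rV[R]_d) (T : R)
    (rho p : spacetime R d -> R) (u f : spacetime R d -> 'rV[R]_d) (c : R)
    (eta : 'rV[R]_d -> R) :
  let Q : set (spacetime R d) := `]0, T[%classic `*` Omega in
  open Omega -> 0 < T ->
  euler_weak_solution Q rho p u f ->
  (forall i, LpOn (lebesgue_st d) Q 3%:E (fun z => u z ord0 i)) ->
  LpOn (lebesgue_st d) Q (3 / 2)%:E p ->
  (forall i, LpOn (lebesgue_st d) Q (3 / 2)%:E (fun z => f z ord0 i)) ->
  LpOn (lebesgue_st d) Q +oo%E rho ->
  0 < c -> {ae lebesgue_st d, forall z, Q z -> c <= rho z} ->
  radial_kernel eta ->
  distr_cvg0 Q
    (fun l => distr_of Q (fun z => J1 Omega eta rho u l z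
                                   - J3 Omega eta rho p u l z))
    (defect Q rho p u f).
Proof.
move=> Q oO T0 euler Lu Lp Lf Lrho c0 rhoc reta.
(* Dimension zero is set apart because [time_kernel_exists] takes its bump from a coordinate
   axis. *)
case: d Omega rho p u f eta @Q oO euler Lu Lp Lf Lrho rhoc reta =>
  [|n] Omega rho p u f eta Q oO euler Lu Lp Lf Lrho rhoc reta; first exact: J_cvg_defect0.
move=> phi [sphi cK KQ]; set K := tsupp phi in cK KQ.
have oQ : open Q by apply: open_setX => //; exact: itv_open.
have mQ : measurable (Q : set (mspacetime R n.+1)) by exact: open_measurable_st.
have [del del0 hdel] := compact_neighborhood cK oQ KQ.
have [rad Kr] := compact_le_norm cK.
have clK : closed K by exact: closed_closure.
have phiK z : phi z != 0 -> K z by move=> h; apply: subset_closure.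
have phir z : phi z != 0 -> `|z| <= rad by move=> /phiK/Kr.
(* A bounded part of Q containing every point within [del] of the support: mollifications at scales
   up to [del] see the fields on [Q0] only. *)
pose Q0 : set (mspacetime R n.+1) :=
  Q `&` [set z : R * 'rV[R]_n.+1 | `|z| <= rad + del].
have mQ0 : measurable Q0 by apply: measurableI => //; exact: measurable_ball_st.
have Q0Q : Q0 `<=` Q by move=> w [].
have Q0rad (w : R * 'rV[R]_n.+1) : Q0 w -> `|w| <= rad + del by case.
have KQ0 z : K z -> forall w, `|z - w| <= del -> Q0 w.
  move=> Kz w zw; split; first exact: (hdel z Kz).
  rewrite /= -(subrK z w) (le_trans (ler_normD _ _))// addrC lerD ?Kr//.
  by rewrite distrC.
have [Gd [y [M [mGd GdQ0 aeGd Gdc src]]]] :=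
  sources_exist mQ mQ0 Q0Q Q0rad c0 Lu Lp Lf Lrho rhoc.
set GR := (X in sources _ _ _ _ X) in src.
set Gp := (X in sources _ _ _ _ _ X) in src.
set Gm := (X in sources _ _ _ _ _ _ X) in src.
set Gb := (X in sources _ _ _ _ _ _ _ X) in src.
set GS := (X in sources _ _ _ _ _ _ _ _ X) in src.
have inG (g : mspacetime R n.+1 -> R) w : Gd w -> g w = (g \_ Gd) w.
  by move=> Gw; rewrite patchE mem_set.
have GdR w : Gd w -> rho w = GR w.
  by move=> Gw; rewrite /GR -inG// indicE memNset ?mulr0 ?addr0// => -[].
have Gdp w : Gd w -> p w = Gp w by exact: inG.
have Gdm i w : Gd w -> rho w * u w ord0 i = Gm i w by exact: inG.
have Gdb i w : Gd w -> rho w * f w ord0 i = Gb i w by exact: inG.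
have GdS i j w : Gd w -> rho w * tensor (u w) (u w) i j = GS i j w by exact: inG.
have aeQ0 (g G : mspacetime R n.+1 -> R) : (forall w, Gd w -> g w = G w) ->
    {ae lebesgue_st n.+1, forall w, Q0 w -> g w = G w}.
  by move=> gG; apply: (ae_imp aeGd) => w Gw /Gw/gG.
have iG i : (lebesgue_st n.+1).-integrable setT (EFin \o src_field GR Gp Gm Gb GS i).
  by have [] := src_field_integrable src i.
have [mrho _] := Lrho; have [mp _] := Lp.
have mu_ i : measurable_fun Q (fun z : mspacetime R n.+1 => u z ord0 i) by have [] := Lu i.
have mf i : measurable_fun Q (fun z : mspacetime R n.+1 => f z ord0 i) by have [] := Lf i.
have Hmass ka (ska : smooth ka) (kar : forall z, ka z != 0 -> `|z| <= del) z (Kz : K z) :=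
  mollified_mass mQ Q0Q euler (iG iR) (fun i => iG (im i)) mrho mu_ (aeQ0 _ _ GdR)
    (fun i => aeQ0 _ _ (Gdm i)) ska kar (KQ0 z Kz).
have Hmomentum ka (ska : smooth ka) (kar : forall z, ka z != 0 -> `|z| <= del) z (Kz : K z) :=
  mollified_momentum mQ Q0Q euler (iG ip) (fun i => iG (im i)) (fun i => iG (ib i))
    (fun i j => iG (iS i j)) mrho mp mu_ mf (aeQ0 _ _ Gdp)
    (fun i => aeQ0 _ _ (Gdm i)) (fun i => aeQ0 _ _ (Gdb i))
    (fun i j => aeQ0 _ _ (GdS i j)) ska kar (KQ0 z Kz).
have [L1 L10 phiL1] := kernel_bounded sphi phir.
have [L2 L20 phiL2] := derive_kernel_bounded sphi phir (1, 0).
have /choice[L3 L3P] j : exists L3 : R, 0 <= L3 /\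
    forall z, `|'D_((0, basis_vec j) : spacetime R n.+1) phi z| <= L3.
  by have [L3 ? ?] := derive_kernel_bounded sphi phir (0, basis_vec j); exists L3.
pose L := L1 + L2 + \sum_j L3 j.
have L30 : 0 <= \sum_j L3 j by apply: sumr_ge0 => j _; have [] := L3P j.
have L0 : 0 <= L by rewrite !addr_ge0.
have phiL z : `|phi z| <= L.
  by rewrite (le_trans (phiL1 z))// /L -addrA lerDl addr_ge0.
have phitL z : `|'D_((1, 0) : spacetime R n.+1) phi z| <= L.
  by rewrite (le_trans (phiL2 z))// /L addrAC lerDr addr_ge0.
have phixL j z : `|'D_((0, basis_vec j) : spacetime R n.+1) phi z| <= L.
  have [_ h] := L3P j; rewrite (le_trans (h z))//.
  rewrite (@le_trans _ _ (\sum_j L3 j))//; last by rewrite /L lerDr addr_ge0.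
  by rewrite (bigD1 j)//= lerDl sumr_ge0// => i _; have [] := L3P i.
have tk (r : R) : 0 < r -> exists th, time_kernel r th by move=> /(time_kernel_exists reta).
have lim := scale_limit src del0 clK Kr sphi phiK KQ0 L0 phiL phitL phixL tk Hmass Hmomentum
  (fun l l0 => space_kernel_scaled reta l0).
rewrite -(flux_defect Q0Q GdR Gdp Gdm Gdb GdS Gdc aeGd src del0 clK Kr sphi phiK KQ0 L0
  phiL phitL phixL).
apply: cvg_trans lim; apply: near_eq_cvg; near=> l.
apply/esym/(distr_of_J Q0Q GdR Gdp Gdm GdS aeGd src del0 phiK KQ0 reta).
- by near: l; exact: nbhs_right_gt.
- by near: l; exact: nbhs_right_lt.
Unshelve. all: by end_near. Qed.
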